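(* Let $X$ be a complete separable metric space, $\mu$ a Radon measure on $X$, $S\subset X$ Borel, $\mathcal A$ a Lipschitz Alberti representation of $\mu\llcorner S$, and let $I\subset\mathbb R$ be a nondegenerate compact interval. Then there is a Lipschitz Alberti representation $\mathcal A'=(P',\nu')$ of $\mu\llcorner S$ with $$P'\left(\operatorname{Frag}(X)\setminus\operatorname{Frag}(I;X)\right)=0$$ and such that (1) $D_{\mathcal A'}=D_{\mathcal A}$. (2) If $\mathcal A$ satisfies a set of conditions on the Lipschitz constant, bi-Lipschitz constants, speed and direction (i.e. any collection of conditions of the form: $\mathcal A$ is $C$-Lipschitz; $\mathcal A$ is $(C,D)$-bi-Lipschitz; $\mathcal A$ has $f$-speed $\ge\delta$; $\mathcal A$ is in the $f$-direction of a cone field $\mathcal C$), then so does $\mathcal A'$.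
   Context: Fragments: a fragment in $X$ is a bi-Lipschitz map $\gamma\colon K\to X$ with $K=\operatorname{dom}\gamma\subset\mathbb R$ compact of positive Lebesgue measure; $\operatorname{Frag}(X)$ is the set of fragments, topologized by identifying $\gamma$ with its graph in the space of nonempty compact subsets of $\mathbb R\times X$ with the Hausdorff distance; $\operatorname{Frag}(I;X)$ is the subset of fragments with $\operatorname{dom}\gamma\subset I$. The metric differential is $\operatorname{md}\gamma(t)=\lim_{\operatorname{dom}\gamma\ni t'\to t}d(\gamma(t'),\gamma(t))/|t'-t|$; for $f$ Lipschitz $(f\circ\gamma)'(t)$ is likewise computed along $\operatorname{dom}\gamma$ (both exist for a.e. $t$). Alberti representations: an Alberti representation of a Radon measure $\mu'$ on $X$ is a pair $\mathcal A=(P,\nu)$ where (1) $P$ is a regular Borel probability measure on $\operatorname{Frag}(X)$; (2) $\gamma\mapsto\nu_\gamma$ assigns to each fragment a finite nonnegative Borel measure on $X$, absolutely continuous with respect to the 1-dimensional Hausdorff measure on the image of $\gamma$, and $\gamma\mapsto\int h\,d\nu_\gamma$ is Borel for each $h\in C_c(X)$; (3) $\mu'(A)=\int\nu_\gamma(A)\,dP(\gamma)$ for all Borel $A$; (4) for all Borel $A\subset X$ and reals $a\le b$, $\gamma\mapsto\nu_\gamma(A\cap\gamma(\operatorname{dom}\gamma\cap[a,b]))$ is Borel. It is $C$-Lipschitz (resp. $(C,D)$-bi-Lipschitz) if $P$-a.e. $\gamma$ is $C$-Lipschitz (resp. satisfies $C|t-s|\le d(\gamma(t),\gamma(s))\le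 D|t-s|$), and Lipschitz if it is $C$-Lipschitz for some $C$. For $f\colon X\to\mathbb R$ Lipschitz and $\delta$ a Borel function it has $f$-speed $\ge\delta$ if for $P$-a.e. $\gamma$ and a.e. $t\in\operatorname{dom}\gamma$, $(f\circ\gamma)'(t)\ge\delta(\gamma(t))\operatorname{md}\gamma(t)$. For $f\colon X\to\mathbb R^q$ Lipschitz it is in the $f$-direction of the cone field $\mathcal C(v,\alpha)$ ($v\colon X\to\mathbb S^{q-1}$, $\alpha\colon X\to(0,\pi/2)$ Borel) if for $P$-a.e. $\gamma$ and a.e. $t\in\operatorname{dom}\gamma$, $u=(f\circ\gamma)'(t)$ belongs to $\mathcal C(v(x),\alpha(x))$ with $x=\gamma(t)$, where $\mathcal C(w,\theta)=\{u\in\mathbb R^q:\tan\theta\,\langle w,u\rangle>\|\pi_w^\perp u\|_2\}$ and $\pi_w^\perp$ is the orthogonal projection onto the orthogonal complement of $w$. Associated derivation: for a Lipschitz Alberti representation $\mathcal A=(P,\nu)$ of $\mu'$, $D_{\mathcal A}$ is the linear map from the bounded real Lipschitz functions on $X$ to $L^\infty(\mu')$ given by $\int gD_{\mathcal A}f\,d\mu'=\int dP(\gamma)\int_X g\,\partial_\gamma f\,d\nu_\gamma$ for bounded Borel $g\in L^1(\mu')$, where $\partial_\gamma f(x)=(f\circ\gamma)'(\gamma^{-1}(x))$ if $x$ is in the image of $\gamma$ and the derivative exists, and $0$ otherwise. The zero measure is regarded as having a trivial Alberti representation satisfying every condition, with derivation $0$. *)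

(* Defs.v *)
From HB Require Import structures.
From mathcomp Require Import all_boot all_order all_algebra.
From mathcomp Require Import all_classical all_reals all_analysis.
From mathcomp Require Import measurable_realfun.
Import Order.TTheory GRing.Theory Num.Theory.
Import numFieldNormedType.Exports.

Set Implicit Arguments.
Unset Strict Implicit.
Unset Printing Implicit Defensive.

Local Open Scope classical_set_scope.
Local Open Scope ring_scope.

#[short(type="completeMetricType")]
HB.structure Definition CompleteMetric (R : numDomainType) :=
  {T of Complete T & Metric R T}.

Notation borel T := (g_sigma_algebraType (@open T)).

Definition separable (T : topologicalType) : Prop :=
  exists2 D : set T, countable D & dense D.

Section borel_measures.
Context (R : realType).

Definition regular_measure (T : ptopologicalType)
    (mu : {measure set (borel T) -> \bar R}) : Prop :=
  forall A : set (borel T), measurable A ->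
    mu A = ereal_inf [set mu U | U in [set U | @open T U /\ A `<=` U]] /\
    mu A = ereal_sup [set mu K | K in [set K | @compact T K /\ K `<=` A]].

Definition radon (T : ptopologicalType)
    (mu : {measure set (borel T) -> \bar R}) : Prop :=
  (forall x : T, exists U : set T, [/\ open U, U x & (mu U < +oo)%E]) /\
  (forall A : set (borel T), measurable A ->
    mu A = ereal_sup [set mu K | K in [set K | @compact T K /\ K `<=` A]]).

End borel_measures.

Section metric_notions.
Context (R : realType).

(* Extended-real valued so that no boundedness is needed for the infimum; on
   nonempty compact sets the value is finite. *)
Definition hausdorff_dist (M : pseudoMetricType R) (A B : set M) : \bar R :=
  ereal_inf [set e%:E | e in [set e : R | [/\ 0 < e,
    A `<=` \bigcup_(b in B) ball b e & B `<=` \bigcup_(a in A) ball a e]]].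

Lemma hausdorff_distP (M : pseudoMetricType R) (A B : set M) (e : R) :
  (hausdorff_dist A B < e%:E)%E <-> exists2 e', e' < e &
    [/\ 0 < e', A `<=` \bigcup_(b in B) ball b e' &
                B `<=` \bigcup_(a in A) ball a e'].
Proof.
split=> [/ereal_inf_lt[_ [e' He' <-]]|[e' e'e He']].
  by rewrite lte_fin => e'e; exists e'.
by apply: (@le_lt_trans _ _ e'%:E); rewrite ?lte_fin//;
  apply: ereal_inf_lbound; exists e'.
Qed.

Lemma hausdorff_distxx (M : pseudoMetricType R) (A : set M) (e : R) :
  0 < e -> (hausdorff_dist A A < e%:E)%E.
Proof.
move=> e0; apply/hausdorff_distP; exists (e / 2).
  by rewrite ltr_pdivrMr// ltr_pMr// ltr1n.
by split; rewrite ?divr_gt0// => a Aa; exists a => //;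
  apply: ballxx; rewrite divr_gt0.
Qed.

Lemma hausdorff_dist_sym (M : pseudoMetricType R) (A B : set M) (e : R) :
  (hausdorff_dist A B < e%:E)%E -> (hausdorff_dist B A < e%:E)%E.
Proof.
by move=> /hausdorff_distP[e' ? []] *; apply/hausdorff_distP; exists e'.
Qed.

Lemma hausdorff_dist_triangle (M : pseudoMetricType R) (A B C : set M)
    (e1 e2 : R) :
  (hausdorff_dist A B < e1%:E)%E -> (hausdorff_dist B C < e2%:E)%E ->
  (hausdorff_dist A C < (e1 + e2)%:E)%E.
Proof.
move=> /hausdorff_distP[d1 de1 [d10 AB BA]] /hausdorff_distP[d2 de2 [d20 BC CB]].
apply/hausdorff_distP; exists (d1 + d2); first by rewrite ltrD.
split; first by rewrite addr_gt0.
- move=> a /AB[b /BC[c Cc cb] ba]; exists c => //.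
  by rewrite addrC; apply: ball_triangle cb ba.
- move=> c /CB[b /BA[a Aa ab] bc]; exists a => //.
  by apply: ball_triangle ab bc.
Qed.

Context (X : metricType R).

(* 0 is added to the set so that the empty set has diameter 0. *)
Definition diam (E : set X) : \bar R :=
  ereal_sup ([set 0%E] `|` [set (mdist p.1 p.2)%:E | p in E `*` E]).

Definition hausdorff1 (A : set X) : \bar R :=
  ereal_sup [set ereal_inf [set (\sum_(0 <= i <oo) diam (E i))%E |
      E in [set E : nat -> set X |
        A `<=` \bigcup_i E i /\ forall i, (diam (E i) <= d%:E)%E]] |
    d in [set d : R | 0 < d]].

Definition lipschitz_fun (f : X -> R) : Prop :=
  exists L : R, forall x y, `|f x - f y| <= L * mdist x y.

End metric_notions.

Section euclidean.
Context (R : realType) (q : nat).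
Implicit Types u v w : 'rV[R]_q.

Definition dot u v : R := \sum_(i < q) u 0 i * v 0 i.

Definition norm2 u : R := Num.sqrt (dot u u).

(* For a unit vector w, u - <w,u> w is the orthogonal projection of u onto the
   orthogonal complement of w. *)
Definition cone w (theta : R) : set 'rV[R]_q :=
  [set u | norm2 (u - dot w u *: w) < tan theta * dot w u].

Definition lipschitz_vec (X : metricType R) (f : X -> 'rV[R]_q) : Prop :=
  exists L : R, forall x y, norm2 (f x - f y) <= L * mdist x y.

End euclidean.

Section fragments.
Context (R : realType) (X : completeMetricType R).

(* A fragment is a map K -> X.  It is stored as a total map that takes the
   fixed value point outside of K, so that two fragments are equal if and only
   if they have the same domain and agree on it. *)
Record frag := Frag {
  dom : set R;
  fmap :> R -> X;
  dom_compact : compact dom;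
  dom_gt0 : (0 < @lebesgue_measure R dom)%E;
  fmap_bilip : exists c C : R, 0 < c /\
    forall t s, dom t -> dom s ->
      c * `|t - s| <= mdist (fmap t) (fmap s) <= C * `|t - s|;
  fmap_out : forall t, ~ dom t -> fmap t = point }.

Definition graph (g : frag) : set (R * X) := [set (t, g t) | t in dom g].

Definition frag_ball (g : frag) (e : R) : set frag :=
  [set h | (hausdorff_dist (graph g) (graph h) < e%:E)%E].

Let frag_ent : set_system (frag * frag) := entourage_ frag_ball.

Let frag_nbhs (g : frag) : set_system frag := nbhs_ frag_ent g.

Let frag_nbhsE : frag_nbhs = nbhs_ frag_ent. Proof. by []. Qed.

Let frag_ball_center (g : frag) (e : R) : 0 < e -> frag_ball g e g.
Proof. exact: hausdorff_distxx. Qed.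

Let frag_ball_sym (g h : frag) (e : R) : frag_ball g e h -> frag_ball h e g.
Proof. exact: hausdorff_dist_sym. Qed.

Let frag_ball_triangle (g h k : frag) (e1 e2 : R) :
  frag_ball g e1 h -> frag_ball h e2 k -> frag_ball g (e1 + e2) k.
Proof. exact: hausdorff_dist_triangle. Qed.

Let frag_entE : frag_ent = entourage_ frag_ball. Proof. by []. Qed.

HB.instance Definition _ := gen_eqMixin frag.
HB.instance Definition _ := gen_choiceMixin frag.
HB.instance Definition _ := hasNbhs.Build frag frag_nbhs.
HB.instance Definition _ := @Nbhs_isPseudoMetric.Build R frag
  frag_ent frag_nbhsE frag_ball frag_ball_center frag_ball_sym
  frag_ball_triangle frag_entE.

(* Measurable spaces are required to have a base point, but frag is empty for
   some X (e.g. when X is finite).  frag_at g0 is the space of fragments, with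
   the fragment g0 as base point. *)
Definition frag_at (g0 : frag) : Type := frag.
HB.instance Definition _ (g0 : frag) := PseudoMetric.on (frag_at g0).
HB.instance Definition _ (g0 : frag) := isPointed.Build (frag_at g0) g0.

Definition image_frag (g : frag) : set X := g @` dom g.

Definition cvg_along (g : frag) (t : R) (F : R -> R) (l : R) : Prop :=
  limit_point (dom g) t /\ F s @[s --> within (dom g) t^'] --> l.

Definition is_md (g : frag) (t m : R) : Prop :=
  cvg_along g t (fun s => mdist (g s) (g t) / `|s - t|) m.

Definition is_deriv_along (g : frag) (f : X -> R) (t l : R) : Prop :=
  cvg_along g t (fun s => (f (g s) - f (g t)) / (s - t)) l.

Definition is_deriv_along_vec (q : nat) (g : frag) (f : X -> 'rV[R]_q)
    (t : R) (u : 'rV[R]_q) : Prop :=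
  forall i : 'I_q, is_deriv_along g (fun x => f x 0 i) t (u 0 i).

(* t is unique, since fragments are injective, and so is l; the value is 0 when
   there are no such t and l. *)
Definition partial_frag (g : frag) (f : X -> R) (x : X) : R :=
  xget 0 [set l | exists t, [/\ dom g t, g t = x & is_deriv_along g f t l]].

Definition lip_frag (C : R) (g : frag) : Prop :=
  forall t s, dom g t -> dom g s -> mdist (g t) (g s) <= C * `|t - s|.

Definition bilip_frag (C D : R) (g : frag) : Prop :=
  forall t s, dom g t -> dom g s ->
    C * `|t - s| <= mdist (g t) (g s) <= D * `|t - s|.

Definition speed_frag (f : X -> R) (delta : X -> R) (g : frag) : Prop :=
  {ae @lebesgue_measure R, forall t, dom g t ->
    exists l m, [/\ is_deriv_along g f t l, is_md g t m &
                    delta (g t) * m <= l]}.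

Definition direction_frag (q : nat) (f : X -> 'rV[R]_q) (v : X -> 'rV[R]_q)
    (alpha : X -> R) (g : frag) : Prop :=
  {ae @lebesgue_measure R, forall t, dom g t ->
    exists2 u, is_deriv_along_vec g f t u & cone (v (g t)) (alpha (g t)) u}.

End fragments.

Section alberti.
Context (R : realType) (X : completeMetricType R).

(* alberti_triv is the trivial representation of the zero measure; it is needed
   as a separate case because there may be no fragments at all. *)
Inductive alberti_data :=
| alberti_triv
| alberti_pair (g0 : frag X) (P : probability (borel (frag_at g0)) R)
    (nu : frag X -> {finite_measure set (borel X) -> \bar R}).

Definition alberti_rep (mu : {measure set (borel X) -> \bar R})
    (A : alberti_data) : Prop :=
  match A with
  | alberti_triv => forall B : set (borel X), measurable B -> mu B = 0%E
  | alberti_pair g0 P nu =>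
    [/\ regular_measure P,
        (forall g, nu g `<< (fun B : set (borel X) =>
                               hausdorff1 (B `&` image_frag g))) /\
        (forall h : X -> R, continuous h ->
           compact (closure [set x | h x != 0]) ->
           measurable_fun [set: borel (frag_at g0)]
             ((fun g => \int[nu g]_x (h x)%:E)%E : borel (frag_at g0) -> \bar R)),
        (forall B : set (borel X), measurable B ->
           mu B = (\int[P]_g nu g B)%E) &
        (forall (B : set (borel X)) (a b : R), measurable B -> a <= b ->
           measurable_fun [set: borel (frag_at g0)]
             ((fun g : frag X => nu g (B `&` g @` (dom g `&` `[a, b]))) :
                borel (frag_at g0) -> \bar R))]
  end.

Definition alberti_ae (A : alberti_data) (Q : frag X -> Prop) : Prop :=
  match A with
  | alberti_triv => True
  | alberti_pair g0 P nu => {ae P, forall g, Q g}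
  end.

Definition lip_alberti (C : R) (A : alberti_data) : Prop :=
  alberti_ae A (lip_frag C).

Definition lipschitz_alberti (A : alberti_data) : Prop :=
  exists C, lip_alberti C A.

Definition bilip_alberti (C D : R) (A : alberti_data) : Prop :=
  alberti_ae A (bilip_frag C D).

Definition speed_alberti (f delta : X -> R) (A : alberti_data) : Prop :=
  alberti_ae A (speed_frag f delta).

Definition direction_alberti (q : nat) (f v : X -> 'rV[R]_q) (alpha : X -> R)
    (A : alberti_data) : Prop :=
  alberti_ae A (direction_frag f v alpha).

Definition alberti_supported (I : set R) (A : alberti_data) : Prop :=
  match A with
  | alberti_triv => True
  | alberti_pair g0 P nu => P [set g : frag X | ~ dom g `<=` I] = 0%E
  end.

Definition derivation_integral (A : alberti_data) (f g : X -> R) : \bar R :=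
  match A with
  | alberti_triv => 0%E
  | alberti_pair g0 P nu =>
    (\int[P]_c \int[nu c]_x (g x * partial_frag c f x)%:E)%E
  end.

(* The element D_A f of L^oo(mu), as the class of all its representatives. *)
Definition derivation (mu : {measure set (borel X) -> \bar R})
    (A : alberti_data) (f : X -> R) : set (borel X -> R) :=
  [set h | h \in Lfun mu +oo%E /\
    forall g : borel X -> R, measurable_fun [set: borel X] g ->
      (exists M : R, forall x, `|g x| <= M) ->
      mu.-integrable [set: borel X] (EFin \o g) ->
      (\int[mu]_x (g x * h x)%:E)%E = derivation_integral A f g].

End alberti.

(* Main.v *)
From HB Require Import structures.
Require Import Defs.
From mathcomp Require Import all_boot all_order all_algebra.
From mathcomp Require Import all_classical all_reals all_analysis.
From mathcomp Require Import measurable_realfun ring lra.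
Import Order.TTheory GRing.Theory Num.Theory.
Import numFieldNormedType.Exports.

Set Implicit Arguments.
Unset Strict Implicit.
Unset Printing Implicit Defensive.

Local Open Scope classical_set_scope.
Local Open Scope ring_scope.

(** The idea is to cut every fragment into short pieces and to move the pieces
    into [a, b].  Let delta be half of the length of [a, b].  The line is the
    disjoint union of the half-open cells [z delta, (z + 1) delta[, and the
    piece of g over a closed cell, if it has positive measure, is a fragment
    whose domain has diameter at most delta.  The new representation draws a
    fragment g from P, a cell with a suitable weight, and takes the translated
    piece g' of g; nu' g' is the part of nu g that is carried by the half-open
    cell, divided by the weight.  Summing over the cells gives back nu g, so
    the same measure is represented.  Lipschitz constants, metric differentials
    and derivatives along g are invariant under translation, and they are
    inherited by a restriction at almost every point of its domain.  Since
    nu g is absolutely continuous with respect to length and a Lipschitz map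
    sends null sets to null sets, almost every means nu g-almost everywhere
    too.

    The measure nu' g' has to depend on the fragment g' alone, while many pairs
    of a cell and a fragment can have the same translated piece.  There is
    room in [a, b] to prevent this: a piece of length at most delta may start
    anywhere in [a, a + delta], and its starting point is used to record a real
    number that encodes the cell and the whole fragment g (normal_piece,
    normal_piece_inj).  The code is made of the answers to countably many
    questions on g: which closed rational boxes its graph meets, and which
    cells its domain charges (family, family_separates).

    Borel measurability of the inverse of this map is obtained as follows.
    Inner regularity of P gives compact sets of fragments, of measure as close
    to 1 as desired, on which each answer is locally constant
    (splitting_compact).  On such a set the map from g to its normal piece is
    continuous (near_normal_piece): two close fragments meet the same boxes, so
    their pieces have close graphs, and their codes agree up to a late digit.
    A continuous injection of a compact set is a homeomorphism, so that the
    images of the pieces are countable unions of compact sets, the inverse maps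
    are Borel, and the new probability measure is regular (Section transport).

    Measurability in g of the integrals against nu g is a matter of lambda
    systems: the condition on parameter intervals says that the images of nu g
    under x |-> (g^-1(x), x) form a measurable kernel
    (measurable_nu_integral).  All integrals against the new representation
    are then computed by one change of variables (moved_integralE).

    For the derivation, the derivative along g is compared with a function
    that is measurable in g and in the parameter together.  The McShane
    extension t |-> inf_s (f (g s) + Lam |t - s|) is measurable in g and
    Lipschitz in t, hence differentiable for almost every t, and at a limit
    point of the domain its derivative is the derivative of f along g
    (partial_frag_velocity).  Both derivations are thereby integrals of
    measurable functions up to null sets, and the change of variables turns
    one into the other (derivation_integral_moved). *)

(** * The space of fragments *)

Lemma hausdorff_prod (S T : topologicalType) :
  hausdorff_space S -> hausdorff_space T -> hausdorff_space (S * T)%type.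
Proof.
move=> hS hT [p1 p2] [q1 q2] pq; congr pair.
- apply: hS => A B pA qB.
  have [[u v] [/= [Au _] [Bu _]]] : (A `*` [set: T]) `&` (B `*` [set: T]) !=set0.
    by apply: (pq (A `*` [set: T]) (B `*` [set: T]));
       [exists (A, setT)|exists (B, setT)] => //=; split => //; exact: filterT.
  by exists u.
- apply: hT => A B pA qB.
  have [[u v] [/= [_ Au] [_ Bu]]] : ([set: S] `*` A) `&` ([set: S] `*` B) !=set0.
    by apply: (pq ([set: S] `*` A) ([set: S] `*` B));
       [exists (setT, A)|exists (setT, B)] => //=; split => //; exact: filterT.
  by exists v.
Qed.

Section fragment_space.
Context (R : realType) (X : completeMetricType R).
Implicit Types (g h : frag X) (t s e : R).

Lemma frag_continuous g t : dom g t ->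
  g s @[s --> within (dom g) (nbhs t)] --> g t.
Proof.
move=> gt; have [c [C [c0 gC]]] := fmap_bilip g.
apply/metricType_numDomainType.cvgrPdist_lt => e e0.
have C1 : 0 < `|C| + 1 by rewrite ltr_wpDl.
near=> s.
have gs : dom g s by near: s; exact: withinT.
have /andP[_ /le_lt_trans] := gC t s gt gs; apply.
rewrite (@le_lt_trans _ _ ((`|C| + 1) * `|t - s|))//.
  by rewrite ler_wpM2r// (le_trans (ler_norm _))// lerDl.
rewrite mulrC -ltr_pdivlMr//.
near: s; apply: cvg_within.
by apply: (nbhsx_ballx t); rewrite divr_gt0.
Unshelve. all: by end_near. Qed.

Lemma compact_graph g : compact (graph g).
Proof.
apply: continuous_compact; last exact: dom_compact.
apply/subspace_continuousP => t gt.
have : (s, g s) @[s --> within (dom g) (nbhs t)] --> (t, g t).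
  have h1 : s @[s --> within (dom g) (nbhs t)] --> t by exact: cvg_within.
  exact: (cvg_pair h1 (frag_continuous gt)).
exact.
Qed.

Lemma frag_inj g t s : dom g t -> dom g s -> g t = g s -> t = s.
Proof.
move=> gt gs gts; have [c [C [c0 gC]]] := fmap_bilip g.
have /andP[+ _] := gC t s gt gs.
rewrite gts mdistxx pmulr_rle0// normr_le0 subr_eq0.
by move/eqP.
Qed.

Lemma frag_eqP g h : graph g = graph h -> g = h.
Proof.
move=> gh.
have dgh : dom g = dom h.
  apply/seteqP; split=> t Kt.
    have : graph g (t, g t) by exists t.
    by rewrite gh => -[s hs [<-]].
  have : graph h (t, h t) by exists t.
  by rewrite -gh => -[s hs [<-]].
have fgh : g = h :> (R -> X).
  apply/funext => t; have [Kt|Kt] := pselect (dom g t); last first.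
    by rewrite !fmap_out// -dgh.
  have : graph g (t, g t) by exists t.
  by rewrite gh => -[s hs [-> ->]].
case: g h dgh fgh {gh} => [d f ? ? ? ?] [d' f' ? ? ? ?] /= dd' ff'.
by subst d' f'; congr Frag; exact: Prop_irrelevance.
Qed.

Lemma frag_ball_graph g e h : frag_ball g e h ->
  (forall z, graph g z -> exists2 w, graph h w & ball z e w) /\
  (forall z, graph h z -> exists2 w, graph g w & ball z e w).
Proof.
move=> /hausdorff_distP[e' e'e [e'0 gh hg]]; split=> z.
  by move=> /gh[w hw /ball_sym wz]; exists w => //; apply: le_ball wz; exact: ltW.
by move=> /hg[w hw /ball_sym wz]; exists w => //; apply: le_ball wz; exact: ltW.
Qed.

Lemma frag_ball_of_graph g e e' h : 0 < e' -> e' < e ->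
  (forall z, graph g z -> exists2 w, graph h w & ball z e' w) ->
  (forall z, graph h z -> exists2 w, graph g w & ball z e' w) ->
  frag_ball g e h.
Proof.
move=> e'0 e'e gh hg; apply/hausdorff_distP; exists e' => //; split => // z.
  by move=> /gh[w hw zw]; exists w => //; exact: ball_sym.
by move=> /hg[w hw zw]; exists w => //; exact: ball_sym.
Qed.

Lemma nbhs_frag_ball g e : 0 < e -> \forall h \near g, frag_ball g e h.
Proof. by move=> e0; apply: (nbhsx_ballx g). Qed.

(** A graph is compact, so it keeps a positive distance from a closed set
    that it misses. *)
Lemma near_disjoint_graph g (F : set (R * X)) : closed F ->
  graph g `&` F = set0 -> \forall h \near g, graph h `&` F = set0.
Proof.
move=> cF gF.
pose P e (z : R * X) := forall w : R * X, ball z e w -> ~ F w.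
have : \forall e \near 0^'+, graph g `<=` P e.
  apply: (iffLR (compact_near_coveringP (graph g))); first exact: compact_graph.
  move=> z gz.
  have : nbhs z (~` F).
    apply: open_nbhs_nbhs; split; first exact: closed_openC.
    by move=> Fz; rewrite -[False]/(set0 z) -gF.
  rewrite -nbhs_ballE => -[r /= r0 rF].
  have r20 : 0 < r / 2 by rewrite divr_gt0.
  exists (ball z (r / 2), [set e | 0 < e < r / 2]) => /=.
    split; first exact: nbhsx_ballx.
    near=> e.
    apply/andP; split; near: e; [exact: nbhs_right_gt|exact: nbhs_right_lt].
  move=> [z' e]/= [zz'] /andP[e0 er] w z'w; apply: rF.
  rewrite (splitr r); apply: ball_triangle zz' _.
  by apply: le_ball z'w; exact: ltW.
move=> near_e; near (0 : R)^'+ => e.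
have e0 : 0 < e by near: e; exact: nbhs_right_gt.
have egF : graph g `<=` P e by near: e.
near=> h; have /frag_ball_graph[_ hg] : frag_ball g e h.
  by near: h; exact: nbhs_frag_ball.
apply/seteqP; split => // w [hw Fw].
have [z gz /ball_sym zw] := hg _ hw.
exact: egF zw Fw.
Unshelve. all: by end_near. Qed.

Definition meets (F : set (R * X)) : set (frag X) :=
  [set g | graph g `&` F !=set0].

Lemma closed_meets (F : set (R * X)) : closed F -> closed (meets F).
Proof.
move=> cF; rewrite -[meets F]setCK; apply: open_closedC.
rewrite openE => g /= gF.
have gF0 : graph g `&` F = set0.
  by apply/seteqP; split => // z gFz; case: gF; exists z.
by apply: filterS (near_disjoint_graph cF gF0) => h hF -[z]; rewrite hF.
Qed.

Lemma open_meets (U : set (R * X)) : open U -> open (meets U).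
Proof.
move=> oU; rewrite openE => g /= [z [gz Uz]].
have : nbhs z U by exact: open_nbhs_nbhs.
rewrite -nbhs_ballE => -[e /= e0 eU]; rewrite /interior /=; near=> h.
have /frag_ball_graph[gh _] : frag_ball g e h.
  by near: h; exact: nbhs_frag_ball.
by have [w hw zw] := gh _ gz; exists w; split => //; exact: eU.
Unshelve. all: by end_near. Qed.

(** A point of one graph that is not on the other one has a neighbourhood
    which small perturbations of the other graph avoid. *)
Lemma hausdorff_frag : hausdorff_space (frag X).
Proof.
have disj (g h : frag X) (z : R * X) : graph g z -> ~ graph h z -> ~ cluster (nbhs g) h.
  move=> gz hz; have chz : closed (graph h).
    by apply: compact_closed; [apply: hausdorff_prod; [exact: Rhausdorff|exact:
        metric_hausdorff]|exact: compact_graph].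
  have : nbhs z (~` graph h).
    by apply: open_nbhs_nbhs; split => //; exact: closed_openC.
  rewrite -nbhs_ballE => -[e /= e0 zh] gh.
  have e20 : 0 < e / 2 by rewrite divr_gt0.
  have [k [gk hk]] := gh _ _ (nbhs_frag_ball g e20) (nbhs_frag_ball h e20).
  have [w kw zw] := (frag_ball_graph gk).1 _ gz.
  have [v hv wv] := (frag_ball_graph hk).2 _ kw.
  by apply: (zh v) => //; rewrite (splitr e); apply: ball_triangle zw wv.
move=> g h gh; apply: frag_eqP; apply/seteqP; split => z.
  by move=> gz; apply: contrapT => hz; exact: disj gz hz gh.
move=> hz; apply: contrapT => gz; apply: (disj h g z hz gz) => A B hA gB.
by rewrite setIC; exact: gh.
Qed.

Lemma compact_domI g (J : set R) : closed J -> compact (dom g `&` J).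
Proof. by move=> cJ; apply: compact_closedI => //; exact: dom_compact. Qed.

Lemma closed_fst (J : set R) : closed J -> closed ([set z | J z.1] : set (R * X)).
Proof. by move=> cJ; apply: (closed_comp _ cJ) => z _; exact: cvg_fst. Qed.

Lemma open_fst (J : set R) : open J -> open ([set z | J z.1] : set (R * X)).
Proof. by move=> cJ; apply: (open_comp _ cJ) => z _; exact: cvg_fst. Qed.

(** By outer regularity dom g `&` J has an open neighbourhood U of measure
    less than c, and the graphs close to the graph of g do not meet the strip
    over J minus U. *)
Lemma frag_measure_lt g (J : set R) (c : \bar R) : closed J ->
  (@lebesgue_measure R (dom g `&` J) < c)%E ->
  \forall h \near g, (@lebesgue_measure R (dom h `&` J) < c)%E.
Proof.
move=> cJ gJc; have cgJ := compact_domI (g := g) cJ.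
have mgJ : measurable (dom g `&` J) by exact: compact_measurable.
have foo := compact_finite_measure cgJ.
have [e e0 gJe] : exists2 e : R, 0 < e & (@lebesgue_measure R (dom g `&` J) + e%:E <= c)%E.
  have fgJ : (@lebesgue_measure R (dom g `&` J)) \is a fin_num by rewrite ge0_fin_numE.
  case: c gJc => [c| |] // gJc.
    exists (c - fine (@lebesgue_measure R (dom g `&` J))).
      by rewrite subr_gt0 -lte_fin fineK.
    by rewrite -{1}(fineK fgJ) -EFinD lee_fin addrC subrK.
    by exists 1 => //; rewrite leey.
  by rewrite ltNge leNye in gJc.
have [U [oU gJU Ue]] := lebesgue_regularity_outer mgJ foo e0.
have Uc : (@lebesgue_measure R U < c)%E.
  apply: lt_le_trans gJe.
  have -> : U = (U `\` (dom g `&` J)) `|` (dom g `&` J).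
    by rewrite setDKU.
  rewrite measureU//=; [|by apply: measurableD => //; exact: open_measurable|by rewrite setDE
      -setIA setICl setI0].
  by rewrite addeC lteD2lE// ge0_fin_numE.
have cF : closed ([set z | (J `\` U) z.1] : set (R * X)).
  by apply: closed_fst; rewrite setDE; apply: closedI => //; exact: open_closedC.
have gF : graph g `&` [set z | (J `\` U) z.1] = set0.
  apply/seteqP; split => // _ [[t gt <-]] [/= Jt Ut].
  by apply: Ut; apply: gJU.
apply: filterS (near_disjoint_graph cF gF) => h hF.
apply: le_lt_trans Uc; apply: le_measure; rewrite ?inE.
- by apply: compact_measurable; exact: compact_domI.
- exact: open_measurable.
- move=> t [ht Jt]; apply: contrapT => Ut.
  have : (graph h `&` [set z | (J `\` U) z.1]) (t, h t) by split; [exists t|split].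
  by rewrite hF.
Qed.

End fragment_space.

(** * Lipschitz images of null sets *)

Section null_images.
Context (R : realType) (X : completeMetricType R).
Implicit Types (g : frag X).

Lemma diam_ge0 (E : set X) : (0 <= diam E)%E.
Proof. by apply: ereal_sup_ubound; left. Qed.

Lemma hausdorff1_ge0 (B : set X) : (0 <= hausdorff1 B)%E.
Proof.
apply: ereal_sup_ge; eexists; first by exists (1 : R); [exact: ltr01|reflexivity].
by apply: le_ereal_inf_tmp => _ [E _ <-]; apply: nneseries_ge0 => *; exact: diam_ge0.
Qed.

Lemma le_hausdorff1 (A B : set X) : A `<=` B -> (hausdorff1 A <= hausdorff1 B)%E.
Proof.
move=> AB; apply: ge_ereal_sup => _ [d d0 <-].
apply: ereal_sup_ge; eexists; first by exists d => //; exact: d0.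
apply: ereal_inf_le_tmp => _ [E [BE Ed] <-]; exists E => //; split => //.
exact: subset_trans BE.
Qed.

(** A C-Lipschitz map sends a cover of N by intervals to a cover of the image
    whose diameters are at most C times the lengths of the intervals. *)
Lemma hausdorff1_null_image g (N : set R) :
  (@lebesgue_measure R).-negligible N -> hausdorff1 (g @` (dom g `&` N)) = 0%E.
Proof.
move=> [N' [mN' N'0 NN']].
have [c [C0 [_ gC0]]] := fmap_bilip g.
pose C := `|C0| + 1; have C_gt0 : 0 < C by rewrite ltr_wpDl.
have gC t s : dom g t -> dom g s -> mdist (g t) (g s) <= C * `|t - s|.
  move=> gt gs; have /andP[_ /le_trans] := gC0 t s gt gs; apply.
  by rewrite ler_wpM2r// (le_trans (ler_norm _))// lerDl.
apply/eqP; rewrite eq_le hausdorff1_ge0 andbT.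
apply: ge_ereal_sup => _ [d d0 <-]; apply/lee_addgt0Pr => e e0; rewrite add0e.
(* The total length eta makes each image smaller than d and the sum of their
   diameters at most e. *)
pose eta := Num.min e d / C; have eta0 : 0 < eta.
  by rewrite divr_gt0// lt_min e0.
have [F NF Feta] : exists2 F, open_itv_cover N' F &
    (\sum_(0 <= k <oo) wlength idfun (F k) <= eta%:E)%E.
  have : lebesgue_measure N' = 0%E by [].
  rewrite /lebesgue_measure /lebesgue_stieltjes_measure /measure_extension.
  rewrite outer_measure_open_itv_cover => infE.
  have : (ereal_inf [set (\sum_(k <oo) wlength idfun (F k))%E
      | F in open_itv_cover N'] < eta%:E)%E by rewrite infE lte_fin.
  by move=> /ereal_inf_lt[_ [F NF <-]] /ltW; exists F.
have l0 k : (0 <= wlength idfun (F k) :> \bar R)%E.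
  by case: NF => /(_ k)[ab -> _]; exact: wlength_itv_ge0.
pose E k := g @` (dom g `&` F k).
have diamE k : (diam (E k) <= C%:E * wlength idfun (F k))%E.
  apply: ge_ereal_sup => r [->|]; first by rewrite mule_ge0// lee_fin ltW.
  move=> [[_ _] [[t [gt Ft] <-] [s [gs Fs] <-]] <-] /=.
  rewrite (@le_trans _ _ (C * `|t - s|)%:E) ?lee_fin ?gC// EFinM.
  rewrite lee_wpmul2l ?lee_fin ?(ltW C_gt0)//.
  case: NF => /(_ k)[[a b] Fab _]; move: Ft Fs; rewrite Fab/= !in_itv/=.
  move=> /andP[at_ tb] /andP[as_ sb]; rewrite wlength_itv_bnd//=.
    by rewrite lee_fin ler_distl; apply/andP; split; lra.
  by lra.
have sumE : (\sum_(0 <= k <oo) C%:E * wlength idfun (F k) <= (Num.min e d)%:E)%E.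
  rewrite nneseriesZl; last by move=> k _; exact: l0.
  rewrite (@le_trans _ _ (C%:E * eta%:E)%E)//.
    by rewrite lee_wpmul2l// lee_fin ltW.
  by rewrite -EFinM lee_fin /eta mulrC divfK// gt_eqF.
apply: (@le_trans _ _ (\sum_(0 <= k <oo) diam (E k))%E).
  apply: ereal_inf_lbound; exists E => //; split.
    move=> _ [t [gt Nt] <-]; case: NF => _ /(_ t (NN' _ Nt))[k _ Fkt].
    by exists k => //; exists t.
  move=> k; apply: le_trans (diamE k) _.
  apply: (@le_trans _ _ (Num.min e d)%:E); last by rewrite lee_fin ge_min lexx orbT.
  apply: le_trans sumE.
  rewrite (nneseriesD1 (n := k))//; last first.
    by move=> i _; rewrite mule_ge0// lee_fin ltW.
  by rewrite leeDl// nneseries_ge0// => i _ _; rewrite mule_ge0// lee_fin ltW.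
apply: (@le_trans _ _ (Num.min e d)%:E); last by rewrite lee_fin ge_min lexx.
apply: le_trans sumE; apply: lee_nneseries => k *; [exact: diam_ge0|exact: diamE].
Qed.

End null_images.

(** * The inverse of a fragment *)

Section fragment_parameter.
Context (R : realType) (X : completeMetricType R).
Implicit Types (g : frag X).

Lemma closed_borel (T : ptopologicalType) (F : set T) :
  closed F -> measurable (F : set (borel T)).
Proof.
move=> cF; rewrite -(setCK F); apply: measurableC.
by apply: sub_sigma_algebra; exact: closed_openC.
Qed.

Lemma open_borel (T : ptopologicalType) (U : set T) :
  open U -> measurable (U : set (borel T)).
Proof. by move=> oU; exact: sub_sigma_algebra. Qed.

(** The image is the second projection of a compact part of the graph. *)
Lemma compact_image_frag g (F : set R) : closed F -> compact (g @` (dom g `&` F)).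
Proof.
move=> cF; have -> : g @` (dom g `&` F) = snd @` (graph g `&` [set z | F z.1]).
  apply/seteqP; split=> [_ [t [gt Ft] <-]|_ [_ [[t gt <-] /= Ft] <-]].
    by exists (t, g t) => //; split => //; exists t.
  by exists t.
apply: continuous_compact.
  by apply: continuous_subspaceT => z; exact: cvg_snd.
apply: compact_closedI; [exact: compact_graph|exact: closed_fst].
Qed.

Lemma compact_borel (A : set X) : compact A -> measurable (A : set (borel X)).
Proof.
by move=> cA; apply: closed_borel; apply: compact_closed => //; exact: metric_hausdorff.
Qed.

Lemma borel_image_frag g (F : set R) : closed F ->
  measurable (g @` (dom g `&` F) : set (borel X)).
Proof. by move=> cF; apply: compact_borel; exact: compact_image_frag. Qed.

Lemma image_fragE g : image_frag g = g @` (dom g `&` setT).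
Proof. by rewrite setIT. Qed.

Lemma measurable_image_frag g : measurable (image_frag g : set (borel X)).
Proof. by rewrite image_fragE; apply: borel_image_frag; exact: closedT. Qed.

Definition param g (x : borel X) : measurableTypeR R :=
  xget 0 [set t | dom g t /\ g t = x].

Lemma paramK g t : dom g t -> param g (g t) = t.
Proof.
move=> gt; rewrite /param; case: xgetP => [_ -> [gs gst]|/(_ t)/not_andP[]//].
exact: frag_inj gst.
Qed.

Lemma image_param g (F : set R) :
  g @` (dom g `&` F) = image_frag g `&` param g @^-1` F.
Proof.
apply/seteqP; split=> [_ [t [gt Ft] <-]|_ [[t gt <-]] /=].
  by split; [exists t|rewrite /= paramK].
by rewrite paramK// => Ft; exists t.
Qed.

Lemma param_out g x : ~ image_frag g x -> param g x = 0.
Proof.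
by move=> gx; rewrite /param xgetPN// => t [gt gtx]; apply: gx; exists t.
Qed.

(** The preimage of a closed half-line is the compact image of a part of the
    domain, up to the default value 0 off the image of g. *)
Lemma measurable_param g : measurable_fun [set: borel X] (param g).
Proof.
apply: (measurability _ (RGenCInfty.measurableE R)).
move=> _ [_ [x ->] <-]; rewrite setTI.
have mg := measurable_image_frag g.
have -> : param g @^-1` `[x, +oo[ = g @` (dom g `&` `[x, +oo[) `|`
    (~` image_frag g `&` [set _ | 0 \in `[x, +oo[]).
  rewrite image_param; apply/seteqP; split=> y.
    have [gy|gy] := pselect (image_frag g y); [by left|right; split => //].
    by move: H; rewrite /= (param_out gy).
  by move=> [[]//|[/param_out gy /= x0]]; rewrite /= gy.
apply: measurableU.
  by apply: borel_image_frag; exact: interval_closed.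
apply: measurableI; first exact: measurableC.
by case: (0 \in _); [rewrite (_ : [set _ | _] = setT)|rewrite (_ : [set _ | _] = set0)] => //;
  apply/seteqP; split.
Qed.

Definition lift g (x : borel X) : measurableTypeR R * borel X := (param g x, x).

Lemma measurable_lift g : measurable_fun [set: borel X] (lift g).
Proof. by apply/measurable_fun_pair; [exact: measurable_param|exact: measurable_id]. Qed.

End fragment_parameter.

(** * Integrals against nu as functions of the fragment *)

Section alberti_kernel.
Context (R : realType) (X : completeMetricType R) (g0 : frag X).
Variable nu : frag X -> {finite_measure set (borel X) -> \bar R}.
Hypothesis nu_ac : forall g, nu g `<< (fun B : set (borel X) =>
  hausdorff1 (B `&` image_frag g)).
Hypothesis nu_itv : forall (B : set (borel X)) (a b : R), measurable B -> a <= b ->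
  measurable_fun [set: borel (frag_at g0)]
    ((fun g : frag X => nu g (B `&` g @` (dom g `&` `[a, b]))) :
       borel (frag_at g0) -> \bar R).

Lemma nu_hausdorff0 (g : frag X) (B : set (borel X)) : measurable B ->
  hausdorff1 (B `&` image_frag g) = 0%E -> nu g B = 0%E.
Proof.
move=> mB B0; apply: (@nu_ac g B _ B mB) => // A mA AB; apply/eqP.
by rewrite eq_le hausdorff1_ge0 andbT -B0; apply: le_hausdorff1; exact: setSI.
Qed.

Lemma nu_image (g : frag X) (B : set (borel X)) : measurable B ->
  nu g B = nu g (B `&` image_frag g).
Proof.
move=> mB; have mg := measurable_image_frag g.
rewrite (measureDI (nu g) mB mg) [X in (X + _)%E](_ : _ = 0%E) ?add0e//.
apply: nu_hausdorff0; first exact: measurableD.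
rewrite (_ : _ `&` _ = g @` (dom g `&` set0)).
  by apply: hausdorff1_null_image; exact: negligible_set0.
by rewrite setI0 image_set0 setDE -setIA setICl setI0.
Qed.

(** A null set of parameters has an image of length 0, which nu g does not
    charge. *)
Lemma nu_null (g : frag X) (N : set R) : measurable N ->
  (@lebesgue_measure R).-negligible N -> nu g (param g @^-1` N) = 0%E.
Proof.
move=> mN N0; apply: nu_hausdorff0.
  by rewrite -[X in measurable X]setTI; apply: measurable_param.
by rewrite setIC -image_param; exact: hausdorff1_null_image.
Qed.

Definition lift_nu (g : borel (frag_at g0)) :
  {measure set (measurableTypeR R * borel X) -> \bar R} :=
  measure_function_pushforward__canonical__measure_function_Measure
    (nu g) (measurable_lift (g : frag X)).

Lemma lift_nuE (g : borel (frag_at g0)) (W : set (measurableTypeR R * borel X)) :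
  lift_nu g W = nu g (lift (g : frag X) @^-1` W).
Proof. by []. Qed.

Lemma lift_nu_fin (g : borel (frag_at g0)) (W : set (measurableTypeR R * borel X)) :
  measurable W -> lift_nu g W \is a fin_num.
Proof.
move=> mW; change (nu g (lift (g : frag X) @^-1` W) \is a fin_num).
rewrite fin_num_measure// -[X in measurable X]setTI.
exact: (measurable_lift (g : frag X)).
Qed.

Lemma lift_nu_lty (g : borel (frag_at g0)) (W : set (measurableTypeR R * borel X)) :
  measurable W -> (lift_nu g W < +oo)%E.
Proof. by move=> mW; rewrite ltey_eq lift_nu_fin. Qed.

(** The sets U for which this holds form a lambda system. It contains the
    compact intervals by hypothesis, hence their increasing unions, the
    closed half-lines. *)
Lemma measurable_nu_param (B : set (borel X)) (U : set (measurableTypeR R)) :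
  measurable B -> measurable U ->
  measurable_fun [set: borel (frag_at g0)]
    ((fun g : frag X => nu g (B `&` param g @^-1` U)) :
       borel (frag_at g0) -> \bar R).
Proof.
move=> mB; have mp (g : frag X) V : measurable V -> measurable (B `&` param g @^-1` V).
  move=> mV; apply: measurableI => //.
  by rewrite -[X in measurable X]setTI; apply: measurable_param.
have mE : (@measurable _ (measurableTypeR R)) = <<s @RGenCInfty.G R >>.
  exact: RGenCInfty.measurableE.
pose H := [set V : set (measurableTypeR R) | measurable V /\
  measurable_fun [set: borel (frag_at g0)]
    ((fun g : frag X => nu g (B `&` param g @^-1` V)) :
       borel (frag_at g0) -> \bar R)].
have Hseq : ndseq_closed H.
  move=> F ndF HF; split; first by apply: bigcupT_measurable => i; case: (HF i).
  apply: (emeasurable_fun_cvg (fun i (g : borel (frag_at g0)) =>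
    nu g (B `&` param (g : frag X) @^-1` (F i)))).
    by move=> i; case: (HF i).
  move=> g _; rewrite preimage_bigcup setI_bigcupr.
  apply: nondecreasing_cvg_mu.
  - by move=> i; apply: mp; case: (HF i).
  - by apply: bigcupT_measurable => i; apply: mp; case: (HF i).
  - move=> m n mn; apply/subsetPset; apply: setIS; apply: preimage_subset.
    by apply/subsetPset; exact: ndF.
have Hcc a b : a <= b -> H `[a, b]%classic.
  move=> ab; split => //; have := nu_itv mB ab.
  apply: eq_measurable_fun => g _ /=.
  rewrite image_param setIA [B `&` _]setIC -setIA.
  rewrite [RHS]nu_image; first by rewrite setIC.
  exact: mp.
have Hco a : H `[a, +oo[%classic.
  have -> : `[a, +oo[%classic = \bigcup_n `[a, a + n%:R]%classic.
    apply/seteqP; split=> [x /= ax|x [n _] /=]; last first.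
      by rewrite !in_itv/= andbT => /andP[].
    exists (Num.truncn (x - a)).+1 => //=; move: ax; rewrite !in_itv/= andbT => ->/=.
    by have := truncnS_gt (x - a); lra.
  apply: Hseq.
    move=> m n mn; apply/subsetPset; apply: subset_itvl.
    by rewrite bnd_simp lerD2l ler_nat.
  by move=> n; apply: Hcc; rewrite lerDl.
have HT : H setT.
  have -> : setT = \bigcup_n `[- n%:R : R, +oo[%classic.
    apply/seteqP; split => // x _; exists (Num.truncn `|x|).+1 => //=.
    rewrite in_itv/= andbT; have := truncnS_gt `|x|; have := ler_norm (- x); rewrite normrN; lra.
  apply: Hseq => // m n mn; apply/subsetPset; apply: subset_itvr.
  by rewrite bnd_simp lerN2 ler_nat.
rewrite mE => mU; suff : H U by case.
apply: (@lambda_system_subset _ (@RGenCInfty.G R) _ setT H) => //.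
- move=> _ _ [x ->] [y ->]; exists (Num.max x y).
  apply/seteqP; split=> z /=; rewrite !in_itv/= !andbT ge_max; first by move=> [-> ->].
  by move=> /andP[].
- split => //.
  move=> V W WV [mV HV] [mW HW]; split; first exact: measurableD.
  apply: (eq_measurable_fun (fun g : borel (frag_at g0) =>
    (nu g (B `&` param (g : frag X) @^-1` V) - nu g (B `&` param (g : frag X) @^-1` W))%E)).
    move=> g _ /=.
    have -> : B `&` param (g : frag X) @^-1` (V `\` W) =
      (B `&` param (g : frag X) @^-1` V) `\` (B `&` param (g : frag X) @^-1` W).
      by apply/seteqP; split => x /=; tauto.
    rewrite measureD; [|exact: mp|exact: mp|].
      by rewrite setIACA setIid -preimage_setI (setIidr WV).
    by rewrite ltey_eq fin_num_measure//; exact: mp.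
  exact: emeasurable_funB.
- by move=> _ [x ->]; exact: Hco.
Qed.

(** Rectangles, which measurable_nu_param deals with, generate the product
    sigma-algebra. *)
Lemma measurable_lift_nu (W : set (measurableTypeR R * borel X)) :
  measurable W -> measurable_fun [set: borel (frag_at g0)] (lift_nu ^~ W).
Proof.
have mp (g : frag X) (V : set (measurableTypeR R * borel X)) : measurable V -> measurable (lift
    g @^-1` V).
  by move=> mV; rewrite -[X in measurable X]setTI; apply: measurable_lift.
rewrite measurable_prod_measurableType => mW.
pose H := [set V : set (measurableTypeR R * borel X) | measurable V /\
  measurable_fun [set: borel (frag_at g0)] (lift_nu ^~ V)].
suff : H W by case.
pose C := [set U `*` B | U in @measurable _ (measurableTypeR R) & B in @measurable _ (borel X)].
have CH : C `<=` H.
  move=> _ [U mU [B mB <-]]; split; first exact: measurableX.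
  apply: eq_measurable_fun (measurable_nu_param mB mU) => g _.
  by rewrite lift_nuE setIC; congr (nu g _).
apply: (@lambda_system_subset _ C _ setT H) => //.
- move=> _ _ [U1 mU1 [B1 mB1 <-]] [U2 mU2 [B2 mB2 <-]].
  exists (U1 `&` U2); first exact: measurableI.
  by exists (B1 `&` B2); [exact: measurableI|rewrite setXI].
- split => //.
  + by apply: CH; exists setT => //; exists setT => //; rewrite setXTT.
  + move=> V V' VV' [mV HV] [mV' HV']; split; first exact: measurableD.
    apply: (eq_measurable_fun (fun g : borel (frag_at g0) => (lift_nu g V - lift_nu g V')%E)).
      move=> g _; change (lift_nu g V - lift_nu g V' = lift_nu g (V `\` V'))%E.
      rewrite measureD ?(setIidr VV')//.
      exact: lift_nu_lty.
    exact: emeasurable_funB.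
  + move=> F ndF HF; split; first by apply: bigcupT_measurable => i; case: (HF i).
    apply: (emeasurable_fun_cvg (fun i (g : borel (frag_at g0)) => lift_nu g (F i))).
      by move=> i; case: (HF i).
    move=> g _; apply: nondecreasing_cvg_mu => //.
      by move=> i; case: (HF i).
    by apply: bigcupT_measurable => i; case: (HF i).
Qed.

Import HBNNSimple.

(** The integrands met below depend on the fragment, on the parameter and on
    the point; here they are integrated against nu g. *)
Lemma measurable_nu_integral
    (k : borel (frag_at g0) * (measurableTypeR R * borel X) -> \bar R) :
  (forall z, (0 <= k z)%E) -> measurable_fun setT k ->
  measurable_fun [set: borel (frag_at g0)]
    ((fun g : frag X => \int[nu g]_x k (g, lift g x))%E :
       borel (frag_at g0) -> \bar R).
Proof.
move=> k0 mk.
apply: (eq_measurable_fun (fun g : borel (frag_at g0) => \int[lift_nu g]_z k (g, z))%E).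
  move=> g _; rewrite ge0_integral_pushforward//=.
    exact: measurable_lift.
  exact: measurableT_comp mk _.
apply: (@measurable_fun_xsection_integral _ _ _ _ _ k lift_nu (nnsfun_approx measurableT mk)) => //.
- by apply/nondecreasing_seqP => n; exact: nd_nnsfun_approx.
- by move=> z; apply: cvg_nnsfun_approx.
move=> n r; set A := _ @^-1` [set r].
apply: (eq_measurable_fun (fun g => mrestr (lift_nu g) measurableT (xsection A g))).
  by move=> g _; rewrite /mrestr setIT.
pose ker : R.-ker _ ~> _ := HB.pack lift_nu (isKernel.Build _ _ _ _ _ lift_nu measurable_lift_nu).
have mA : measurable A by apply: measurable_funPTI; exact: measurable_set1.
have [] := @measurable_prod_subset_xsection_kernel _ _ _ _ _ ker _ measurableT _ A mA => //.
move=> g; exists (fine (lift_nu g setT) + 1) => V mV; rewrite EFinD fineK ?lift_nu_fin//.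
apply: (@le_lt_trans _ _ (lift_nu g setT)).
  by rewrite /mrestr setIT; apply: le_measure; rewrite ?inE.
by rewrite lteDl ?lift_nu_fin// lte_fin.
Qed.

End alberti_kernel.

(** * Lipschitz functions on the line are differentiable almost everywhere *)

Section lipschitz_derivable.
Context (R : realType).
Local Notation leb := (@lebesgue_measure R).

Lemma stieltjes_itv (G : cumulative R R) (x y : R) : x <= y ->
  lebesgue_stieltjes_measure G `]x, y]%classic = (G y - G x)%:E.
Proof.
move=> xy; rewrite /lebesgue_stieltjes_measure /measure_extension.
by rewrite measurable_mu_extE/=; [rewrite wlength_itv_bnd|exact: is_ocitv].
Qed.

(** A cover of A by intervals of total length at most e / L has Stieltjes
    measure at most e. *)
Lemma stieltjes_lipschitz_ac (G : cumulative R R) (L : R) : 0 < L ->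
  (forall x y, x <= y -> G y - G x <= L * (y - x)) ->
  lebesgue_stieltjes_measure G `<< leb.
Proof.
move=> L0 GL; apply/null_content_dominatesP => A mA A0.
apply/eqP; rewrite eq_le measure_ge0 andbT.
apply/lee_addgt0Pr => e e0; rewrite add0e.
have : (mu_ext (wlength idfun) A < (e / L)%:E :> \bar R)%E.
  by rewrite [X in (X < _)%E](_ : _ = 0%E) ?lte_fin ?divr_gt0//.
move=> /ereal_inf_lt[_ [F [mF AF] <-]] /ltW Fe.
have l0 k : (0 <= wlength idfun (F k) :> \bar R)%E by exact: wlength_ge0.
have GF k : (wlength G (F k) <= L%:E * wlength idfun (F k))%E.
  have [->|[[a b] /= ab ->]] := (ocitvP (F k)).1 (mF k).
    by rewrite !wlength0 mule0.
  by rewrite !(wlength_itv_bnd _ _ _ (ltW ab)) -EFinM lee_fin GL// ltW.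
apply: (@le_trans _ _ (\sum_(k <oo) wlength G (F k))%E).
  by apply: ereal_inf_lbound; exists F.
apply: (@le_trans _ _ (\sum_(k <oo) (L%:E * wlength idfun (F k)))%E).
  by apply: lee_nneseries => k *; [exact: wlength_ge0|exact: GF].
rewrite nneseriesZl//.
apply: (@le_trans _ _ (L%:E * (e / L)%:E)%E).
  by rewrite lee_wpmul2l// lee_fin ltW.
by rewrite -EFinM lee_fin mulrC divfK// gt_eqF.
Qed.

(** On a bounded window the Stieltjes measure is finite and absolutely
    continuous. There G is, up to a constant, the indefinite integral of the
    Radon-Nikodym density, and the Lebesgue differentiation theorem applies. *)
Lemma cumulative_derivable_ae (G : cumulative R R) :
  lebesgue_stieltjes_measure G `<< leb ->
  {ae leb, forall t, derivable G t 1}.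
Proof.
move=> Gac.
pose D n : set (measurableTypeR R) := `](- n%:R), n%:R]%classic.
have mD n : measurable (D n) by exact: measurable_itv.
have nn n : (- n%:R : R) <= n%:R.
  by rewrite (@le_trans _ _ 0)// oppr_le0.
have GD n : (lebesgue_stieltjes_measure G (D n) < +oo)%E.
  by rewrite stieltjes_itv ?ltry.
suff main n : {ae leb, forall t, - n%:R < t < n%:R -> derivable G t 1}.
  have := ae_foralln main; apply: filterS => t tG.
  apply: (tG (Num.truncn `|t|).+1); rewrite -ltr_norml.
  exact: truncnS_gt.
pose nu : {finite_measure set _ -> \bar R} := mfrestr (mD n) (GD n).
have nuac : nu `<< leb.
  apply/null_content_dominatesP => A mA A0; rewrite /nu/= /mfrestr /mrestr.
  apply/eqP; rewrite eq_le measure_ge0 andbT.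
  rewrite -[leRHS]((null_content_dominatesP _ _).1 Gac A mA A0).
  apply: le_measure; rewrite ?inE//; first exact: measurableI.
have [f [f0 ffin fint nuf]] := radon_nikodym_sigma_finite nuac.
pose h := fine \o f.
have hint : leb.-integrable setT (EFin \o h).
  by apply: eq_integrable fint => // x _; rewrite /h/= fineK.
have /FTC1 : locally_integrable [set: R] h.
  by apply: open_integrable_locally hint; exact: openT.
move=> /(_ (BRight (- n%:R))) FTC.
have ihint y : leb.-integrable [set` Interval (BRight (- n%:R)) (BRight y)] (EFin \o h).
  by apply: integrableS hint => //; exact: measurable_itv.
move: (FTC ihint); apply: filterS; first exact: (ae_filter_ringOfSetsType leb).
move=> x hx /andP[xl xr].
have [|dx _] := hx; first by rewrite /= lte_fin.
pose Phi (y : R) : R := \int[leb]_(t in [set` Interval (BRight (- n%:R)) (BRight y)]) h t.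
have {}dx : derivable (fun y : R => Phi y + cst (G (- n%:R)) y) x 1.
  exact: (derivableD dx (derivable_cst (G (- n%:R)) x 1)).
apply: near_eq_derivable dx; near=> y => /=.
have : ball x (Num.min (x + n%:R) (n%:R - x)) y.
  by near: y; apply: nbhsx_ballx; rewrite lt_min; apply/andP; split; lra.
rewrite /ball/= lt_min !ltr_norml => /andP[/andP[_ xy] /andP[yx _]].
have {xy}ny : - n%:R <= y by lra.
have {yx}yn : y <= n%:R by lra.
rewrite /Phi /Rintegral.
have -> : (\int[leb]_(t in [set` Interval (BRight (- n%:R)%R) (BRight y)]) (h t)%:E)%E = (G y -
    G (- n%:R))%:E.
  rewrite -stieltjes_itv//.
  have -> : lebesgue_stieltjes_measure G `]- n%:R, y]%classic = nu `]- n%:R, y]%classic.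
    rewrite /nu/= /mfrestr /mrestr; congr (lebesgue_stieltjes_measure G _).
    by rewrite setIidl//; apply: subset_itvl; rewrite bnd_simp.
  rewrite nuf; last exact: measurable_itv.
  by apply: eq_integral => t _; rewrite /h/= fineK.
by rewrite /= subrK.
Unshelve. all: by end_near. Qed.

(** Adding the linear function K x makes F nondecreasing, and keeps it
    Lipschitz. *)
Lemma lipschitz_derivable_ae (F : R -> R) (L : R) :
  (forall x y, `|F x - F y| <= L * `|x - y|) ->
  {ae leb, forall t, derivable F t 1}.
Proof.
move=> FL0; pose K := `|L| + 1; have K0 : 0 < K by rewrite ltr_wpDl.
have FK x y : `|F x - F y| <= K * `|x - y|.
  by rewrite (le_trans (FL0 x y))// ler_wpM2r// (le_trans (ler_norm _))// lerDl.
pose G := (fun x => F x + K * x) : R -> R.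
have ndG : nondecreasing G.
  move=> x y xy; have := FK y x; rewrite (ger0_norm (x := y - x)) ?subr_ge0//.
  rewrite ler_norml /G => /andP[+ _]; lra.
have cF : continuous F.
  move=> x; apply/cvgrPdist_le => e e0; near=> y.
  rewrite (le_trans (FK x y))// mulrC -ler_pdivlMr//.
  by near: y; apply: cvgr_dist_le; [exact: cvg_id|rewrite divr_gt0].
have rcG : right_continuous G.
  apply: right_continuousW => x; apply: cvgD; first exact: cF.
  by apply: cvgMr; exact: cvg_id.
pose cG : cumulative R R := HB.pack G (isCumulative.Build R _ R G ndG rcG).
have : {ae leb, forall t, derivable cG t 1}.
  apply: cumulative_derivable_ae; apply: (@stieltjes_lipschitz_ac _ (2 * K)); first lra.
  move=> x y xy; have := FK y x; rewrite (ger0_norm (x := y - x)) ?subr_ge0//= /G.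
  rewrite ler_norml => /andP[_]; lra.
apply: filterS; first exact: (ae_filter_ringOfSetsType leb).
move=> t dG.
have -> : F = (fun x => G x - K * x) by apply/funext => x; rewrite /G addrK.
exact: (derivableB dG (derivableM (derivable_cst K t 1) (@derivable_id _ _ t 1))).
Unshelve. all: by end_near. Qed.

End lipschitz_derivable.

(** * Translations and a coding of binary sequences *)

Section translation.
Context (R : realType).

Lemma lebesgue_measure_shift (c : R) (A : set (measurableTypeR R)) : measurable A ->
  lebesgue_measure ((fun t => t + c) @^-1` A) = lebesgue_measure A.
Proof.
move=> mA; have mshift : measurable_fun [set: measurableTypeR R]
    ((fun t : R => t + c) : measurableTypeR R -> measurableTypeR R).
  by apply: measurable_funD; [exact: measurable_id|exact: measurable_cst].
pose m := measure_function_pushforward__canonical__measure_function_Measure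
  (@lebesgue_measure R) mshift.
rewrite -[LHS]/(m A); apply/esym; apply: lebesgue_measure_unique => // _ [[x y] _ <-] /=.
rewrite /m/= /pushforward.
have -> : (fun t : R => t + c) @^-1` `]x, y] = `]x - c, y - c]%classic.
  by apply/seteqP; split=> t /=; rewrite !in_itv/= => /andP[? ?]; apply/andP; split; lra.
rewrite !lebesgue_measure_itv/= !lte_fin ltrD2r; case: ifPn => // _.
by rewrite -!EFinD; congr EFin; ring.
Qed.

Lemma negligible_shift (c : R) (N : set R) : (@lebesgue_measure R).-negligible N ->
  (@lebesgue_measure R).-negligible ((fun t => t + c) @^-1` N).
Proof.
move=> [A [mA A0 NA]]; exists ((fun t => t + c) @^-1` A); split.
- rewrite -[X in measurable X]setTI.
  suff : measurable_fun [set: measurableTypeR R] ((fun t : R => t + c) : measurableTypeR R ->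
      measurableTypeR R) by exact.
  by apply: measurable_funD; [exact: measurable_id|exact: measurable_cst].
- by rewrite lebesgue_measure_shift.
- by move=> t /NA.
Qed.

End translation.

(** Binary sequences are coded by the base-4 expansions with digits 0 and 1:
    the gaps left by the digits 2 and 3 make the coding injective. *)
Section code.
Context (R : realType).
Implicit Types s t : nat -> bool.

Definition code_partial s k : R := \sum_(i < k) (s i)%:R * 4^-1 ^+ i.+1.

Definition code s : R := sup (range (code_partial s)).

Let q0 k : 0 < (4^-1 : R) ^+ k. Proof. by rewrite exprn_gt0// invr_gt0. Qed.

Lemma code_partial_le s k n : code_partial s (k + n) + 4^-1 ^+ (k + n) / 3 <=
  code_partial s k + 4^-1 ^+ k / 3.
Proof.
elim: n => [|n IH]; first by rewrite addn0.
apply: le_trans IH; rewrite addnS /code_partial big_ord_recr/= -addrA lerD2l exprS.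
by case: (s _); have := q0 (k + n); move: (4^-1 ^+ _) => q; rewrite ?mul1r ?mul0r; lra.
Qed.

Lemma code_partial_nd s k n : code_partial s k <= code_partial s (k + n).
Proof.
elim: n => [|n IH]; first by rewrite addn0.
rewrite (le_trans IH)// addnS /code_partial big_ord_recr/= lerDl.
by rewrite mulr_ge0// ltW.
Qed.

Lemma code_ub s k n : code_partial s n <= code_partial s k + 4^-1 ^+ k / 3.
Proof.
have [kn|/ltnW nk] := leqP k n.
  have := code_partial_le s k (n - k); rewrite subnKC//; have := q0 n; lra.
by have := code_partial_nd s n (k - n); rewrite subnKC//; have := q0 k; lra.
Qed.

Lemma code_bounds s k :
  code_partial s k <= code s <= code_partial s k + 4^-1 ^+ k / 3.
Proof.
have ub : has_ubound (range (code_partial s)).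
  by exists (code_partial s 0 + 4^-1 ^+ 0 / 3) => _ [n _ <-]; exact: code_ub.
apply/andP; split; first by apply: ub_le_sup => //; exists k.
apply: ge_sup; first by exists (code_partial s 0); exists 0%N.
by move=> _ [n _ <-]; exact: code_ub.
Qed.

Lemma code_ge0 s : 0 <= code s.
Proof. by have := code_bounds s 0; rewrite /code_partial big_ord0 => /andP[]. Qed.

Lemma code_le1 s : code s <= 1.
Proof.
by have := code_bounds s 0; rewrite /code_partial big_ord0 expr0 => /andP[_]; lra.
Qed.

Lemma eq_code_partial s t k : (forall i, (i < k)%N -> s i = t i) ->
  code_partial s k = code_partial t k.
Proof. by move=> st; apply: eq_bigr => i _; rewrite st. Qed.

(** The digits from the k-th one on contribute at most 4 ^ (-k) / 3. *)
Lemma code_close s t k : (forall i, (i < k)%N -> s i = t i) ->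
  `|code s - code t| <= 4^-1 ^+ k / 3.
Proof.
move=> /eq_code_partial st; rewrite ler_norml.
have /andP[] := code_bounds s k; have /andP[] := code_bounds t k; rewrite st.
by move=> ? ? ? ?; apply/andP; split; lra.
Qed.

Lemma code_inj s t : code s = code t -> forall k, s k = t k.
Proof.
move=> cst; elim/ltn_ind => k IH; have stk := eq_code_partial IH.
have /andP[] := code_bounds s k.+1; have /andP[] := code_bounds t k.+1.
rewrite /code_partial !big_ord_recr/= -/(code_partial s k) -/(code_partial t k).
rewrite stk cst exprS; have := q0 k; move: (4^-1 ^+ k) => q.
by case: (s k); case: (t k) => //; rewrite ?mul1r ?mul0r; lra.
Qed.

End code.

(** * Compact sets that split a countable family *)

Section splitting.
Context (T : topologicalType).
Hypothesis hT : hausdorff_space T.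

(** On C the membership in each B k is locally constant: C is compact, and so
    are both parts into which B k divides it. *)
Definition splits (B : nat -> set T) (C : set T) :=
  compact C /\ forall k, compact (C `&` B k) /\ compact (C `\` B k).

Lemma near_split (B : nat -> set T) (C : set T) x k : splits B C -> C x ->
  \forall y \near within C (nbhs x), B k y <-> B k x.
Proof.
move=> [cC /(_ k)[cB cB']] Cx; have [Bx|Bx] := pselect (B k x).
  have : nbhs x (~` (C `\` B k)).
    apply: open_nbhs_nbhs; split; last by move=> [].
    by apply: closed_openC; exact: compact_closed.
  rewrite /within/=; apply: filterS => y nCBy Cy; split => // _.
  by apply: contrapT => By; exact: nCBy.
have : nbhs x (~` (C `&` B k)).
  apply: open_nbhs_nbhs; split; last by move=> [].
  by apply: closed_openC; exact: compact_closed.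
by rewrite /within/=; apply: filterS => y nCBy Cy; split => // By; case: nCBy.
Qed.

End splitting.

Section lusin.
Context (R : realType) (T : ptopologicalType).
Hypothesis hT : hausdorff_space T.
Variable P : probability (borel T) R.
Hypothesis regP : regular_measure P.

Lemma regular_compact_approx (A : set (borel T)) (e : R) : measurable A -> 0 < e ->
  exists K : set T, [/\ compact K, K `<=` A & (P (A `\` K) <= e%:E)%E].
Proof.
move=> mA e0; have [_ PA] := regP mA.
have PAfin : P A \is a fin_num by exact: fin_num_measure.
have := PAfin; rewrite {1}PA => /(ub_ereal_sup_adherent e0)[_ [K [cK KA] <-]].
rewrite -PA => Ke.
exists K; split => //.
have mK : measurable (K : set (borel T)).
  by apply: closed_borel; exact: compact_closed.
rewrite measureD//=; last by rewrite ltey_eq PAfin.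
rewrite setIidr// leeBlDr; last exact: fin_num_measure.
by rewrite addeC -leeBlDr// ltW.
Qed.

(** Inner regularity applied to each B k and to its complement gives compact
    sets K k and L k; on the intersection of the unions K k `|` L k, every B k
    is relatively open and closed. *)
Lemma splitting_compact (B : nat -> set (borel T)) (e : R) :
  (forall k, measurable (B k)) -> 0 < e ->
  exists C, splits B C /\ (P (~` C) <= e%:E)%E.
Proof.
(* Two sets are lost for each k, so each of them gets half of the k-th term
   of a series of sum e. *)
move=> mB e0; pose d k : R := e / (2 ^ k.+1)%:R / 2.
have d0 k : 0 < d k by rewrite !divr_gt0// ltr0n expn_gt0.
have /choice[K KB] : forall k, exists K : set T, [/\ compact K, K `<=` B k & (P (B k `\` K) <=
    (d k)%:E)%E].
  by move=> k; exact: regular_compact_approx.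
have /choice[L LB] : forall k, exists L : set T, [/\ compact L, L `<=` ~` B k & (P (~` B k `\`
    L) <= (d k)%:E)%E].
  by move=> k; apply: regular_compact_approx => //; exact: measurableC.
have cK k : compact (K k) by case: (KB k).
have cL k : compact (L k) by case: (LB k).
pose C := \bigcap_k (K k `|` L k).
have cC : compact C.
  apply: (@subclosed_compact _ _ (K 0%N `|` L 0%N)); last by apply: bigcap_inf.
    by apply: closed_bigI => k _; apply: compact_closed => //; exact: compactU.
  exact: compactU.
have mKL k : measurable (K k `|` L k : set (borel T)).
  by apply: closed_borel; apply: compact_closed => //; exact: compactU.
exists C; split; first split => // k.
  have -> : C `&` B k = C `&` K k.
    apply/seteqP; split=> [x [Cx Bx]|x [Cx Kx]]; split => //.
      by case: (Cx k I) => // Lx; case: (LB k) => _ /(_ _ Lx).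
    by case: (KB k) => _ /(_ _ Kx).
  have -> : C `\` B k = C `&` L k.
    apply/seteqP; split=> [x [Cx Bx]|x [Cx Lx]]; split => //.
      by case: (Cx k I) => // Kx; case: (KB k) => _ /(_ _ Kx).
    by case: (LB k) => _ /(_ _ Lx).
  by split; apply: compact_closedI => //; exact: compact_closed.
rewrite /C setC_bigcap.
apply: (@le_trans _ _ (\sum_(k <oo) P (~` (K k `|` L k)))%E).
  apply: measure_sigma_subadditive => //.
    by move=> k; exact: measurableC.
  by apply: bigcup_measurable => k _; exact: measurableC.
apply: (@le_trans _ _ (\sum_(k <oo) (e / (2 ^ k.+1)%:R)%:E)%E); last first.
  by apply: epsilon_trick0; exact: ltW.
apply: lee_nneseries => [//|k _].
have -> : ~` (K k `|` L k) = (B k `\` K k) `|` (~` B k `\` L k).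
  rewrite setCU; apply/seteqP; split=> x.
    by move=> [Kx Lx]; have [Bx|Bx] := pselect (B k x); [left|right].
  move=> [[Bx Kx]|[Bx Lx]]; split => //.
    by move=> Lx; case: (LB k) => _ /(_ _ Lx).
  by move=> Kx; case: (KB k) => _ /(_ _ Kx).
have mK : measurable (K k : set (borel T)) by apply: closed_borel; exact: compact_closed.
have mL : measurable (L k : set (borel T)) by apply: closed_borel; exact: compact_closed.
apply: (@le_trans _ _ (P (B k `\` K k) + P (~` B k `\` L k))%E).
  by apply: measureU2; apply: measurableD => //; exact: measurableC.
have -> : (e / (2 ^ k.+1)%:R)%:E = ((d k)%:E + (d k)%:E)%E.
  by rewrite -EFinD /d -splitr.
by apply: leeD; [case: (KB k)|case: (LB k)].
Qed.

End lusin.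

(** * Cells and a countable separating family of fragments *)

Section cells.
Context (R : realType) (delta : R).
Hypothesis delta0 : 0 < delta.

(** Cells are numbered by the codes of integers. A number that encodes no
    integer gives another copy of the cell at 0, but its half-open cell is
    empty, so that the half-open cells still partition the line. *)
Definition cell_index (n : nat) : int := odflt 0 (unpickle n).

Definition cell n : set R :=
  `[(cell_index n)%:~R * delta, ((cell_index n)%:~R + 1) * delta]%classic.

Definition half_open_cell n : set R := [set t | pickle (Num.floor (t / delta)) = n].

Lemma closed_cell n : closed (cell n). Proof. exact: interval_closed. Qed.

Lemma half_open_cellE n t : half_open_cell n t ->
  (cell_index n)%:~R * delta <= t < ((cell_index n)%:~R + 1) * delta.
Proof.
move=> <-; rewrite /cell_index pickleK/=.
have /andP[fl fu] := floor_itv (t / delta).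
by rewrite -ler_pdivlMr// fl/= -ltr_pdivrMr//; move: fu; rewrite intrD.
Qed.

Lemma half_open_cell_sub n : half_open_cell n `<=` cell n.
Proof.
by move=> t /half_open_cellE/andP[h1 h2]; rewrite /cell/= in_itv/= h1 ltW.
Qed.

Lemma half_open_cell_interior n t : half_open_cell n t ->
  t <> (cell_index n)%:~R * delta -> nbhs t (cell n).
Proof.
move=> /half_open_cellE/andP[h1 h2] h3.
have {}h1 : (cell_index n)%:~R * delta < t by rewrite lt_neqAle h1 andbT; apply/eqP/nesym.
apply: (@filterS _ _ _ `](cell_index n)%:~R * delta, ((cell_index n)%:~R + 1) * delta[%classic).
  by apply: subset_itv; rewrite bnd_simp.
by apply: near_in_itvoo; rewrite in_itv/= h1.
Qed.

Lemma trivIset_half_open_cell : trivIset setT half_open_cell.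
Proof. by apply/trivIsetP => i j _ _ ij; apply/seteqP; split=> // t [/= ti tj]; move: ij;
    rewrite -ti -tj eqxx. Qed.

Lemma bigcup_half_open_cell : \bigcup_n half_open_cell n = setT.
Proof. by apply/seteqP; split => // t _; exists (pickle (Num.floor (t / delta))). Qed.

Lemma measurable_half_open_cell n : measurable (half_open_cell n : set (measurableTypeR R)).
Proof.
have [[z zn]|nz] := pselect (exists z : int, pickle z = n); last first.
  rewrite (_ : half_open_cell n = set0)//; apply/seteqP; split => // t tn.
  by apply: nz; exists (Num.floor (t / delta)).
have -> : half_open_cell n = `[z%:~R * delta, (z%:~R + 1) * delta[%classic; last exact:
    measurable_itv.
apply/seteqP; split=> t /=.
  by move/half_open_cellE; rewrite /cell_index -zn pickleK/= in_itv/=.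
rewrite in_itv/= -zn -ler_pdivlMr// -ltr_pdivrMr// => /andP[h1 h2].
rewrite /half_open_cell/=; congr pickle; apply/floor_def.
by rewrite h1 intrD.
Qed.

Lemma cell_width n t : cell n t -> (cell_index n)%:~R * delta <= t <= (cell_index n)%:~R *
    delta + delta.
Proof. by rewrite /cell/= in_itv/= mulrDl mul1r. Qed.

Lemma cell_cover t : exists n, cell n t.
Proof.
by exists (pickle (Num.floor (t / delta))); apply: half_open_cell_sub.
Qed.

End cells.

Lemma dense_seq (R : realType) (X : completeMetricType R) : separable X ->
  exists u : nat -> X, forall x e, 0 < e -> exists i, mdist (u i) x < e.
Proof.
move=> [D cD dD].
have hD x e : 0 < e -> exists2 y, D y & mdist y x < e.
  move=> e0; have [|y []] := dD (ball x e)° _ (open_interior _).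
    by exists x; exact: nbhsx_ballx.
  move=> /interior_subset; rewrite ballEmdist /= metric_sym => xy Dy.
  by exists y.
have /pfcard_geP[D0|/unsquash u] := cD.
  by have [y] := hD point 1 ltr01; rewrite D0.
exists u => x e e0; have [y Dy yx] := hD x e e0.
by have [i _ uiy] := @surj _ _ _ _ u y Dy; exists i; rewrite uiy.
Qed.

Section separating_family.
Context (R : realType) (X : completeMetricType R) (delta : R).
Hypothesis delta0 : 0 < delta.
Variable u : nat -> X.
Hypothesis u_dense : forall x e, 0 < e -> exists i, mdist (u i) x < e.
Implicit Types (g h : frag X).

Definition box (j : nat * (rat * rat) * (nat * rat)) : set (R * X) :=
  [set w | [/\ cell delta j.1.1 w.1, ratr j.1.2.1 <= w.1 <= ratr j.1.2.2 &
               mdist (u j.2.1) w.2 <= ratr j.2.2]].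

Lemma closed_mdist_le (x : X) (r : R) : closed [set y | mdist x y <= r].
Proof.
rewrite -[X in closed X]setCK; apply: open_closedC; rewrite openE => y /= /negP.
rewrite -ltNge => ry; rewrite /interior -nbhs_ballE; exists (mdist x y - r).
  by rewrite /= subr_gt0.
move=> z; rewrite ballEmdist/= => yz; apply/negP; rewrite -ltNge.
by have := metric_triangle x z y; rewrite (metric_sym z y); lra.
Qed.

Lemma closed_snd (J : set X) : closed J -> closed ([set z | J z.2] : set (R * X)).
Proof. by move=> cJ; apply: (closed_comp _ cJ) => z _; exact: cvg_snd. Qed.

Lemma closed_box j : closed (box j).
Proof.
have -> : box j = [set w | cell delta j.1.1 w.1] `&`
    [set w | `[ratr j.1.2.1, ratr j.1.2.2]%classic w.1] `&`
    [set w | [set y | mdist (u j.2.1) y <= ratr j.2.2] w.2].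
  by apply/seteqP; split=> w /=; rewrite in_itv/=; [move=> []|move=> [[]]].
apply: closedI; first apply: closedI.
- by apply: closed_fst; exact: closed_cell.
- by apply: closed_fst; exact: interval_closed.
- by apply: closed_snd; exact: closed_mdist_le.
Qed.

(** Rational end points and a dense sequence give small boxes around any
    point. A box is cut by its closed cell, and a neighbourhood of z may
    leave the cell, hence the restriction to the points over the cell. *)
Lemma box_basis n (z : R * X) e : 0 < e -> exists j,
  [/\ j.1.1 = n, \forall w \near z, cell delta n w.1 -> box j w &
      forall w w', box j w -> box j w' -> ball w e w'].
Proof.
case: z => t x e0.
have rat_between (y y' : R) : y < y' -> exists q : rat, y < ratr q < y'.
  by move=> /rat_in_itvoo[q]; rewrite in_itv/=; exists q.
have [p /andP[p1 p2]] : exists q : rat, t - e / 4 < ratr q < t by apply: rat_between; lra.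
have [q /andP[q1 q2]] : exists q : rat, t < ratr q < t + e / 4 by apply: rat_between; lra.
have [r /andP[r1 r2]] : exists q : rat, e / 4 < ratr q < e / 2 by apply: rat_between; lra.
have e80 : 0 < e / 8 by lra.
have [i ix] := u_dense x e80.
exists ((n, (p, q)), (i, r)); split => //=.
  pose d := Num.min (Num.min (t - ratr p) (ratr q - t)) (e / 8).
  have d0 : 0 < d by rewrite !lt_min !subr_gt0 p2 q1.
  apply: (@filterS _ _ _ (ball (t, x) d)); last exact: nbhsx_ballx.
  move=> [t' x'] [/=].
  rewrite ballEmdist/= /ball/= !lt_min => /andP[/andP[h1 h2] _] /andP[_ h3] ct'.
  move: h1 h2; rewrite !ltr_norml => /andP[_ h1] /andP[h2 _].
  split => //=; first by apply/andP; split; lra.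
  by have := metric_triangle (u i) x x'; lra.
move=> [t1 x1] [t2 x2] [/= _ /andP[a1 a2] a3] [/= _ /andP[b1 b2] b3]; split => /=.
  by rewrite /ball/= ltr_norml; apply/andP; split; lra.
rewrite ballEmdist/=; have := metric_triangle x1 (u i) x2.
by rewrite (metric_sym x1 (u i)); lra.
Qed.

Definition cell_pos n : set (frag X) :=
  [set g | (0 < @lebesgue_measure R (dom g `&` cell delta n))%E].

(** The countable family that carries all the information used about a
    fragment: which rational boxes its graph meets, and which cells its domain
    charges. *)
Definition family k : set (frag X) :=
  match unpickle k : option (nat * (rat * rat) * (nat * rat) + nat) with
  | Some (inl j) => meets (box j)
  | Some (inr n) => cell_pos n
  | None => set0
  end.

Definition box_code j : nat :=
  pickle (inl j : nat * (rat * rat) * (nat * rat) + nat)%type.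

Definition cell_code n : nat :=
  pickle (inr n : nat * (rat * rat) * (nat * rat) + nat)%type.

Lemma family_box j : family (box_code j) = meets (box j).
Proof. by rewrite /family pickleK. Qed.

Lemma family_cell n : family (cell_code n) = cell_pos n.
Proof. by rewrite /family pickleK. Qed.

(** Meeting a closed set is a closed condition; charging a cell is the
    complement of an intersection of open conditions, by upper semicontinuity
    of the measure. *)
Lemma measurable_family (g0 : frag X) k : measurable (family k : set (borel (frag_at g0))).
Proof.
rewrite /family; case: unpickle => [[j|n]|]; last exact: measurable0.
  by apply: (@closed_borel (frag_at g0)); apply: closed_meets; exact: closed_box.
pose V i : set (frag X) := [set g | (@lebesgue_measure R (dom g `&` cell delta n) <
    i.+1%:R^-1%:E)%E].
have -> : cell_pos n = ~` \bigcap_i V i.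
  rewrite setC_bigcap; apply/seteqP; split => g /=.
    move=> g_pos; have : (exists i, i.+1%:R^-1%:E <= @lebesgue_measure R (dom g `&` cell delta
        n))%E.
      move: g_pos; rewrite /cell_pos/=; case: (lebesgue_measure _) => [r| |] //; last by exists
          0%N; rewrite leey.
      rewrite lte_fin => r0; exists (Num.truncn r^-1); rewrite lee_fin.
      by rewrite -[leRHS]invrK lef_pV2 ?posrE ?invr_gt0// ltW// truncnS_gt.
    by move=> [i gi]; exists i => //=; apply/negP; rewrite -leNgt.
  move=> [i _ /negP]; rewrite -leNgt; apply: lt_le_trans.
  by rewrite lte_fin invr_gt0.
apply: measurableC; apply: bigcapT_measurable => i; apply: (@open_borel (frag_at g0)).
by rewrite openE => g gi; apply: frag_measure_lt => //; exact: closed_cell.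
Qed.

(** If a point lies on one graph only, a small box around it misses the other
    graph, which is compact. *)
Lemma family_separates g h : (forall k, family k g <-> family k h) -> g = h.
Proof.
have half (k1 k2 : frag X) : (forall k, family k k1 <-> family k k2) -> graph k1 `<=` graph k2.
  move=> k12 z k1z; apply: contrapT => k2z.
  have [n zn] := cell_cover delta0 z.1.
  have : nbhs z (~` graph k2).
    apply: open_nbhs_nbhs; split => //; apply: closed_openC; apply: compact_closed.
      by apply: hausdorff_prod; [exact: Rhausdorff|exact: metric_hausdorff].
    exact: compact_graph.
  rewrite -nbhs_ballE => -[e /= e0 zk2].
  have [j [jn jz jb]] := box_basis n z e0.
  have bz : box j z by exact: (nbhs_singleton jz).
  have : family (box_code j) k1 by rewrite family_box; exists z.
  move=> /(iffLR (k12 _)); rewrite family_box => -[w [k2w jw]].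
  by apply: (zk2 w) => //; exact: jb.
move=> gh; apply: frag_eqP; apply/seteqP; split; apply: half => // k.
by split=> /gh.
Qed.

Definition rgraph n g : set (R * X) := graph g `&` [set z | cell delta n z.1].

(** Restricting to a closed cell is not continuous on all fragments, because
    points of the graph may cross the ends of the cell. It is continuous
    where the answers of the family are locally constant: the boxes, which
    are cut by the cell, that meet the graph of g also meet the graph of a
    close h. The opposite inclusion follows from compactness. *)
Lemma near_rgraph (C : set (frag X)) g n e : splits family C -> C g -> 0 < e ->
  \forall h \near within C (nbhs g),
    (forall z, rgraph n g z -> exists2 w, rgraph n h w & ball z e w) /\
    (forall w, rgraph n h w -> exists2 z, rgraph n g z & ball w e z).
Proof.
move=> fC Cg e0; have cn : closed [set z : R * X | cell delta n z.1].
  by apply: closed_fst; exact: closed_cell.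
have FF : Filter (within C (nbhs g)) by exact: within_filter.
apply: filterI.
  pose Q (h : frag X) (z : R * X) := exists2 w, rgraph n h w & ball z e w.
  (* Finitely many boxes cover the compact set rgraph n g. *)
  have : \forall h \near within C (nbhs g), rgraph n g `<=` Q h.
    have cr : compact (rgraph n g) by apply: compact_closedI => //; exact: compact_graph.
    apply: (iffRL (near_covering_withinP _) (iffLR (compact_near_coveringP _) cr)).
    move=> z [gz nz]; have [j [jn jz jb]] := box_basis n z e0.
    have bz : box j z by exact: (nbhs_singleton jz).
    exists ([set w | cell delta n w.1 -> box j w], meets (box j)); first split => //.
      have := near_split (@hausdorff_frag R X) (box_code j) fC Cg.
      apply: filterS => h; rewrite family_box => -[_]; apply.
      by exists z.
    move=> [w h] [/= jw [w' [hw' jw']]] [gw nw]; exists w'.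
      by split => //; case: jw'; rewrite jn.
    by apply: jb => //; exact: jw.
  by move=> gQ; exact: gQ.
apply: cvg_within.
(* F is the part of the strip over the cell that is far from the restricted
   graph. The graph of g misses it, so graphs close to that of g do. *)
pose F := [set z : R * X | cell delta n z.1] `&` ~` (\bigcup_(z in rgraph n g) (ball z e)°).
have cF : closed F.
  apply: closedI => //; apply: open_closedC; apply: bigcup_open => z _.
  exact: open_interior.
have gF : graph g `&` F = set0.
  apply/seteqP; split => // z [gz [nz]]; apply; exists z => //.
  exact: nbhsx_ballx.
apply: filterS (near_disjoint_graph cF gF) => h hF w [hw nw].
have : ~ F w by move=> Fw; rewrite -[False]/(set0 w) -hF.
move=> /not_andP[//|/contrapT[z gz /interior_subset zw]].
by exists z => //; exact: ball_sym.
Qed.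

End separating_family.

(** * Translated restrictions of a fragment *)

Section pieces.
Context (R : realType) (X : completeMetricType R).
Implicit Types (g h : frag X) (J : set R) (tau : R).

Definition is_piece g J tau h :=
  dom h = [set t | dom g (t + tau) /\ J (t + tau)] /\
  (forall t, dom h t -> h t = g (t + tau)).

Lemma ex_piece g J tau : closed J -> (0 < @lebesgue_measure R (dom g `&` J))%E ->
  exists h, is_piece g J tau h.
Proof.
move=> cJ gJ0; pose K := [set t | dom g (t + tau) /\ J (t + tau)].
have KE : K = (fun t => t + tau) @^-1` (dom g `&` J) by [].
have cgJ : compact (dom g `&` J) by exact: compact_domI.
have cK : compact K.
  have -> : K = (fun t => t - tau) @` (dom g `&` J).
    apply/seteqP; split=> [t Kt|_ [t gt <-]]; last by rewrite /K/= subrK.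
    by exists (t + tau) => //; rewrite addrK.
  apply: continuous_compact => //; apply: continuous_subspaceT => t.
  by apply: continuousB; [exact: cvg_id|exact: cvg_cst].
have K0 : (0 < @lebesgue_measure R K)%E.
  by rewrite KE lebesgue_measure_shift//; exact: compact_measurable.
pose f t : X := if t \in K then g (t + tau) else point.
have fE t : K t -> f t = g (t + tau) by move=> Kt; rewrite /f mem_set.
have fbilip : exists c C : R, 0 < c /\ forall t s, K t -> K s ->
    c * `|t - s| <= mdist (f t) (f s) <= C * `|t - s|.
  have [c [C [c0 gC]]] := fmap_bilip g; exists c, C; split => // t s Kt Ks.
  rewrite !fE//; have := gC _ _ (proj1 Kt) (proj1 Ks).
  by rewrite opprD addrACA subrr addr0.
have fout t : ~ K t -> f t = point by move=> Kt; rewrite /f memNset.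
by exists (Frag cK K0 fbilip fout); split.
Qed.

Definition piece g J tau : frag X := xget g (is_piece g J tau).

Lemma pieceP g J tau : closed J -> (0 < @lebesgue_measure R (dom g `&` J))%E ->
  is_piece g J tau (piece g J tau).
Proof. by move=> cJ gJ; apply: xgetPex; exact: ex_piece. Qed.

Section is_piece.
Variables (g : frag X) (J : set R) (tau : R) (h : frag X).
Hypothesis gh : is_piece g J tau h.

Lemma dom_piece t : dom h t <-> dom g (t + tau) /\ J (t + tau).
Proof. by case: gh => ->. Qed.

Lemma piece_in t : dom g t -> J t -> dom h (t - tau).
Proof. by move=> gt Jt; apply/dom_piece; rewrite subrK. Qed.

Lemma pieceE t : dom h t -> h t = g (t + tau).
Proof. by case: gh => _; exact. Qed.

Lemma graph_piece z : graph h z <-> exists w, [/\ graph g w, J w.1 & z = (w.1 - tau, w.2)].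
Proof.
split=> [[t ht <-]|[_ [[t gt <-] /= Jt ->]]].
  have [gt Jt] := (dom_piece t).1 ht.
  by exists (t + tau, g (t + tau)); split => //=; [exists (t + tau)|rewrite addrK pieceE].
exists (t - tau); first exact: piece_in.
by rewrite pieceE ?subrK//; exact: piece_in.
Qed.

Lemma image_piece (U : set R) :
  h @` (dom h `&` U) = g @` (dom g `&` (J `&` [set t | U (t - tau)])).
Proof.
apply/seteqP; split=> [_ [t [/[dup] ht /dom_piece[gt Jt] Ut] <-]|_ [t [gt [Jt Ut]] <-]].
  by exists (t + tau); [rewrite /= addrK|rewrite pieceE].
exists (t - tau); first by split => //; exact: piece_in.
by rewrite pieceE ?subrK//; exact: piece_in.
Qed.

Lemma bilip_piece C D : bilip_frag C D g -> bilip_frag C D h.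
Proof.
move=> gCD t s ht hs; rewrite !pieceE//.
have [gt _] := (dom_piece t).1 ht; have [gs _] := (dom_piece s).1 hs.
by have := gCD _ _ gt gs; rewrite opprD addrACA subrr addr0.
Qed.

Lemma lip_piece C : lip_frag C g -> lip_frag C h.
Proof.
move=> gCD t s ht hs; rewrite !pieceE//.
have [gt _] := (dom_piece t).1 ht; have [gs _] := (dom_piece s).1 hs.
by have := gCD _ _ gt gs; rewrite opprD addrACA subrr addr0.
Qed.

Let ball_shift (t s r : R) : ball t r s <-> ball (t + tau) r (s + tau).
Proof. by rewrite /ball/= opprD addrACA subrr addr0. Qed.

Let cvg_alongP (k : frag X) (t : R) (F : R -> R) (l : R) :
  F s @[s --> within (dom k) t^'] --> l <->
  (forall e, 0 < e -> exists2 r, 0 < r &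
     forall s, ball t r s -> s != t -> dom k s -> `|l - F s| < e).
Proof.
split=> [/cvgrPdist_lt kl e /kl|kl].
  rewrite !near_withinE -nbhs_ballE => -[r r0 kr]; exists r => //.
apply/cvgrPdist_lt => e /kl[r r0 kr]; rewrite !near_withinE -nbhs_ballE.
by exists r => // s ts st ks; exact: kr.
Qed.

(** A limit along a set is a limit along any of its subsets, provided that
    the point is still a limit point. *)
Lemma cvg_along_piece t (F H : R -> R) l : limit_point (dom h) t ->
  (forall s, dom h s -> H s = F (s + tau)) ->
  cvg_along g (t + tau) F l -> cvg_along h t H l.
Proof.
move=> lt HF [_ /cvg_alongP gl]; split => //; apply/cvg_alongP => e /gl[r r0 gr].
exists r => // s ts st hs; rewrite HF//; apply: gr.
- by rewrite -ball_shift.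
- by rewrite (inj_eq (addIr tau)).
- by case: ((dom_piece s).1 hs).
Qed.

Lemma limit_point_piece t : nbhs (t + tau) J ->
  limit_point (dom g) (t + tau) -> limit_point (dom h) t.
Proof.
move=> tJ lt U; rewrite -nbhs_ballE => -[r /= r0 Ur].
have : nbhs (t + tau) (J `&` ball (t + tau) r).
  by apply: filterI => //; exact: nbhsx_ballx.
move=> /lt[y [yt gy [Jy yr]]]; exists (y - tau); split.
- by rewrite subr_eq.
- exact: piece_in.
- by apply: Ur; apply/ball_shift; rewrite subrK.
Qed.

Lemma limit_point_of_piece t : limit_point (dom h) t -> limit_point (dom g) (t + tau).
Proof.
move=> lt U; rewrite -nbhs_ballE => -[r /= r0 Ur].
have [y [yt hy yr]] := lt _ (nbhsx_ballx t r r0).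
exists (y + tau); split; first by rewrite (inj_eq (addIr tau)).
  by case: ((dom_piece y).1 hy).
by apply: Ur; exact: ((ball_shift t y r).1 yr).
Qed.

(** Near an interior point of J the domains of h and g agree up to the
    translation. *)
Lemma cvg_along_piece_interior t (F H : R -> R) l : nbhs (t + tau) J ->
  (forall s, dom h s -> H s = F (s + tau)) ->
  cvg_along g (t + tau) F l <-> cvg_along h t H l.
Proof.
move=> tJ HF; split=> [gl|[lt /cvg_alongP hl]].
  by apply: (cvg_along_piece _ HF gl); apply: limit_point_piece => //; case: gl.
split; first exact: limit_point_of_piece.
move: tJ; rewrite -nbhs_ballE => -[r0 /= r00 Jr0].
apply/cvg_alongP => e /hl[r r1 hr].
exists (Num.min r r0); first by rewrite lt_min r1.
move=> s tsr st gs.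
have [ts ts0] : ball (t + tau) r s /\ ball (t + tau) r0 s.
  by split; apply: le_ball tsr; rewrite ge_min lexx ?orbT.
have hs : dom h (s - tau) by apply: piece_in => //; exact: Jr0.
have := hr (s - tau); rewrite HF// subrK; apply => //.
- by apply/ball_shift; rewrite subrK.
- by rewrite subr_eq.
Qed.

Lemma partial_frag_piece (f : X -> R) t : dom g t -> nbhs t J ->
  partial_frag h f (g t) = partial_frag g f (g t).
Proof.
move=> gt tJ; have Jt : J t by exact: nbhs_singleton tJ.
have ht := piece_in gt Jt.
have tJ' : nbhs (t - tau + tau) J by rewrite subrK.
rewrite /partial_frag; congr (xget 0 _); apply/seteqP; split=> l [s [ks gst sl]].
  have sE : s = t - tau.
    by apply: (frag_inj ks ht); rewrite gst pieceE// subrK.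
  exists t; split => //; move: sl; rewrite sE /is_deriv_along.
  rewrite -(cvg_along_piece_interior (F := fun s => (f (g s) - f (g t)) / (s - t)) _ tJ').
    by rewrite subrK.
  by move=> r hr; rewrite !pieceE// subrK opprB addrA.
have sE : s = t by exact: (frag_inj ks gt).
exists (t - tau); split; rewrite ?pieceE ?subrK// /is_deriv_along.
rewrite -(cvg_along_piece_interior (F := fun s => (f (g s) - f (g t)) / (s - t)) _ tJ').
  by rewrite subrK -sE.
by move=> r hr; rewrite !pieceE// subrK opprB addrA.
Qed.

(** A set of real numbers has at most countably many isolated points. *)
Lemma ae_limit_point (k : frag X) :
  {ae @lebesgue_measure R, forall t, dom k t -> limit_point (dom k) t}.
Proof.
exists (isolated (dom k)); split.
- exact/countable_measurable/countable_isolated.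
- exact/countable_lebesgue_measure0/countable_isolated.
- move=> t /= /not_implyP[kt nlt].
  split; first exact: mem_set.
  move: nlt; rewrite not_limit_pointE => -[V tV kV]; exists V => //.
  apply/seteqP; split; first by rewrite setIC.
  by move=> _ ->; split => //; exact: nbhs_singleton.
Qed.

Lemma ae_piece (Q : R -> Prop) :
  {ae @lebesgue_measure R, forall t, dom g t -> Q t} ->
  {ae @lebesgue_measure R, forall t, dom h t -> Q (t + tau)}.
Proof.
move=> /(negligible_shift tau); apply: negligibleS => t /= /not_implyP[ht Qt].
by move=> gQ; apply: Qt; apply: gQ; case: ((dom_piece t).1 ht).
Qed.

Lemma ae_speed_piece (f delta : X -> R) :
  speed_frag f delta g -> speed_frag f delta h.
Proof.
move=> /ae_piece gQ; have hl := ae_limit_point h; move: gQ hl.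
apply: filterS2; first exact: (ae_filter_ringOfSetsType (@lebesgue_measure R)).
move=> t gQ hl ht; have [l [m [gl gm lm]]] := gQ ht; exists l, m; split.
- apply: (cvg_along_piece (hl ht) _ gl) => s hs.
  by rewrite !pieceE// opprD addrACA subrr addr0.
- apply: (cvg_along_piece (hl ht) _ gm) => s hs.
  by rewrite !pieceE// opprD addrACA subrr addr0.
- by rewrite pieceE.
Qed.

Lemma ae_direction_piece q (f v : X -> 'rV[R]_q) (alpha : X -> R) :
  direction_frag f v alpha g -> direction_frag f v alpha h.
Proof.
move=> /ae_piece gQ; have hl := ae_limit_point h; move: gQ hl.
apply: filterS2; first exact: (ae_filter_ringOfSetsType (@lebesgue_measure R)).
move=> t gQ hl ht; have [w gw vw] := gQ ht; exists w; last by rewrite pieceE.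
move=> i; apply: (cvg_along_piece (hl ht) _ (gw i)) => s hs.
by rewrite !pieceE// opprD addrACA subrr addr0.
Qed.

End is_piece.

End pieces.

(** * Pieces that reveal where they come from *)

Lemma inf_close (R : realType) (A B : set R) (e : R) :
  has_inf A -> has_inf B ->
  (forall x, A x -> exists2 y, B y & `|x - y| < e) ->
  (forall y, B y -> exists2 x, A x & `|y - x| < e) ->
  `|inf A - inf B| <= e.
Proof.
have half (A' B' : set R) : has_inf A' -> has_inf B' ->
    (forall x, A' x -> exists2 y, B' y & `|x - y| < e) -> inf B' - e <= inf A'.
  move=> [A0 lA] [B0 lB] AB; apply: lb_le_inf => // x /AB[y By].
  have := ge_inf lB By; rewrite ltr_norml => ? /andP[]; lra.
move=> iA iB AB BA; have := half _ _ iA iB AB; have := half _ _ iB iA BA.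
by rewrite ler_norml => ? ?; apply/andP; split; lra.
Qed.

Section normalized_pieces.
Context (R : realType) (X : completeMetricType R) (a b : R).
Hypothesis ab : a < b.
Variable u : nat -> X.
Hypothesis u_dense : forall x e, 0 < e -> exists i, mdist (u i) x < e.
Implicit Types (g h : frag X) (n m : nat).

Local Notation delta := ((b - a) / 2).
Local Notation fam := (family delta u).

Let delta0 : 0 < delta. Proof. by rewrite divr_gt0// subr_gt0. Qed.

(** Odd positions record the fragment through the separating family, and even
    positions record n. *)
Definition digits n g (i : nat) : bool :=
  if odd i then `[< fam i./2 g >] else i./2 == n.

Lemma digits_inj n m g h : (forall i, digits n g i = digits m h i) -> n = m /\ g = h.
Proof.
move=> dd; split.
  by have := dd m.*2; rewrite /digits odd_double doubleK eqxx => /eqP.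
apply: (family_separates delta0 u_dense) => k.
have := dd k.*2.+1; rewrite /digits /= odd_double/= uphalf_double => kk.
by split=> /asboolP; [rewrite kk|rewrite -kk] => /asboolP.
Qed.

Definition dom_cell n g : set R := dom g `&` cell delta n.

(** The piece over cell n is made to start at a + delta * code, where code <=
    1. As its length is at most delta = (b - a) / 2, it stays in [a, b],
    while its starting point determines n and g. *)
Definition translate n g : R := inf (dom_cell n g) - a - delta * code R (digits n g).

Definition normal_piece n g : frag X := piece g (cell delta n) (translate n g).

Lemma normal_pieceP n g : cell_pos delta n g ->
  is_piece g (cell delta n) (translate n g) (normal_piece n g).
Proof. by move=> gn; apply: pieceP => //; exact: closed_cell. Qed.

Lemma dom_cell_nonempty n g : cell_pos delta n g -> dom_cell n g !=set0.
Proof.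
move=> gn; apply/set0P/eqP => g0; move: gn; rewrite /cell_pos/= -/(dom_cell n g) g0.
by rewrite measure0 ltxx.
Qed.

Lemma has_inf_dom_cell n g : cell_pos delta n g -> has_inf (dom_cell n g).
Proof.
move=> gn; split; first exact: dom_cell_nonempty.
by exists ((cell_index n)%:~R * delta) => t [_ /cell_width/andP[]].
Qed.

Lemma dom_cell_inf n g t : cell_pos delta n g -> dom_cell n g t ->
  inf (dom_cell n g) <= t <= inf (dom_cell n g) + delta.
Proof.
move=> gn gt; have [ne lb] := has_inf_dom_cell gn.
rewrite (ge_inf lb gt)/=; case: gt => _ /cell_width/andP[_ tu].
suff : (cell_index n)%:~R * delta <= inf (dom_cell n g) by lra.
by apply: lb_le_inf => // s [_ /cell_width/andP[]].
Qed.

Lemma inf_dom_normal_piece n g : cell_pos delta n g ->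
  inf (dom (normal_piece n g)) = a + delta * code R (digits n g).
Proof.
move=> gn; have [ne lb] := has_inf_dom_cell gn; have Tg := normal_pieceP gn.
have step t : dom (normal_piece n g) t -> a + delta * code R (digits n g) <= t.
  move=> /(dom_piece Tg) /(dom_cell_inf gn)/andP[+ _]; rewrite /translate; lra.
apply/eqP; rewrite eq_le; apply/andP; split.
  have lbT : has_lbound (dom (normal_piece n g)).
    by exists (a + delta * code R (digits n g)) => t; exact: step.
  set c := delta * code R (digits n g).
  have -> : inf (dom (normal_piece n g)) <= a + c = (inf (dom (normal_piece n g)) - c <= a).
    by rewrite lerBlDr.
  have -> : inf (dom (normal_piece n g)) - c <= a =
    (inf (dom (normal_piece n g)) + translate n g <= inf (dom_cell n g)).
    by rewrite /translate -/c; apply/idP/idP => ?; lra.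
  apply: lb_le_inf => // t [gt ct]; rewrite -lerBrDr; apply: ge_inf => //.
  exact: (piece_in Tg).
apply: lb_le_inf => //; have [t [gt ct]] := ne.
by exists (t - translate n g); exact: (piece_in Tg).
Qed.

Lemma dom_normal_piece n g : cell_pos delta n g -> dom (normal_piece n g) `<=` `[a, b]%classic.
Proof.
move=> gn t /(dom_piece (normal_pieceP gn)) /(dom_cell_inf gn); rewrite /translate/= in_itv/=.
have c0 := code_ge0 R (digits n g); have c1 := code_le1 R (digits n g).
have : 0 <= delta * code R (digits n g) by rewrite mulr_ge0// (ltW delta0).
have : delta * code R (digits n g) <= delta by rewrite ler_piMr// (ltW delta0).
by move=> ? ? /andP[? ?]; apply/andP; split; lra.
Qed.

(** Both n and g are read off from the infimum of the domain. *)
Lemma normal_piece_inj n m g h : cell_pos delta n g -> cell_pos delta m h ->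
  normal_piece n g = normal_piece m h -> n = m /\ g = h.
Proof.
move=> gn hm gh; apply: digits_inj; apply: (@code_inj R).
have := inf_dom_normal_piece gn; rewrite gh inf_dom_normal_piece// => /addrI.
by move=> /(mulfI (lt0r_neq0 delta0)).
Qed.

Lemma near_digits (C : set (frag X)) g n k : splits fam C -> C g ->
  \forall h \near within C (nbhs g), forall i, (i < k)%N -> digits n h i = digits n g i.
Proof.
move=> fC Cg; have FF : Filter (within C (nbhs g)) by exact: within_filter.
have : \forall h \near within C (nbhs g), forall i : 'I_k, fam i./2 h <-> fam i./2 g.
  by apply: filter_forall => i; exact: (near_split (@hausdorff_frag R X)).
apply: filterS => h hg i ik; rewrite /digits; case: ifPn => // _.
by apply/asboolP/asboolP => /(hg (Ordinal ik)).
Qed.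

(** The graph of the normal piece is the graph of g over the cell, shifted by
    the infimum of its domain and by the code. For h close to g in C the
    graphs over the cell are close by near_rgraph, hence also the infima, and
    the codes differ only in late digits. *)
Lemma near_normal_piece (C : set (frag X)) g n e : splits fam C -> C g ->
  cell_pos delta n g -> 0 < e ->
  \forall h \near within C (nbhs g), cell_pos delta n h -> frag_ball (normal_piece n g) e
      (normal_piece n h).
Proof.
move=> fC Cg gn e0; have FF : Filter (within C (nbhs g)) by exact: within_filter.
have e40 : 0 < e / 4 by lra.
(* Digits beyond the k-th one change the shift by at most e / 4. *)
have [k ke] : exists k, delta * ((4^-1 : R) ^+ k / 3) <= e / 4.
  have : (4^-1 : R) ^+ k @[k --> \oo] --> (0 : R).
    by apply: cvg_expr; rewrite ger0_norm ?invr_ge0// invf_lt1// ltr1n.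
  move=> /cvgrPdist_lt/(_ (e / 4 / delta)) [|k _ /(_ k (leqnn k))].
    by rewrite divr_gt0.
  have q0 : 0 < (4^-1 : R) ^+ k by rewrite exprn_gt0// invr_gt0.
  rewrite sub0r normrN gtr0_norm// => kk; exists k.
  move: kk; rewrite ltr_pdivlMr// mulrC => ?.
  have : 0 < delta * 4^-1 ^+ k by rewrite mulr_gt0.
  by rewrite mulrA; lra.
have nr := near_rgraph u_dense n fC Cg e40.
have nd := near_digits n k fC Cg.

apply: filterS2 nd nr.
move=> h gh [grh hrg] hn.
have infgh : `|inf (dom_cell n g) - inf (dom_cell n h)| <= e / 4.
  apply: inf_close; [exact: has_inf_dom_cell|exact: has_inf_dom_cell| |].
    move=> t [gt ct]; have [|_ [[s hs <-] cs] [ts _]] := grh (t, g t).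
      by split => //; exists t.
    by exists s.
  move=> t [ht ct]; have [|_ [[s gs <-] cs] [ts _]] := hrg (t, h t).
    by split => //; exists t.
  by exists s.
have codegh : `|delta * code R (digits n g) - delta * code R (digits n h)| <= e / 4.
  apply: le_trans ke; rewrite -mulrBr normrM gtr0_norm// ler_wpM2l ?(ltW delta0)//.
  by apply: code_close => i /gh ->.
have tgh : `|translate n g - translate n h| <= e / 2.
  move: infgh codegh; rewrite /translate !ler_norml => /andP[? ?] /andP[? ?].
  by apply/andP; split; lra.
have Tg := normal_pieceP gn; have Th := normal_pieceP hn.
have shift_ball (z w : R * X) : ball z (e / 4) w ->
    ball (z.1 - translate n g, z.2) (3 / 4 * e) (w.1 - translate n h, w.2).
  move: z w => [t x] [s y] [/= ts xy]; split => /=.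
    move: ts tgh; rewrite /ball/= !ltr_norml ler_norml => /andP[? ?] /andP[? ?].
    by apply/andP; split; lra.
  by apply: le_ball xy; lra.
apply: (@frag_ball_of_graph _ _ _ _ (3 / 4 * e)); [lra|lra| |].
  move=> z /(graph_piece Tg)[w [gw cw ->]].
  have [w' [hw' cw'] ww'] := grh w (conj gw cw).
  exists (w'.1 - translate n h, w'.2); last exact: shift_ball.
  by apply/(graph_piece Th); exists w'.
move=> z /(graph_piece Th)[w [hw cw ->]].
have [w' [gw' cw'] ww'] := hrg w (conj hw cw).
exists (w'.1 - translate n g, w'.2); last by apply/ball_sym/shift_ball/ball_sym.
by apply/(graph_piece Tg); exists w'.
Qed.

End normalized_pieces.

(** * Glueing restrictions of a measure along injections *)

Lemma ge0_integral_mrestr d (T : measurableType d) (R : realType)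
    (mu : {measure set T -> \bar R}) (H : set T) (mH : measurable H) (f : T -> \bar R) :
  measurable_fun setT f -> (forall x, (0 <= f x)%E) ->
  (\int[mrestr mu mH]_x f x = \int[mu]_(x in H) f x)%E.
Proof.
move=> mf f0; have mHC : measurable (~` H) by exact: measurableC.
rewrite (@ge0_negligible_integral _ _ _ (mrestr mu mH) setT (~` H))//; last first.
  by change (mu (~` H `&` H) = 0%E); rewrite setICl measure0.
rewrite setTD setCK; apply: eq_measure_integral => A mA AH.
by change (mu (A `&` H) = mu A); rewrite setIidl.
Qed.

(** Glueing countably many restrictions of a probability measure along
    injections f n that are defined on countable unions of compact sets on
    which they are continuous.  Since a continuous injection of a compact set
    is a homeomorphism onto its image, the images and the inverses of the f n
    are Borel, and the glued measure is again regular. *)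
Section transport.
Context (R : realType) (S T : ptopologicalType).
Hypotheses (hS : hausdorff_space S) (hT : hausdorff_space T).
Variable P : probability (borel S) R.
Hypothesis regP : regular_measure P.
Variables (K : nat -> nat -> set S) (f : nat -> S -> T).
Hypothesis cK : forall n j, compact (K n j).
Hypothesis fK : forall n j, {within K n j, continuous (f n)}.

Definition source n : set S := \bigcup_j K n j.

Hypothesis f_inj : forall n m x y, source n x -> source m y -> f n x = f m y ->
  n = m /\ x = y.
Hypothesis K_approx : forall n e, 0 < e -> exists j,
  (P (source n `\` K n j) <= e%:E)%E.

Definition target n : set T := f n @` source n.

Definition inverse n (y : T) : S := xget point [set x | source n x /\ f n x = y].

Lemma inverseK n x : source n x -> inverse n (f n x) = x.
Proof.
move=> nx; rewrite /inverse; case: xgetP => [_ -> [ny fyx]|/(_ x)/not_andP[]//].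
by case: (f_inj ny nx fyx).
Qed.

Lemma target_inverse n y : target n y -> source n (inverse n y) /\ f n (inverse n y) = y.
Proof. by move=> [x nx <-]; rewrite inverseK. Qed.

Lemma compact_borel_source n j : measurable (K n j : set (borel S)).
Proof. by apply: closed_borel; exact: compact_closed. Qed.

Lemma measurable_source n : measurable (source n : set (borel S)).
Proof. by apply: bigcupT_measurable => j; exact: compact_borel_source. Qed.

(** On each compact set K n j the map is continuous, so the image is a
    countable union of compact sets. *)
Lemma closed_image_measurable n (F : set S) : closed F ->
  measurable (f n @` (source n `&` F) : set (borel T)).
Proof.
move=> cF; rewrite setI_bigcupl image_bigcup; apply: bigcupT_measurable => j.
apply: closed_borel; apply: compact_closed => //; apply: continuous_compact.
  by apply: continuous_subspaceW (fK (j := j)) => x [].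
exact: compact_closedI.
Qed.

Lemma measurable_target n : measurable (target n : set (borel T)).
Proof.
by rewrite /target -[source n]setIT; apply: closed_image_measurable; exact: closedT.
Qed.

Lemma measurable_inverse n :
  measurable_fun (target n : set (borel T)) (inverse n : borel T -> borel S).
Proof.
apply: (@measurability _ _ (borel T) (borel S) _ _ (@open S) erefl) => _ [U oU <-].
have -> : target n `&` inverse n @^-1` U = target n `\` (f n @` (source n `&` ~` U)).
  apply/seteqP; split=> y [ny Uy]; split => //.
    by move=> [x [nx xU] xy]; apply: xU; rewrite -(inverseK nx) xy.
  apply: contrapT => nUy; apply: Uy; have [ni fi] := target_inverse ny.
  by exists (inverse n y).
apply: measurableD; first exact: measurable_target.
by apply: closed_image_measurable; exact: open_closedC.
Qed.

Lemma measurable_f n : measurable_fun (source n : set (borel S)) (f n : borel S -> borel T).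
Proof.
apply: (@measurability _ _ (borel S) (borel T) _ _ (@open T) erefl) => _ [U oU <-].
rewrite setI_bigcupl; apply: bigcupT_measurable => j.
have -> : K n j `&` f n @^-1` U = K n j `\` (K n j `&` f n @^-1` (~` U)).
  apply/seteqP; split=> x [Kx Ux]; split => //; first by move=> [].
  by apply: contrapT => nU; apply: Ux.
apply: measurableD; first exact: compact_borel_source.
apply: closed_borel; have /closed_subspaceP : closed ((f n @^-1` (~` U)) : set (subspace (K n j))).
  by apply: closed_comp => [x _|]; [exact: fK|exact: open_closedC].
move=> [V cV VE]; rewrite setIC -VE; apply: closedI => //.
exact: compact_closed.
Qed.

(** The restriction of P to the source of f n is pushed forward by a map that
    has to be measurable everywhere. *)
Definition patched n (x : borel S) : borel T := if x \in source n then f n x else point.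

Lemma measurable_patched n : measurable_fun [set: borel S] (patched n).
Proof.
move=> _ A mA; rewrite setTI.
have -> : patched n @^-1` A = (source n `&` f n @^-1` A) `|` (~` source n `&` [set _ | A point]).
  apply/seteqP; split=> x; rewrite /= /patched.
    by case: ifPn => [/set_mem|/negP]; [left|rewrite in_setE; right].
  by move=> [[nx fx]|[nx Ap]]; [rewrite mem_set|rewrite memNset].
apply: measurableU; first by apply: measurable_f => //; exact: measurable_source.
apply: measurableI; first by apply: measurableC; exact: measurable_source.
by have [Ap|nAp] := pselect (A point);
  [rewrite (_ : [set _ | _] = setT)|rewrite (_ : [set _ | _] = set0)] => //;
  apply/seteqP; split.
Qed.

Hypothesis P_source : (0 < P (\bigcup_n source n))%E.

Let mass : \bar R := (\sum_(n <oo) (2^-1 ^+ n.+1)%:E * P (source n))%E.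

Let w_ge0 n : (0 <= (2^-1 ^+ n.+1 : R)%:E)%E.
Proof. by rewrite lee_fin exprn_ge0// invr_ge0. Qed.

Let mass_ge0 : (0 <= mass)%E.
Proof. by apply: nneseries_ge0 => n _ _; rewrite mule_ge0. Qed.

Let mass_le1 : (mass <= 1)%E.
Proof.
apply: (@le_trans _ _ (\sum_(n <oo) (1 / (2 ^ n.+1)%:R : R)%:E)%E); last first.
  exact: epsilon_trick0.
apply: lee_nneseries => n _; first by rewrite mule_ge0.
rewrite -[leRHS]mule1 div1r natrX exprVn lee_wpmul2l ?lee_fin ?invr_ge0//.
by apply: probability_le1; exact: measurable_source.
Qed.

Let mass_gt0 : (0 < mass)%E.
Proof.
rewrite lt0e mass_ge0 andbT; apply/negP => /eqP mass0.
have P0 n : P (source n) = 0%E.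
  have : ((2^-1 ^+ n.+1)%:E * P (source n) <= mass)%E.
    rewrite /mass (nneseriesD1 (n := n))//; last by move=> i _; rewrite mule_ge0.
    by rewrite leeDl// nneseries_ge0// => i _ _; rewrite mule_ge0.
  rewrite mass0 => h; have {h} : ((2^-1 ^+ n.+1)%:E * P (source n))%E = 0%E.
    by apply/eqP; rewrite eq_le h mule_ge0.
  move/eqP; rewrite mule_eq0 => /orP[|/eqP//].
  by rewrite eqe expf_eq0/= invr_eq0 pnatr_eq0.
have : (P (\bigcup_n source n) <= \sum_(n <oo) P (source n))%E.
  apply: measure_sigma_subadditive => //.
    by move=> n; exact: measurable_source.
  by apply: bigcupT_measurable => n; exact: measurable_source.
by rewrite eseries0// leNgt P_source.
Qed.

Let Z : R := fine mass.
Let Z0 : 0 < Z.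
Proof. by rewrite fine_gt0// mass_gt0/= (le_lt_trans mass_le1)// ltry. Qed.

(** Geometric weights keep the sum of the glued measures finite, and Z makes
    the total mass equal to 1. *)
Definition weight n : R := 2^-1 ^+ n.+1 / Z.

Lemma weight_gt0 n : 0 < weight n.
Proof. by rewrite divr_gt0// exprn_gt0// invr_gt0. Qed.

Lemma ex_transport : exists P' : probability (borel T) R,
  forall F : borel T -> \bar R, measurable_fun setT F -> (forall y, (0 <= F y)%E) ->
    (\int[P']_y F y = \sum_(n <oo) (weight n)%:E * \int[P]_(x in source n) F (f n x))%E.
Proof.
pose push n : {measure set (borel T) -> \bar R} :=
  measure_function_pushforward__canonical__measure_function_Measure
    (mrestr P (measurable_source n)) (measurable_patched n).
pose w n : {nonneg R} := NngNum (ltW (weight_gt0 n)).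
pose Q : {measure set (borel T) -> \bar R} := mseries (fun n => mscale (w n) (push n)) 0.
have QF (F : borel T -> \bar R) : measurable_fun setT F -> (forall y, (0 <= F y)%E) ->
    (\int[Q]_y F y = \sum_(n <oo) (weight n)%:E * \int[P]_(x in source n) F (f n x))%E.
  move=> mF F0; rewrite ge0_integral_measure_series//; apply: eq_eseriesr => n _.
  rewrite ge0_integral_mscale//; congr (_ * _)%E.
  rewrite ge0_integral_pushforward//=; last exact: measurable_patched.
  rewrite preimage_setT ge0_integral_mrestr//; last first.
    by apply: measurableT_comp => //; exact: measurable_patched.
  by apply: eq_integral => x nx; rewrite /= /patched nx.
have QT : Q setT = 1%E.
  have := QF (cst 1%E) (measurable_cst _) (fun=> lee01).
  rewrite integral_cst// mul1e => ->.
  transitivity (\sum_(n <oo) Z^-1%:E * ((2^-1 ^+ n.+1)%:E * P (source n)))%E.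
    apply: eq_eseriesr => n _; rewrite integral_cst ?mul1e; last exact: measurable_source.
    by rewrite muleA -EFinM mulrC.
  rewrite nneseriesZl; last by move=> n _; rewrite mule_ge0.
  rewrite -/mass -(fineK (x := mass)); last first.
    by rewrite ge0_fin_numE// (le_lt_trans mass_le1)// ltry.
  by rewrite -EFinM mulVf// gt_eqF.
pose P' : probability (borel T) R := HB.pack_for (probability (borel T) R)
  (Measure.sort Q) (Measure_isProbability.Build _ _ _ Q QT).
by exists P'.
Qed.

Section transported.
Variable P' : probability (borel T) R.
Hypothesis P'E : forall F : borel T -> \bar R,
  measurable_fun setT F -> (forall y, (0 <= F y)%E) ->
  (\int[P']_y F y = \sum_(n <oo) (weight n)%:E * \int[P]_(x in source n) F (f n x))%E.

Lemma measurable_pullback n (A : set (borel T)) : measurable A ->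
  measurable (source n `&` f n @^-1` A : set (borel S)).
Proof. by move=> mA; apply: measurable_f => //; exact: measurable_source. Qed.

Lemma transport_measure (A : set (borel T)) : measurable A ->
  (P' A = \sum_(n <oo) (weight n)%:E * P (source n `&` f n @^-1` A))%E.
Proof.
move=> mA; have := P'E (F := fun y => (\1_A y)%:E).
rewrite integral_indic// setIT => ->; last 2 first.
- exact/measurable_EFinP.
- by move=> y; rewrite lee_fin.
apply: eq_eseriesr => n _; congr (_ * _)%E.
transitivity (\int[P]_(x in source n) (\1_(source n `&` f n @^-1` A) x)%:E)%E.
  apply: eq_integral => x /set_mem nx; congr (_%:E).
  rewrite !indicE; congr (_%:R); congr nat_of_bool.
  by apply/idP/idP => /set_mem Ax; apply/mem_set => //; case: Ax.
rewrite integral_indic; [|exact: measurable_source|exact: measurable_pullback].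
by rewrite setIAC setIid.
Qed.

Let weight_ge0 n (A : set (borel S)) : (0 <= (weight n)%:E * P A)%E.
Proof. by rewrite mule_ge0// lee_fin ltW// weight_gt0. Qed.

(** The part of the source outside K n j is small, and inside K n j compact
    sets have compact images. *)
Let pullback_approx n (A : set (borel T)) (e : R) : measurable A -> 0 < e ->
  exists k : set S, [/\ compact k, k `<=` source n `&` f n @^-1` A, compact (f n @` k) &
    (P (source n `&` f n @^-1` A) <= P k + e%:E)%E].
Proof.
move=> mA e0; have e20 : 0 < e / 2 by rewrite divr_gt0.
have mAn := measurable_pullback n mA.
have [j Pj] := K_approx n e20.
have mK := compact_borel_source n j.
have [k [ck kA Pk]] := regular_compact_approx hS regP (measurableI _ _ mAn mK) e20.
have mk : measurable (k : set (borel S)) by apply: closed_borel; exact: compact_closed.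
exists k; split => //; first by move=> x /kA[].
  apply: continuous_compact => //.
  by apply: continuous_subspaceW (fK (n := n) (j := j)) => x /kA[].
rewrite (splitr e) EFinD.
apply: (@le_trans _ _ (P (k `|` ((source n `&` f n @^-1` A `&` K n j) `\` k) `|` (source n `\`
    K n j)))%E).
  apply: le_measure; rewrite ?inE.
  - exact: mAn.
  - apply: measurableU; last by apply: measurableD => //; exact: measurable_source.
    by apply: measurableU => //; apply: measurableD => //; exact: measurableI.
  - move=> x [nx Ax]; have [Kx|Kx] := pselect (K n j x); last by right.
    by left; have [kx|kx] := pselect (k x); [left|right].
apply: (le_trans (measureU2 _ _ _)).
- by apply: measurableU => //; apply: measurableD => //; exact: measurableI.
- by apply: measurableD => //; exact: measurable_source.
rewrite addeA; apply: leeD => //; apply: (le_trans (measureU2 _ _ _)) => //.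
  by apply: measurableD => //; exact: measurableI.
exact: leeD.
Qed.

(** All but finitely many of the glued measures contribute at most e / 2
    together, and a finite union of compact sets is compact. *)
Let transport_inner (A : set (borel T)) (e : R) : measurable A -> 0 < e ->
  exists k : set T, [/\ compact k, k `<=` A & (P' A <= P' k + e%:E)%E].
Proof.
move=> mA e0; have e20 : 0 < e / 2 by rewrite divr_gt0.
pose c n := ((weight n)%:E * P (source n `&` f n @^-1` A))%E.
have sumc : (\sum_(n <oo) c n < +oo)%E.
  by rewrite -transport_measure// (le_lt_trans (probability_le1 _ mA))// ltry.
have [N tail] : exists N, (\sum_(N <= n <oo) c n < (e / 2)%:E)%E.
  have /fine_cvgP[_] := nneseries_tail_cvg sumc (fun n _ => weight_ge0 n _).
  move=> /cvgrPdist_lt/(_ _ e20)[N _ /(_ N (leqnn N))].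
  rewrite /= sub0r normrN => ce; exists N.
  have c0 : (0 <= \sum_(N <= n <oo) c n)%E by apply: nneseries_ge0 => *; exact: weight_ge0.
  move: ce; rewrite ger0_norm ?fine_ge0// -lte_fin fineK//.
  rewrite ge0_fin_numE//; apply: le_lt_trans sumc.
  rewrite [leRHS](nneseries_split 0 N)//; last by move=> *; exact: weight_ge0.
  by rewrite add0n leeDr// sume_ge0// => i _; exact: weight_ge0.
(* The weights multiply these errors, so that each of the N first terms loses
   at most e / 2 / N.+1. *)
pose d n : R := e / 2 / N.+1%:R / weight n.
have d0 n : 0 < d n by rewrite !divr_gt0// weight_gt0.
have /choice[k kP] := fun n => pullback_approx n mA (d0 n).
have [L [cL LA kL]] : exists L : set T, [/\ compact L, L `<=` A &
    forall n, (n < N)%N -> k n `<=` f n @^-1` L].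
  elim: (N) => [|M [L [cL LA kL]]]; first by exists set0; split => //; exact: compact0.
  have [ck kA cfk _] := kP M.
  exists (L `|` f M @` k M); split; first exact: compactU.
    by move=> y [/LA//|[x /kA[_ ?] <-]].
  move=> n; rewrite ltnS leq_eqVlt => /predU1P[-> x kx|nM x kx].
    by right; exists x.
  by left; exact: kL kx.
exists L; split => //.
have mL : measurable (L : set (borel T)) by apply: closed_borel; exact: compact_closed.
rewrite (transport_measure mA) (nneseries_split 0 N)//.
rewrite add0n (splitr e) EFinD addeA; apply: leeD; last exact: ltW tail.
apply: (@le_trans _ _ (\sum_(0 <= n < N) ((weight n)%:E * P (source n `&` f n @^-1` L) + (e / 2
    / N.+1%:R)%:E))%E).
  rewrite !big_nat; apply: lee_sum => n /= nN; have [ck kA _ Pk] := kP n.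
  have -> : ((e / 2 / N.+1%:R)%:E = (weight n)%:E * (d n)%:E)%E.
    by rewrite -EFinM; congr (_%:E); rewrite /d [RHS]mulrC divfK// gt_eqF// weight_gt0.
  have wn0 : (0 <= (weight n)%:E)%E by rewrite lee_fin ltW// weight_gt0.
  rewrite -ge0_muleDr//; last by rewrite lee_fin ltW.
  apply: lee_wpmul2l => //; apply: (le_trans Pk); apply: leeD => //.
  apply: le_measure; rewrite ?inE.
  - by apply: closed_borel; exact: compact_closed.
  - exact: measurable_pullback.
  - by move=> x kx; split; [case: (kA _ kx)|exact: kL kx].
rewrite big_split/=; apply: leeD.
  rewrite (transport_measure mL); apply: nneseries_lim_ge => n _ _.
  exact: weight_ge0.
rewrite sumEFin; suff : e / 2 / N.+1%:R *+ N <= e / 2 by rewrite sumr_const_nat subn0.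
rewrite -mulr_natr -mulrA ger_pMr//.
by rewrite mulrC ler_pdivrMr// mul1r ler_nat.
Qed.

(** Outer regularity is inner regularity of the complement, compact sets
    being closed. *)
Lemma transport_regular : regular_measure P'.
Proof.
have fin (B : set (borel T)) : measurable B -> P' B \is a fin_num.
  by move=> mB; rewrite fin_num_measure.
move=> A mA; split; apply/eqP; rewrite eq_le; apply/andP; split.
- by apply: le_ereal_inf_tmp => _ [U [oU AU] <-]; apply: le_measure; rewrite ?inE//; exact:
    open_borel.
- apply/lee_addgt0Pr => e e0.
  have [k [ck kA Pk]] := transport_inner (measurableC mA) e0.
  have mk : measurable (k : set (borel T)) by apply: closed_borel; exact: compact_closed.
  apply: (@le_trans _ _ (P' (~` k))).
    apply: ereal_inf_lbound; exists (~` k) => //; split.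
      by apply: closed_openC; exact: compact_closed.
    by move=> x Ax /kA.
  have {Pk} Pk : (1 - P' A <= P' k + e%:E)%E by rewrite -probability_setC.
  rewrite probability_setC//; suff : (1 - P' k <= P' A + e%:E)%E by [].
  move: Pk (fin _ mA) (fin _ mk); case: (P' A) => [x||]//; case: (P' k) => [y||]//.
  move=> + _ _; rewrite !leeBlDr//.
  by move=> /le_trans; apply; rewrite [leRHS]addeC [leRHS]addeA [leRHS]addeAC.
- apply/lee_addgt0Pr => e e0; have [k [ck kA Pk]] := transport_inner mA e0.
  by apply: (le_trans Pk); rewrite leeD2r//; apply: ereal_sup_ubound; exists k.
- apply: ge_ereal_sup => _ [k [ck kA] <-]; apply: le_measure; rewrite ?inE//.
  by apply: closed_borel; exact: compact_closed.
Qed.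

(** A function that is known on the targets through the maps f n inherits
    measurability from the inverse maps. Dividing by the weights cancels
    those of the glued measure. *)
Lemma transport_integral (G : nat -> borel S -> \bar R) (F : borel T -> \bar R) :
  (forall n, measurable_fun setT (G n)) -> (forall n x, (0 <= G n x)%E) ->
  (forall n x, source n x -> F (f n x) = ((weight n)^-1%:E * G n x)%E) ->
  (forall y, (forall n, ~ target n y) -> F y = 0%E) ->
  measurable_fun setT F /\
  (\int[P']_y F y = \sum_(n <oo) \int[P]_(x in source n) G n x)%E.
Proof.
move=> mG G0 FG F0; have w0 n : 0 <= (weight n)^-1 by rewrite invr_ge0 ltW// weight_gt0.
have FinvE n y : target n y -> F y = ((weight n)^-1%:E * G n (inverse n y))%E.
  by move=> /target_inverse[ny {1}<-]; exact: FG.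
have Fge0 y : (0 <= F y)%E.
  have [[n ny]|nt] := pselect (exists n, target n y).
    by rewrite (FinvE n)// mule_ge0// lee_fin.
  by rewrite F0// => n ny; apply: nt; exists n.
have mF : measurable_fun setT F.
  move=> _ V mV; rewrite setTI.
  have -> : F @^-1` V =
      \bigcup_n (target n `&` (fun y => (weight n)^-1%:E * G n (inverse n y))%E @^-1` V)
      `|` (~` (\bigcup_n target n) `&` [set _ | V 0%E]).
    apply/seteqP; split=> y /=.
      have [[n ny]|nt] := pselect (exists n, target n y).
        by rewrite (FinvE n)// => Vy; left; exists n.
      rewrite F0; last by move=> n ny; apply: nt; exists n.
      by right; split => // -[n _ ny]; apply: nt; exists n.
    move=> [[n _ [ny Vy]]|[nt V0]]; first by rewrite (FinvE n).
    by rewrite F0// => n ny; apply: nt; exists n.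
  apply: measurableU.
    apply: bigcupT_measurable => n; have mt := measurable_target n.
    have : measurable_fun (target n : set (borel T)) (fun y => (weight n)^-1%:E * G n (inverse
        n y))%E.
      apply: emeasurable_funM; first exact: measurable_cst.
      by apply: measurableT_comp (mG n) _; exact: measurable_inverse.
    exact.
  apply: measurableI.
    by apply: measurableC; apply: bigcupT_measurable => n; exact: measurable_target.
  by have [V0|V0] := pselect (V 0%E);
    [rewrite (_ : [set _ | _] = setT)|rewrite (_ : [set _ | _] = set0)] => //;
    apply/seteqP; split.
split => //; rewrite P'E//; apply: eq_eseriesr => n _.
have ms := measurable_source n; have wn := weight_gt0 n.
transitivity ((weight n)%:E * \int[P]_(x in source n) ((weight n)^-1%:E * G n x))%E.
  by congr (_ * _)%E; apply: eq_integral => x /set_mem; exact: FG.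
rewrite ge0_integralZl//; last 2 first.
- exact: measurable_funTS.
- by rewrite lee_fin.
by rewrite muleA -EFinM mulfV ?mul1e// gt_eqF.
Qed.

Lemma transport_ae (Q : S -> Prop) (Q' : T -> Prop) : {ae P, forall x, Q x} ->
  (forall n x, source n x -> Q x -> Q' (f n x)) -> {ae P', forall y, Q' y}.
Proof.
move=> [N [mN N0 QN]] QQ'.
pose N' : set (borel T) := ~` (\bigcup_n target n) `|` \bigcup_n (target n `&` inverse n @^-1` N).
have mN' : measurable N'.
  apply: measurableU.
    by apply: measurableC; apply: bigcupT_measurable => n; exact: measurable_target.
  apply: bigcupT_measurable => n; apply: measurable_inverse => //.
  exact: measurable_target.
exists N'; split => //.
  rewrite transport_measure// eseries0// => n _ _.
  rewrite (@subset_measure0 _ _ _ P _ N) ?mule0//; first exact: measurable_pullback.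
  move=> x [nx [nt|[m _ [[z mz zx] Nx]]]]; first by case: nt; exists n => //; exists x.
  have [mn zxE] := f_inj mz nx zx; move: Nx.
  by rewrite /= -zx inverseK// zxE.
move=> y /= Qy; have [[n ny]|nt] := pselect (exists n, target n y).
  right; exists n => //; split => //; apply: QN => /= Qi; apply: Qy.
  by have [si fi] := target_inverse ny; rewrite -fi; exact: QQ'.
by left => -[n _ ny]; apply: nt; exists n.
Qed.

End transported.

End transport.

(** * Measurability of the translation *)

Section measurable_translate.
Context (R : realType) (X : completeMetricType R) (a b : R).
Hypothesis ab : a < b.
Variable u : nat -> X.
Hypothesis u_dense : forall x e, 0 < e -> exists i, mdist (u i) x < e.
Variable g0 : frag X.

Local Notation delta := ((b - a) / 2).
Local Notation fam := (family delta u).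

Let delta0 : 0 < delta. Proof. by rewrite divr_gt0// subr_gt0. Qed.

Lemma measurable_digits n i :
  measurable_fun [set: borel (frag_at g0)] ((fun g => digits a b u n g i) : borel (frag_at g0)
      -> bool).
Proof.
apply: (measurable_fun_bool true); rewrite setTI /digits.
case: (odd i) => /=.
  rewrite (_ : _ @^-1` _ = fam i./2); first exact: measurable_family.
  by apply/seteqP; split=> g /=; [move/asboolP|move=> ?; apply/asboolP].
by case: (_ == n); [rewrite (_ : _ @^-1` _ = setT)|rewrite (_ : _ @^-1` _ = set0)] => //;
  apply/seteqP; split.
Qed.

(** The code is a limit of finite sums of digits, and digits are indicators
    of Borel sets. *)
Lemma measurable_code_digits n :
  measurable_fun [set: borel (frag_at g0)]
    ((fun g => code R (digits a b u n g)) : borel (frag_at g0) -> measurableTypeR R).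
Proof.
apply: (measurable_fun_cvg (h := fun k (g : borel (frag_at g0)) => code_partial R (digits a b u
    n g) k)).
  move=> k; rewrite /code_partial; apply: measurable_sum => i.
  apply: measurable_funM; last exact: measurable_cst.
  apply: (@measurableT_comp _ _ _ _ _ _ (fun c : bool => c%:R : R)); last exact: measurable_digits.
  by move=> _ V _; rewrite setTI.
move=> g _; apply/cvgrPdist_le => e e0.
have : (4^-1 : R) ^+ k @[k --> \oo] --> (0 : R).
  by apply: cvg_expr; rewrite ger0_norm ?invr_ge0// invf_lt1// ltr1n.
move=> /cvgrPdist_le/(_ _ e0); apply: filterS => k.
have q0 : 0 < (4^-1 : R) ^+ k by rewrite exprn_gt0// invr_gt0.
rewrite sub0r normrN gtr0_norm// => ke.
have /andP[h1 h2] := code_bounds R (digits a b u n g) k.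
by rewrite ger0_norm ?subr_ge0//; lra.
Qed.

(** If g meets the cell, the infimum is at least r if and only if the graph
    over the cell misses the half-lines that end before r, and missing a
    closed set is an open condition. *)
Lemma measurable_inf_dom_cell n :
  measurable_fun [set: borel (frag_at g0)]
    ((fun g => inf (dom_cell a b n g)) : borel (frag_at g0) -> measurableTypeR R).
Proof.
pose M (J : set R) : set (borel (frag_at g0)) := meets [set z : R * X | (cell delta n `&` J) z.1].
have mM J : closed J -> measurable (M J).
  move=> cJ; apply: (@closed_borel (frag_at g0)); apply: closed_meets; apply: closed_fst.
  by apply: closedI => //; exact: closed_cell.
have ME J (g : frag X) : M J g <-> dom_cell a b n g `&` J !=set0.
  split=> [[_ [[t gt <-] [/= ct Jt]]]|[t [[gt ct] Jt]]]; first by exists t.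
  by exists (t, g t); split => //; exists t.
apply: (measurability _ (RGenCInfty.measurableE R)).
move=> _ [_ [r ->] <-]; rewrite setTI.
have -> : (fun g => inf (dom_cell a b n g)) @^-1` `[r, +oo[ =
   (M setT `&` ~` (\bigcup_k M `]-oo, r - k.+1%:R^-1]%classic)) `|`
   (~` M setT `&` [set _ | 0 \in `[r, +oo[]) :> set (borel (frag_at g0)).
  apply/seteqP; split=> g /=; rewrite in_itv/= andbT.
    have [ne|ne] := pselect (M setT g).
      move: (ne) => /ME; rewrite setIT => gne rg.
      left; split => // -[k _ /ME[t [gt /=]]]; rewrite in_itv/= => tr.
      have hlb : has_lbound (dom_cell a b n g).
        by exists ((cell_index n)%:~R * delta) => s [_ /cell_width/andP[]].
      have := ge_inf hlb gt; have : 0 < k.+1%:R^-1 :> R by rewrite invr_gt0.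
      by move: (_^-1) tr => q; lra.
    move=> rg; right; split => //; move: rg.
    have -> : dom_cell a b n g = set0.
      apply/seteqP; split => // t gt; apply: ne; apply/ME; exists t => //.
    by rewrite inf0 in_itv/= andbT.
  rewrite in_itv/= andbT.
  move=> [[/ME]|[ne]].
    rewrite setIT => gne nr; apply: lb_le_inf => // t gt; rewrite leNgt; apply/negP => tr.
    apply: nr; have [k kr] : exists k, k.+1%:R^-1 < r - t.
      exists (Num.truncn (r - t)^-1); rewrite invf_plt ?posrE ?subr_gt0//.
      exact: truncnS_gt.
    by exists k => //; apply/ME; exists t; split => //=; rewrite in_itv/= lerBrDr addrC
        -lerBrDr (ltW kr).
  have -> : dom_cell a b n g = set0.
    by apply/seteqP; split => // t gt; apply: ne; apply/ME; exists t.
  by rewrite inf0.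
apply: measurableU; apply: measurableI.
- by apply: mM; exact: closedT.
- apply: measurableC; apply: bigcupT_measurable => k; apply: mM.
  exact: interval_closed.
- by apply: measurableC; apply: mM; exact: closedT.
by case: (0 \in _); [rewrite (_ : [set _ | _] = setT)|rewrite (_ : [set _ | _] = set0)] => //;
  apply/seteqP; split.
Qed.

Lemma measurable_translate n :
  measurable_fun [set: borel (frag_at g0)]
    (translate a b u n : borel (frag_at g0) -> measurableTypeR R).
Proof.
rewrite /translate; apply: measurable_funB.
  by apply: measurable_funB; [exact: measurable_inf_dom_cell|exact: measurable_cst].
by apply: measurable_funM; [exact: measurable_cst|exact: measurable_code_digits].
Qed.

End measurable_translate.

(** * Integrals of functions that need not be measurable, and disintegration *)

Section null_modification.
Context d (T : measurableType d) (R : realType) (mu : {measure set T -> \bar R}).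
Local Open Scope ereal_scope.
Import HBNNSimple.

(** A simple function below f1, set to zero on N, is below f2 and has the
    same integral. *)
Let le_nnintegral (N : set T) (f1 f2 : T -> \bar R) : measurable N -> mu N = 0 ->
  (forall x, 0 <= f2 x) -> (forall x, ~ N x -> f1 x = f2 x) ->
  ereal_sup [set sintegral mu h | h in [set h : {nnsfun T >-> R} | forall x, (h x)%:E <= f1 x]] <=
  ereal_sup [set sintegral mu h | h in [set h : {nnsfun T >-> R} | forall x, (h x)%:E <= f2 x]].
Proof.
move=> mN N0 f20 f12; apply: ge_ereal_sup => _ [h hf1 <-].
pose h' : {nnsfun T >-> R} := mul_nnsfun h (indic_nnsfun R (measurableC mN)).
have h'E x : h' x = (h x * \1_(~` N) x)%R by [].
have -> : sintegral mu h = sintegral mu h'.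
  rewrite -!integralT_nnsfun; apply: ge0_ae_eq_integral => //.
  - exact/measurable_EFinP.
  - exact/measurable_EFinP.
  - by move=> x _; rewrite lee_fin.
  - by move=> x _; rewrite lee_fin.
  exists N; split => // x /= /not_implyP[_ hh']; apply: contrapT => Nx.
  have h'x : h' x = h x by rewrite h'E indicE mem_set// mulr1.
  by apply: hh'; rewrite -[in LHS]h'x.
apply: ereal_sup_ubound; exists h' => // x; rewrite h'E indicE.
have [Nx|Nx] := pselect (N x); first by rewrite memNset ?mulr0//= => /(_ Nx).
by rewrite mem_set// mulr1 -f12.
Qed.

(** The integral of a function that is not known to be measurable is still
    determined by its values off a null set, because a simple function below
    it may be set to zero there. *)
Lemma integral_null_modification (N : set T) (f1 f2 : T -> \bar R) :
  measurable N -> mu N = 0 -> (forall x, ~ N x -> f1 x = f2 x) ->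
  \int[mu]_x f1 x = \int[mu]_x f2 x.
Proof.
move=> mN N0 f12; rewrite /integral !patch_setT.
have f21 x : ~ N x -> f2 x = f1 x by move=> /f12.
have p (f f' : T -> \bar R) x : (~ N x -> f x = f' x) -> ~ N x -> f^\+ x = f'^\+ x.
  by move=> ff' Nx; rewrite !funeposE ff'.
have n (f f' : T -> \bar R) x : (~ N x -> f x = f' x) -> ~ N x -> f^\- x = f'^\- x.
  by move=> ff' Nx; rewrite !funenegE ff'.
by congr (_ - _); apply/eqP; rewrite eq_le !(le_nnintegral mN N0)// => x; auto.
Qed.

Lemma integral_ae_eq (f1 f2 : T -> \bar R) : {ae mu, forall x, f1 x = f2 x} ->
  \int[mu]_x f1 x = \int[mu]_x f2 x.
Proof.
move=> [N [mN N0 fN]]; apply: (integral_null_modification mN N0) => x Nx.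
by apply: contrapT => fx; apply: Nx; exact: fN.
Qed.

End null_modification.

Section disintegration.
Context (R : realType) (X : completeMetricType R) (g0 : frag X).
Variable P : probability (borel (frag_at g0)) R.
Variable nu : frag X -> {finite_measure set (borel X) -> \bar R}.
Hypothesis nu_ac : forall g, nu g `<< (fun B : set (borel X) =>
  hausdorff1 (B `&` image_frag g)).
Hypothesis nu_itv : forall (B : set (borel X)) (a b : R), measurable B -> a <= b ->
  measurable_fun [set: borel (frag_at g0)]
    ((fun g : frag X => nu g (B `&` g @` (dom g `&` `[a, b]))) :
       borel (frag_at g0) -> \bar R).
Variable m : {measure set (borel X) -> \bar R}.
Hypothesis mE : forall B : set (borel X), measurable B -> (m B = \int[P]_g nu g B)%E.
Local Open Scope ereal_scope.
Import HBNNSimple.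

Lemma measurable_nu_fun (h : borel X -> \bar R) : measurable_fun setT h ->
  (forall x, 0 <= h x) ->
  measurable_fun [set: borel (frag_at g0)]
    ((fun g : frag X => \int[nu g]_x h x) : borel (frag_at g0) -> \bar R).
Proof.
move=> mh h0; have := @measurable_nu_integral R X g0 nu nu_ac nu_itv (fun z => h z.2.2).
apply => // ; apply: (measurableT_comp mh).
by apply: (measurableT_comp measurable_snd); exact: measurable_snd.
Qed.

Lemma measurable_nu_set (B : set (borel X)) : measurable B ->
  measurable_fun [set: borel (frag_at g0)]
    ((fun g : frag X => nu g B) : borel (frag_at g0) -> \bar R).
Proof.
move=> mB; apply: (eq_measurable_fun (fun g : borel (frag_at g0) => \int[nu g]_x (\1_B x)%:E)).
  by move=> g _; rewrite integral_indic ?setIT.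
apply: measurable_nu_fun; first exact/measurable_EFinP.
by move=> x; rewrite lee_fin.
Qed.

Lemma integral_disintegration (h : borel X -> \bar R) : measurable_fun setT h ->
  (forall x, 0 <= h x) -> \int[m]_x h x = \int[P]_g \int[nu g]_x h x.
Proof.
move=> mh h0; pose h_ := nnsfun_approx measurableT mh.
have mh_ n : measurable_fun [set: borel X] (EFin \o h_ n) by exact/measurable_EFinP.
have h_0 n x : 0 <= (EFin \o h_ n) x by rewrite lee_fin.
have h_nd x : {homo (fun n => (EFin \o h_ n) x) : i j / (i <= j)%N >-> i <= j}.
  by move=> i j ij; rewrite lee_fin; exact/lefP/nd_nnsfun_approx.
have lim_h (q : {measure set (borel X) -> \bar R}) :
    \int[q]_x h x = limn (fun n => \int[q]_x (EFin \o h_ n) x).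
  rewrite -monotone_convergence//; apply: eq_integral => x _.
  by apply/esym/cvg_lim => //; exact: cvg_nnsfun_approx.
have nd_h (q : {measure set (borel X) -> \bar R}) :
    {homo (fun n => \int[q]_x (EFin \o h_ n) x) : i j / (i <= j)%N >-> i <= j}.
  by move=> i j ij; apply: ge0_le_integral => // x _; exact: h_nd.
rewrite lim_h; transitivity (limn (fun n => \int[P]_g \int[nu g]_x (EFin \o h_ n) x)).
  congr (limn _); apply/funext => n.
  rewrite [LHS]integralT_nnsfun sintegralE.
  transitivity (\int[P]_g (\sum_(r \in range (h_ n)) r%:E * nu g (h_ n @^-1` [set r]))).
    have mr r : measurable (h_ n @^-1` [set r]) by [].
    rewrite ge0_integral_fsum//.
    - apply: eq_fsbigr => r /set_mem[x _ rx].
      rewrite ge0_integralZl//; first by rewrite mE.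
        exact: measurable_nu_set.
      by rewrite lee_fin -rx.
    - move=> r; apply: emeasurable_funM; first exact: measurable_cst.
      exact: measurable_nu_set.
    - by move=> r g _; exact: nnsfun_mulemu_ge0.
  by apply: eq_integral => g _; rewrite [RHS]integralT_nnsfun sintegralE.
rewrite -monotone_convergence//.
- by apply: eq_integral => g _; rewrite lim_h.
- by move=> n; exact: measurable_nu_fun.
- by move=> n g _; exact: integral_ge0.
Qed.

End disintegration.

(** * A measurable version of the derivative along a fragment *)

(** This form has no division, so that it may be applied at two points on
    both sides of t and the errors added. *)
Lemma derivable_expansion (R : realType) (F : R -> R) (t e : R) : derivable F t 1 ->
  0 < e -> exists2 r, 0 < r & forall s, `|s - t| < r ->
    `|F s - F t - 'D_1 F t * (s - t)| <= e * `|s - t|.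
Proof.
move=> dF e0; have : h^-1 *: ((F \o shift t) (h *: 1) - F t) @[h --> 0^'] --> 'D_1 F t by exact: dF.
move=> /cvgrPdist_le/(_ _ e0); rewrite near_withinE -nbhs_ballE => -[r /= r0 tr].
exists r => // s str; have [->|st] := eqVneq s t.
  by rewrite !subrr mulr0 subr0 normr0 mulr0.
have st0 : s - t != 0 by rewrite subr_eq0.
have := tr (s - t); rewrite /ball/= sub0r normrN => /(_ str st0).
rewrite [(_ - _) *: _]mulr1 subrK => /(ler_wpM2r (normr_ge0 (s - t))).
rewrite -normrM; by rewrite mulrBl [_ *: _]mulrC mulfVK// distrC.
Qed.

Section velocity.
Context (R : realType) (X : completeMetricType R).
Variables (f : X -> R) (M Lam : R).
Hypothesis fM : forall x, `|f x| <= M.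
Hypothesis fc : continuous f.
Hypothesis Lam0 : 0 <= Lam.
Implicit Types (g : frag X).

(** The McShane extension to the line of the composition of f and g; it
    extends that map when it is Lam-Lipschitz on dom g. *)
Definition mcshane g (t : R) : R := inf [set f (g s) + Lam * `|t - s| | s in dom g].

Lemma dom_nonempty g : dom g !=set0.
Proof. by apply/set0P/eqP => g0; have := dom_gt0 g; rewrite g0 measure0 ltxx. Qed.

Lemma has_inf_mcshane g t : has_inf [set f (g s) + Lam * `|t - s| | s in dom g].
Proof.
split; first by have [s gs] := dom_nonempty g; exists (f (g s) + Lam * `|t - s|); exists s.
exists (- M) => _ [s gs <-]; rewrite -[leLHS]addr0 lerD ?mulr_ge0//.
by have := fM (g s); rewrite ler_norml => /andP[].
Qed.

Lemma mcshane_lt g t r : mcshane g t < r <-> exists2 s, dom g s & f (g s) + Lam * `|t - s| < r.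
Proof.
have [ne _] := has_inf_mcshane g t.
split=> [/(inf_lt ne)[_ [s gs <-]]|[s gs]]; first by exists s.
apply: le_lt_trans; apply: ge_inf; last by exists s.
by have [] := has_inf_mcshane g t.
Qed.

Lemma mcshane_le g t s : dom g s -> mcshane g t <= f (g s) + Lam * `|t - s|.
Proof. by move=> gs; apply: ge_inf; [have [] := has_inf_mcshane g t|exists s]. Qed.

Lemma mcshane_lip g t t' : `|mcshane g t - mcshane g t'| <= Lam * `|t - t'|.
Proof.
have half x y : mcshane g x - mcshane g y <= Lam * `|x - y|.
  rewrite lerBlDl -lerBlDr; have [ne lb] := has_inf_mcshane g y.
  apply: lb_le_inf => // _ [s gs <-]; rewrite lerBlDr; apply: (le_trans (mcshane_le x gs)).
  rewrite -addrA lerD2l -mulrDr ler_wpM2l// [leRHS]addrC; exact: ler_distD.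
rewrite ler_norml half andbT lerNl opprB distrC; exact: half.
Qed.

Definition lip_along g := forall s t, dom g s -> dom g t -> `|f (g s) - f (g t)| <= Lam * `|s - t|.

Lemma mcshane_ext g t : lip_along g -> dom g t -> mcshane g t = f (g t).
Proof.
move=> gL gt; apply/eqP; rewrite eq_le; apply/andP; split.
  by have := mcshane_le t gt; rewrite subrr normr0 mulr0 addr0.
have [ne _] := has_inf_mcshane g t; apply: lb_le_inf => // _ [s gs <-].
by rewrite -lerBlDl; apply: le_trans (gL t s gt gs); exact: ler_norm.
Qed.

(** The extension takes a value less than r at t if and only if the graph of
    g meets an open set. *)
Lemma measurable_mcshane (g0 : frag X) t : measurable_fun [set: borel (frag_at g0)]
  (mcshane ^~ t : borel (frag_at g0) -> measurableTypeR R).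
Proof.
apply: (measurability _ (RGenCInfty.measurableE R)) => _ [_ [r ->] <-]; rewrite setTI.
pose U : set (R * X) := [set z | f z.2 + Lam * `|t - z.1| < r].
have -> : mcshane ^~ t @^-1` `[r, +oo[ = ~` meets U :> set (borel (frag_at g0)).
  apply/seteqP; split=> g /=; rewrite in_itv/= andbT.
    move=> rg [_ [[s gs <-] /= Us]]; move: rg; rewrite leNgt => /negP; apply.
    by apply/mcshane_lt; exists s.
  move=> gU; rewrite leNgt; apply/negP => /mcshane_lt[s gs sr]; apply: gU.
  by exists (s, g s); split => //; exists s.
apply: measurableC; apply: (@open_borel (frag_at g0)); apply: open_meets.
have -> : U = (fun z : R * X => f z.2 + Lam * `|t - z.1|) @^-1` `]-oo, r[%classic.
  by apply/seteqP; split=> z; rewrite /U/= in_itv.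
apply: open_comp; last exact: interval_open.
move=> z _; apply: cvgD; first by apply: continuous_comp; [exact: cvg_snd|exact: fc].
apply: cvgMr; apply: cvg_norm; apply: cvgB; first exact: cvg_cst.
exact: cvg_fst.
Qed.

(** Difference quotient over the grid cell of length k.+1%:R^-1 around t; taking
    the end points in a countable grid makes it jointly measurable. *)
Definition quotient k g t : R :=
  let d := k.+1%:R^-1 in let e := (Num.floor (t / d))%:~R * d in
  (mcshane g (e + d) - mcshane g e) / d.

Lemma measurable_quotient (g0 : frag X) k :
  measurable_fun [set: borel (frag_at g0) * measurableTypeR R]
    ((fun z => quotient k (z.1 : frag X) z.2) :
       borel (frag_at g0) * measurableTypeR R -> measurableTypeR R).
Proof.
move=> _ V mV; rewrite setTI; set d : R := k.+1%:R^-1.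
pose q n (g : borel (frag_at g0)) : measurableTypeR R :=
  (mcshane g ((cell_index n)%:~R * d + d) - mcshane g ((cell_index n)%:~R * d)) / d.
have mq n : measurable_fun setT (q n).
  apply: measurable_funM; last exact: measurable_cst.
  by apply: measurable_funB; exact: measurable_mcshane.
have -> : (fun z : borel (frag_at g0) * measurableTypeR R => quotient k (z.1 : frag X) z.2)
    @^-1` V =
    \bigcup_n ((q n @^-1` V) `*` half_open_cell d n).
  apply/seteqP; split=> [[g t] /= Vt|[g t] [n _ [/= Vt]]].
    exists (pickle (Num.floor (t / d))) => //; split => //.
    by move: Vt; rewrite /q /quotient/= /cell_index pickleK.
  by rewrite /half_open_cell/= => tn; move: Vt; rewrite /q /quotient/= -tn /cell_index pickleK.
apply: bigcupT_measurable => n; apply: measurableX; last by apply: measurable_half_open_cell;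
    rewrite invr_gt0.
by rewrite -[X in measurable X]setTI; apply: mq.
Qed.

(** The quotients are between - Lam and Lam, and so is their upper limit; the
    truncation makes this bound immediate. *)
Definition velocity g t : R :=
  Num.max (- Lam) (Num.min Lam (fine (limn_esup (fun k => (quotient k g t)%:E)))).

Lemma velocity_bound g t : `|velocity g t| <= Lam.
Proof.
rewrite ler_norml /velocity le_max lexx/= ge_max ge_min lexx/= andbT.
by rewrite (le_trans _ Lam0)// oppr_le0.
Qed.

Lemma measurable_velocity (g0 : frag X) :
  measurable_fun [set: borel (frag_at g0) * measurableTypeR R]
    ((fun z => velocity (z.1 : frag X) z.2) :
       borel (frag_at g0) * measurableTypeR R -> measurableTypeR R).
Proof.
apply: measurable_maxr; first exact: measurable_cst.
apply: measurable_minr; first exact: measurable_cst.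
apply: (measurableT_comp (fine_measurable measurableT)).
apply: (@measurable_fun_limn_esup _ _ _ _ (fun k (z : borel (frag_at g0) * measurableTypeR R)
    => (quotient k (z.1 : frag X) z.2)%:E)).
by move=> k; apply/measurable_EFinP; exact: measurable_quotient.
Qed.

(** The end points of the grid cell enclose t, so that the errors of the
    expansions at both ends add up to at most e times the length of the cell. *)
Lemma quotient_cvg g t : derivable (mcshane g) t 1 ->
  quotient k g t @[k --> \oo] --> 'D_1 (mcshane g) t.
Proof.
move=> dF; apply/cvgrPdist_le => e e0; have [r r0 tr] := derivable_expansion dF e0.
have : \forall k \near \oo, (k.+1%:R^-1 : R) < r.
  exact: (near_infty_natSinv_lt (PosNum r0)).
apply: filterS => k; rewrite /quotient.
have d0 : 0 < (k.+1%:R^-1 : R) by rewrite invr_gt0.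
move: (_^-1) d0 => d d0 dr; set x := _ * d.
have /andP[x1 x2] := floor_itv (t / d).
have xt : x <= t by rewrite -ler_pdivlMr.
have tx : t < x + d by rewrite /x -[X in _ + X]mul1r -mulrDl -ltr_pdivrMr//; move: x2; rewrite
    intrD.
have h1 : `|x - t| < r by rewrite ler0_norm ?subr_le0//; lra.
have h2 : `|x + d - t| < r by rewrite gtr0_norm ?subr_gt0//; lra.
have := tr _ h1; have := tr _ h2; rewrite [`|x - t|]ler0_norm ?subr_le0//.
rewrite [`|x + d - t|]gtr0_norm ?subr_gt0// => {}h2 {}h1.
set l := 'D_1 _ t in h1 h2 *.
suff : `|(l - (mcshane g (x + d) - mcshane g x) / d) * d| <= e * d.
  by rewrite normrM (gtr0_norm d0) ler_pM2r.
rewrite mulrBl divfK ?gt_eqF//.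
have -> : l * d - (mcshane g (x + d) - mcshane g x) =
  (mcshane g x - mcshane g t - l * (x - t)) - (mcshane g (x + d) - mcshane g t - l * (x + d - t)).
  by ring.
apply: (le_trans (ler_normB _ _)); lra.
Qed.

Lemma velocity_derive g t : derivable (mcshane g) t 1 -> velocity g t = 'D_1 (mcshane g) t.
Proof.
move=> dF; have cq := quotient_cvg dF.
have ql k : `|quotient k g t| <= Lam.
  rewrite /quotient normrM normfV ler_pdivrMr ?normr_gt0//.
  by rewrite (le_trans (mcshane_lip _ _ _))// addrAC subrr add0r.
have [_ qE] : (limn_einf (fun k => (quotient k g t)%:E) = ('D_1 (mcshane g) t)%:E) *
    (limn_esup (fun k => (quotient k g t)%:E) = ('D_1 (mcshane g) t)%:E).
  by apply: cvg_limn_einf_sup; apply/cvg_EFin => //; exact: nearW.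
rewrite /velocity qE/=.
have /andP[l1 l2] : - Lam <= 'D_1 (mcshane g) t <= Lam.
  apply/andP; split; [apply: (cvgr_to_ge cq)|apply: (cvgr_to_le cq)];
    apply: nearW => k; have := ql k; rewrite ler_norml => /andP[] //.
by rewrite min_r// max_r.
Qed.

Lemma is_deriv_along_mcshane g t : lip_along g -> dom g t -> limit_point (dom g) t ->
  derivable (mcshane g) t 1 -> is_deriv_along g f t ('D_1 (mcshane g) t).
Proof.
move=> gL gt lt dF; split => //; apply/cvgrPdist_le => e e0.
have [r r0 tr] := derivable_expansion dF e0.
rewrite !near_withinE -nbhs_ballE; exists r => // s ts st gs.
have {}ts : `|s - t| < r by rewrite distrC.
have := tr s ts; rewrite !mcshane_ext//.
have st0 : s - t != 0 by rewrite subr_eq0.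
rewrite -ler_pdivrMr ?normr_gt0// -normrV ?unitfE// -normrM mulrBl mulfK//.
by rewrite distrC.
Qed.

Lemma partial_frag_deriv g t l : dom g t -> is_deriv_along g f t l ->
  partial_frag g f (g t) = l.
Proof.
move=> gt gl; have : [set l | exists t', [/\ dom g t', g t' = g t & is_deriv_along g f t' l]] l.
  by exists t.
rewrite /partial_frag => /(xgetI 0)[s [gs gst]]; set l' := xget _ _ => gl'.
have st : s = t by exact: frag_inj gs gt gst.
move: gl'; rewrite st => -[_ gl']; case: gl => lt gl.
have FF : ProperFilter (within (dom g) t^').
  apply: Build_ProperFilter_ex => P; rewrite /within/= /dnbhs/= /within/= => /lt[r [rt gr Pr]].
  by exists r; exact: Pr.
by apply: cvg_unique gl' gl; exact: Rhausdorff.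
Qed.

(** A Lipschitz function on dom g extends to the line, where it is
    differentiable almost everywhere; at a limit point of dom g the derivative
    of the extension is the derivative along g. *)
Lemma partial_frag_velocity g : lip_along g ->
  {ae @lebesgue_measure R, forall t, dom g t -> partial_frag g f (g t) = velocity g t}.
Proof.
move=> gL; have dF := lipschitz_derivable_ae (mcshane_lip g).
have lp := ae_limit_point g; move: dF lp.
apply: filterS2; first exact: (ae_filter_ringOfSetsType (@lebesgue_measure R)).
move=> t dF /[swap] gt /(_ gt) lt; rewrite velocity_derive//.
by apply: partial_frag_deriv => //; exact: is_deriv_along_mcshane.
Qed.

End velocity.

(** * The representation on the pieces *)

(** From a representation (P, nu) and compact sets C j of fragments that
    split the family, the probability P is transported to the normal pieces
    of fragments that charge a cell. The fragments of C j that charge cell n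
    form a compact set, because charging it is one of the conditions of the
    family. *)
Section moved_representation.
Context (R : realType) (X : completeMetricType R) (a b : R).
Hypothesis ab : a < b.
Variable u : nat -> X.
Hypothesis u_dense : forall x e, 0 < e -> exists i, mdist (u i) x < e.
Variables (g0 : frag X) (P : probability (borel (frag_at g0)) R).
Variable nu : frag X -> {finite_measure set (borel X) -> \bar R}.
Hypothesis regP : regular_measure P.
Hypothesis nu_ac : forall g, nu g `<< (fun B : set (borel X) =>
  hausdorff1 (B `&` image_frag g)).
Hypothesis nu_itv : forall (B : set (borel X)) (c d : R), measurable B -> c <= d ->
  measurable_fun [set: borel (frag_at g0)]
    ((fun g : frag X => nu g (B `&` g @` (dom g `&` `[c, d]))) :
       borel (frag_at g0) -> \bar R).

Local Notation delta := ((b - a) / 2).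
Let delta0 : 0 < delta. Proof. by rewrite divr_gt0// subr_gt0. Qed.

Variable C : nat -> set (frag X).
Hypothesis C_splits : forall j, splits (family delta u) (C j).
Hypothesis C_approx : forall e, 0 < e -> exists j, (P (~` C j) <= e%:E)%E.

Definition pos_part n j : set (frag_at g0) := C j `&` cell_pos delta n.

Local Notation K := pos_part.
Local Notation f := (normal_piece a b u : nat -> frag_at g0 -> frag_at g0).
Local Notation src := (source K).
Local Notation tgt := (target K f).
Local Notation inv := (inverse K f).

Lemma src_pos n g : src n g -> cell_pos delta n g.
Proof. by move=> [j _ []]. Qed.

Lemma compact_pos_part n j : compact (K n j).
Proof. by have [_ /(_ (cell_code n))[+ _]] := C_splits j; rewrite family_cell. Qed.

Lemma normal_piece_continuous n j : {within K n j, continuous (f n)}.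
Proof.
apply/subspace_continuousP => g [Cg gn]; apply/cvg_ballP => e e0.
have := near_normal_piece ab u_dense (C_splits j) Cg gn e0.
rewrite !near_withinE; apply: filterS => h hC [Ch hn].
exact: hC.
Qed.

Lemma normal_piece_src_inj n m g h : src n g -> src m h -> f n g = f m h -> n = m /\ g = h.
Proof. by move=> /src_pos gn /src_pos hm; exact: normal_piece_inj. Qed.

Lemma measurable_cell_pos n : measurable (cell_pos delta n : set (borel (frag_at g0))).
Proof. by rewrite -(family_cell delta u); exact: measurable_family. Qed.

Let measurable_C j : measurable (C j : set (borel (frag_at g0))).
Proof.
apply: (@closed_borel (frag_at g0)); apply: compact_closed; first exact: hausdorff_frag.
by case: (C_splits j).
Qed.

Let hS : hausdorff_space (frag_at g0). Proof. exact: hausdorff_frag. Qed.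

Let msrc n : measurable (src n : set (borel (frag_at g0))).
Proof. by apply: measurable_source => //; exact: compact_pos_part. Qed.

(** The C j need not be nested, so that continuity of P along unions says
    nothing here; what K n j misses is in the complement of C j. *)
Lemma pos_part_approx n e : 0 < e -> exists j, (P (src n `\` K n j) <= e%:E)%E.
Proof.
move=> /C_approx[j Pj]; exists j; apply: le_trans Pj; apply: le_measure; rewrite ?inE.
- apply: measurableD => //; apply: measurableI => //.
  exact: measurable_cell_pos.
- exact: measurableC.
- by move=> g [/src_pos gn ngK] Cg; apply: ngK; split.
Qed.

Lemma cell_pos_src n : P (cell_pos delta n `\` src n) = 0%E.
Proof.
have m0 : measurable (cell_pos delta n `\` src n : set (borel (frag_at g0))).
  by apply: measurableD => //; exact: measurable_cell_pos.
apply/eqP; rewrite eq_le measure_ge0 andbT; apply/lee_addgt0Pr => e e0.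
have [j Pj] := C_approx e0; rewrite add0e; apply: le_trans Pj.
apply: le_measure; rewrite ?inE//; first exact: measurableC.
by move=> g [gn ng] Cg; apply: ng; exists j.
Qed.

Lemma ex_cell_pos (g : frag X) : exists n, cell_pos delta n g.
Proof.
apply: contrapT => /forallNP npos.
have : (@lebesgue_measure R (dom g) <= \sum_(n <oo) @lebesgue_measure R (dom g `&` cell delta n))%E.
  apply: measure_sigma_subadditive => [n||t gt].
  - by apply: compact_measurable; apply: compact_domI; exact: closed_cell.
  - by apply: compact_measurable; exact: dom_compact.
  - by have [n tn] := cell_cover delta0 t; exists n.
rewrite eseries0 ?leNgt ?dom_gt0// => n _ _.
by apply/eqP; rewrite eq_le measure_ge0 andbT leNgt; apply/negP; exact: npos.
Qed.

Lemma src_gt0 : (0 < P (\bigcup_n src n))%E.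
Proof.
have [j Pj] := C_approx (e := 2^-1) ltac:(by rewrite invr_gt0).
apply: (@lt_le_trans _ _ (P (C j))).
  have := probability_setC P (measurable_C j).
  move: Pj => /[swap] ->; rewrite -(fineK (x := P (C j))); last by rewrite fin_num_measure.
  by rewrite -EFinB lee_fin lte_fin; lra.
apply: le_measure; rewrite ?inE//; first exact: bigcupT_measurable.
by move=> g Cg; have [n gn] := ex_cell_pos g; exists n => //; exists j.
Qed.

Local Notation w := (weight P K).

Variable P' : probability (borel (frag_at g0)) R.
Hypothesis P'E : forall F : borel (frag_at g0) -> \bar R,
  measurable_fun setT F -> (forall y, (0 <= F y)%E) ->
  (\int[P']_y F y = \sum_(n <oo) (w n)%:E * \int[P]_(x in src n) F (f n x))%E.

Lemma regular_moved : regular_measure P'.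
Proof.
apply: (transport_regular hS hS regP compact_pos_part normal_piece_continuous _ _ P'E).
- exact: pos_part_approx.
- exact: src_gt0.
Qed.

Lemma moved_ae (Q : frag X -> Prop) (Q' : frag X -> Prop) : {ae P, forall g, Q g} ->
  (forall n g, src n g -> Q g -> Q' (f n g)) -> {ae P', forall g, Q' g}.
Proof.
move=> PQ QQ'.
apply: (transport_ae hS hS compact_pos_part normal_piece_continuous _ P'E PQ).
- exact: normal_piece_src_inj.
- exact: QQ'.
Qed.

Let hoc n : set (measurableTypeR R) := half_open_cell delta n.

Let mhoc n : measurable (hoc n). Proof. exact: measurable_half_open_cell. Qed.

Let mphoc n (g : frag X) : measurable (param g @^-1` hoc n).
Proof. by rewrite -[X in measurable X]setTI; apply: measurable_param. Qed.

(** The parameters that dom g has in the cell form a null set. *)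
Lemma nu_cell0 n (g : frag X) : ~ cell_pos delta n g -> nu g (param g @^-1` hoc n) = 0%E.
Proof.
move=> ng; rewrite (nu_image nu_ac)//.
have mN : measurable (dom g `&` cell delta n : set (measurableTypeR R)).
  by apply: compact_measurable; apply: compact_domI; exact: closed_cell.
apply: (@subset_measure0 _ _ _ (nu g) _ (param g @^-1` (dom g `&` cell delta n))).
- by apply: measurableI => //; exact: measurable_image_frag.
- by rewrite -[X in measurable X]setTI; apply: measurable_param.
- move=> x [xn [t gt tx]]; move: xn; rewrite /= -tx paramK// => tn.
  by split => //; exact: half_open_cell_sub.
apply: (nu_null nu_ac) => //; exists (dom g `&` cell delta n); split => //.
by apply/eqP; rewrite eq_le measure_ge0 andbT leNgt; apply/negP.
Qed.

Let G (k : borel (frag_at g0) * (measurableTypeR R * borel X) -> \bar R) n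
    (g : borel (frag_at g0)) : \bar R :=
  (\int[nu g]_(x in param (g : frag X) @^-1` hoc n) k (g, lift (g : frag X) x))%E.

Let measurable_slice (k : borel (frag_at g0) * (measurableTypeR R * borel X) -> \bar R)
  (g : frag X) : measurable_fun setT k ->
  measurable_fun [set: borel X] (fun x => k (g, lift g x)).
Proof.
move=> mk; apply: (measurableT_comp mk).
by apply/measurable_fun_pair; [exact: measurable_cst|exact: measurable_lift].
Qed.

Let measurable_G k n : (forall z, (0 <= k z)%E) -> measurable_fun setT k ->
  measurable_fun setT (G k n).
Proof.
move=> k0 mk.
pose k' (z : borel (frag_at g0) * (measurableTypeR R * borel X)) : \bar R :=
  (k z * (\1_(hoc n) z.2.1)%:E)%E.
have mk' : measurable_fun setT k'.
  apply: emeasurable_funM => //; apply/measurable_EFinP.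
  apply: (@measurableT_comp _ _ _ _ _ _ (\1_(hoc n) : measurableTypeR R -> R)) => //.
  by apply: (measurableT_comp measurable_fst); exact: measurable_snd.
have k'0 z : (0 <= k' z)%E by rewrite mule_ge0// lee_fin.
apply: eq_measurable_fun (measurable_nu_integral nu_ac nu_itv k'0 mk') => g _.
rewrite /G [RHS]integral_mkcond; apply: eq_integral => x _; rewrite /k'/= patchE indicE.
by change (x \in param (g : frag X) @^-1` hoc n) with (param (g : frag X) x \in hoc n);
  case: ifPn => _; rewrite ?mule1 ?mule0.
Qed.

Let G_ge0 k n g : (forall z, (0 <= k z)%E) -> (0 <= G k n g)%E.
Proof. by move=> k0; apply: integral_ge0 => x _; exact: k0. Qed.

Lemma moved_integral (k : nat -> borel (frag_at g0) * (measurableTypeR R * borel X) -> \bar R)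
    (F : borel (frag_at g0) -> \bar R) :
  (forall n z, (0 <= k n z)%E) -> (forall n, measurable_fun setT (k n)) ->
  (forall n g, src n g -> F (f n g) = ((w n)^-1%:E *
     \int[nu g]_(x in param (g : frag X) @^-1` hoc n) k n (g, lift (g : frag X) x))%E) ->
  (forall y, (forall n, ~ tgt n y) -> F y = 0%E) ->
  measurable_fun setT F /\
  (\int[P']_y F y = \sum_(n <oo) \int[P]_(x in src n) G (k n) n x)%E.
Proof.
move=> k0 mk FG F0.
apply: (transport_integral hS hS compact_pos_part normal_piece_continuous _ _ P'E (G := fun n
    => G (k n) n)) => //.
- exact: normal_piece_src_inj.
- exact: src_gt0.
- by move=> n; exact: measurable_G.
- by move=> n x; exact: G_ge0.
Qed.

(** The inverse weights in F cancel the weights in P', and the half-open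
    cells partition the parameters, so the sum over n restores the integral
    over the whole of nu g. *)
Lemma moved_integralE (k : borel (frag_at g0) * (measurableTypeR R * borel X) -> \bar R)
    (F : borel (frag_at g0) -> \bar R) :
  (forall z, (0 <= k z)%E) -> measurable_fun setT k ->
  (forall n g, src n g -> F (f n g) = ((w n)^-1%:E *
     \int[nu g]_(x in param (g : frag X) @^-1` hoc n) k (g, lift (g : frag X) x))%E) ->
  (forall y, (forall n, ~ tgt n y) -> F y = 0%E) ->
  (\int[P']_y F y = \int[P]_g \int[nu g]_x k (g, lift (g : frag X) x))%E.
Proof.
move=> k0 mk FG F0.
have [_ ->] := moved_integral (fun=> k0) (fun=> mk) FG F0.
transitivity (\sum_(n <oo) \int[P]_g G k n g)%E.
  apply: eq_eseriesr => n _.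
  transitivity (\int[P]_(g in cell_pos delta n) G k n g)%E.
    rewrite [RHS](ge0_negligible_integral (N := (cell_pos delta n `\` src n : set (borel
        (frag_at g0)))) _ _ _ _ (cell_pos_src n)).
    - by rewrite setDD setIidr// => g; exact: src_pos.
    - by apply: measurableD => //; exact: measurable_cell_pos.
    - exact: measurable_cell_pos.
    - by apply: measurable_funTS; exact: measurable_G.
    - by move=> g _; exact: G_ge0.
  rewrite integral_mkcond; apply: eq_integral => g _; rewrite patchE.
  case: ifPn => // /negP gn; rewrite /G.
  rewrite null_set_integral//; first by apply: measurable_funTS; exact: measurable_slice.
  by apply: nu_cell0 => gp; apply: gn; exact: mem_set.
rewrite -integral_nneseries//; last 2 first.
- by move=> n; exact: measurable_G.
- by move=> n g _; exact: G_ge0.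
apply: eq_integral => g _; rewrite /G -ge0_integral_bigcup//.
- congr integral; first by rewrite -preimage_bigcup bigcup_half_open_cell preimage_setT.
- by apply: measurable_funTS; exact: measurable_slice.
- apply/trivIsetP => i j _ _ ij; rewrite -preimage_setI.
  have tri : trivIset setT hoc := @trivIset_half_open_cell R delta.
  by move/trivIsetP: tri => /(_ i j) ->; rewrite ?preimage_set0.
Qed.

(** Since normal pieces determine n and g, the values prescribed on the
    targets do not conflict. *)
Lemma ex_moved_measure : exists nu' : frag X -> {finite_measure set (borel X) -> \bar R},
  (forall n g, src n g -> forall B, measurable B ->
     nu' (f n g) B = ((w n)^-1%:E * nu g (B `&` param g @^-1` hoc n))%E) /\
  (forall y, (forall n, ~ tgt n y) -> forall B, nu' y B = 0%E).
Proof.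
have /choice[nu' nu'P] : forall y : frag X, exists m : {finite_measure set (borel X) -> \bar R},
   (forall n, tgt n y -> forall B, measurable B ->
     m B = ((w n)^-1%:E * nu (inv n y) (B `&` param (inv n y : frag X) @^-1` hoc n))%E) /\
   ((forall n, ~ tgt n y) -> forall B, m B = 0%E).
  move=> y; have [[n ny]|nt] := pselect (exists n, tgt n y); last first.
    by exists mzero; split => // n ny; exfalso; apply: nt; exists n.
  have wn0 : 0 <= (w n)^-1.
    by rewrite invr_ge0 ltW// weight_gt0//; [exact: compact_pos_part|exact: src_gt0].
  pose m0 := mscale (NngNum wn0) (mrestr (nu (inv n y)) (mphoc n (inv n y))).
  have m0T : fin_num_fun m0.
    move=> B mB; rewrite /m0 /mscale/=; apply: fin_numM => //.
    by rewrite /mrestr fin_num_measure//; exact: measurableI.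
  pose m : {finite_measure set (borel X) -> \bar R} := HB.pack (Measure.sort m0)
    (@Measure_isFinite.Build _ _ _ m0 m0T).
  exists m; split => [k ky B mB|nk]; last by case: (nk n).
  suff -> : k = n by [].
  have [nx fnx] := target_inverse normal_piece_src_inj ny.
  have [kx fx] := target_inverse normal_piece_src_inj ky.
  by move: fx; rewrite -[RHS]fnx => /(normal_piece_src_inj kx nx)[].
exists nu'; split=> [n g ng B mB|y yn B]; last by case: (nu'P y) => _; exact.
have [+ _] := nu'P (f n g) => /(_ n) -> //; last by exists g.
by rewrite (inverseK normal_piece_src_inj).
Qed.

Variable nu' : frag X -> {finite_measure set (borel X) -> \bar R}.
Hypothesis nu'E : forall n g, src n g -> forall B, measurable B ->
  nu' (f n g) B = ((w n)^-1%:E * nu g (B `&` param g @^-1` hoc n))%E.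
Hypothesis nu'0 : forall y, (forall n, ~ tgt n y) -> forall B, nu' y B = 0%E.

Let w_inv_ge0 n : 0 <= (w n)^-1.
Proof.
by rewrite invr_ge0 ltW// weight_gt0//; [exact: compact_pos_part|exact: src_gt0].
Qed.

Lemma moved_nu_integral n g (h : borel X -> \bar R) : src n g ->
  measurable_fun setT h -> (forall x, (0 <= h x)%E) ->
  (\int[nu' (f n g)]_x h x =
    (w n)^-1%:E * \int[nu g]_(x in param (g : frag X) @^-1` hoc n) h x)%E.
Proof.
move=> gn mh h0.
transitivity (\int[mscale (NngNum (w_inv_ge0 n)) (mrestr (nu g) (mphoc n g))]_x h x)%E.
  by apply: eq_measure_integral => B mB _; exact: nu'E.
by rewrite ge0_integral_mscale// ge0_integral_mrestr.
Qed.

Lemma moved_nu_off (y : frag_at g0) (h : borel X -> \bar R) :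
  (forall n, ~ tgt n y) -> (\int[nu' y]_x h x = 0)%E.
Proof.
move=> yn; transitivity (\int[mzero]_x h x)%E; last exact: integral_measure_zero.
by apply: eq_measure_integral => B mB _; exact: (nu'0 yn B).
Qed.

(** The image of the piece contains the part of the image of g over the
    half-open cell, and nu' lives on that part. *)
Lemma moved_ac (y : frag_at g0) : nu' y `<< (fun B : set (borel X) =>
  hausdorff1 (B `&` image_frag (y : frag X))).
Proof.
move=> A A0 B mB BA; have [[n ny]|nt] := pselect (exists n, tgt n y); last first.
  by apply: nu'0 => n ny; apply: nt; exists n.
move: ny A0 => [g gn <-] A0; rewrite nu'E//.
have -> : nu g (B `&` param g @^-1` hoc n) = 0%E; last by rewrite mule0.
apply: (nu_hausdorff0 nu_ac); first exact: measurableI.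
apply/eqP; rewrite eq_le hausdorff1_ge0 andbT -(A0 B mB BA).
apply: le_hausdorff1 => x [[Bx xn] gx]; split => //.
have Tg : is_piece g (cell delta n) (translate a b u n g) (f n g).
  by apply: normal_pieceP => //; exact: src_pos gn.
rewrite image_fragE (image_piece Tg).
move: gx xn => [t gt <-]; rewrite /= paramK// => tn.
by exists t => //; split => //; split => //; exact: half_open_cell_sub.
Qed.

Lemma measurable_moved_nu_integral (h : borel X -> \bar R) :
  measurable_fun setT h -> (forall x, (0 <= h x)%E) ->
  measurable_fun [set: borel (frag_at g0)]
    ((fun y => \int[nu' y]_x h x)%E : borel (frag_at g0) -> \bar R).
Proof.
move=> mh h0; pose k (n : nat) (z : borel (frag_at g0) * (measurableTypeR R * borel X)) := h z.2.2.
have mk n : measurable_fun setT (k n).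
  by apply: (measurableT_comp mh); apply: (measurableT_comp measurable_snd); exact: measurable_snd.
have [] // := @moved_integral k (fun y : frag_at g0 => \int[nu' y]_x h x)%E _ mk.
- by move=> n z; exact: h0.
- by move=> n g gn; exact: moved_nu_integral.
- by move=> y yn; exact: moved_nu_off.
Qed.

(** Parameters of the piece in [c, d] are parameters of g in a translate of
    [c, d], and the translation is measurable in g. *)
Lemma measurable_moved_nu_itv (B : set (borel X)) (c d : R) : measurable B ->
  measurable_fun [set: borel (frag_at g0)]
    ((fun y : frag X => nu' y (B `&` y @` (dom y `&` `[c, d]))) :
       borel (frag_at g0) -> \bar R).
Proof.
move=> mB.
pose k n (z : borel (frag_at g0) * (measurableTypeR R * borel X)) : \bar R :=
  (\1_(`[c, d]%classic) (z.2.1 - translate a b u n z.1) * \1_B z.2.2)%:E.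
have mfst : measurable_fun setT (fun z : borel (frag_at g0) * (measurableTypeR R * borel X) =>
    z.2.1).
  by apply: (measurableT_comp measurable_fst); exact: measurable_snd.
have mk n : measurable_fun setT (k n).
  apply/measurable_EFinP; apply: measurable_funM.
    apply: (@measurableT_comp _ _ _ _ _ _ (\1_(`[c, d]%classic) : measurableTypeR R -> R)) => //.
    apply: measurable_funB => //.
    have mt : measurable_fun [set: borel (frag_at g0) * (measurableTypeR R * borel X)]
        ((translate a b u n : borel (frag_at g0) -> measurableTypeR R) \o fst).
      by apply: (measurableT_comp (@measurable_translate R X a b u g0 n)); exact: measurable_fst.
    exact: mt.
  apply: (@measurableT_comp _ _ _ _ _ _ (\1_B : borel X -> R)) => //.
  by apply: (measurableT_comp measurable_snd); exact: measurable_snd.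
have k0 n z : (0 <= k n z)%E by rewrite lee_fin mulr_ge0.
have [] // := moved_integral k0 mk _ (F := fun y : frag_at g0 =>
  nu' y (B `&` (y : frag X) @` (dom y `&` `[c, d]))).
  move=> n g gn; have Tg : is_piece g (cell delta n) (translate a b u n g) (f n g).
    by apply: normal_pieceP => //; exact: src_pos gn.
  have mI : measurable (f n g @` (dom (f n g) `&` `[c, d]) : set (borel X)).
    by apply: borel_image_frag; exact: interval_closed.
  rewrite nu'E//; last exact: measurableI.
  congr (_ * _)%E.
  pose A : set (borel X) := B `&` param (g : frag X) @^-1` [set t | `[c, d]%classic (t -
      translate a b u n g)].
  have mA : measurable A.
    apply: measurableI => //.
    rewrite -[X in measurable X]setTI; apply: measurable_param => //.
    rewrite -[X in measurable X]setTI.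
    have : measurable_fun [set: measurableTypeR R] ((fun t => t - translate a b u n g) :
        measurableTypeR R -> measurableTypeR R).
      by apply: measurable_funB; [exact: measurable_id|exact: measurable_cst].
    by apply => //; exact: measurable_itv.
  transitivity (\int[nu g]_(x in param (g : frag X) @^-1` hoc n) (\1_A x)%:E)%E; last first.
    apply: eq_integral => x _; rewrite /k/=; congr EFin; rewrite !indicE -natrM mulnb.
    congr (_%:R); congr nat_of_bool.
    apply/idP/idP => [/set_mem[Bx xt]|/andP[/set_mem xt /set_mem Bx]].
      by apply/andP; split; exact: mem_set.
    by apply: mem_set; split.
  rewrite integral_indic// (nu_image nu_ac)//; last by apply: measurableI => //; exact: measurableI.
  rewrite [RHS](nu_image nu_ac)//; last exact: measurableI.
  congr (nu g _); rewrite (image_piece Tg); apply/seteqP; split=> x.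
    move=> [[[Bx [t [gt [nt tcd]] tx]] xn] gx]; split => //; split => //; split => //.
    by rewrite /= -tx paramK.
  move=> [[[Bx xt] xn] [t gt tx]]; move: xt xn; rewrite /= -tx paramK// => tcd tn.
  split; last by exists t.
  split => /=; last by [].
  split; first by move: Bx; rewrite /= -tx.
  by exists t => //; split => //; split => //; exact: half_open_cell_sub.
by move=> y yn; exact: nu'0.
Qed.

Lemma moved_measure (B : set (borel X)) : measurable B ->
  (\int[P']_y nu' y B = \int[P]_g nu g B)%E.
Proof.
move=> mB; pose k (z : borel (frag_at g0) * (measurableTypeR R * borel X)) : \bar R := (\1_B
    z.2.2)%:E.
rewrite (@moved_integralE k (fun y : frag_at g0 => nu' y B)).
- by apply: eq_integral => g _; rewrite /k/= integral_indic ?setIT.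
- by move=> z; rewrite lee_fin.
- apply/measurable_EFinP; apply: (@measurableT_comp _ _ _ _ _ _ (\1_B : borel X -> R)) => //.
  by apply: (measurableT_comp measurable_snd); exact: measurable_snd.
- by move=> n g gn; rewrite nu'E// /k/= integral_indic.
- by move=> y yn; exact: nu'0.
Qed.

Lemma moved_rep (m : {measure set (borel X) -> \bar R}) :
  (forall B : set (borel X), measurable B -> m B = (\int[P]_g nu g B)%E) ->
  alberti_rep m (alberti_pair P' nu').
Proof.
move=> mE; split.
- exact: regular_moved.
- split; first exact: moved_ac.
  move=> h ch _; have mh : measurable_fun [set: borel X] (h : borel X -> measurableTypeR R).
    apply: (measurability _ (RGenOpens.measurableE R)) => _ [_ [c [d ->]] <-].
    rewrite setTI; apply: open_borel; apply: open_comp => //; exact: interval_open.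
  have mEh : measurable_fun [set: borel X] (EFin \o h : borel X -> \bar R) by
      exact/measurable_EFinP.
  apply: (eq_measurable_fun (fun y : borel (frag_at g0) =>
     \int[nu' y]_x (EFin \o h)^\+ x - \int[nu' y]_x (EFin \o h)^\- x)%E).
    by move=> y _; rewrite [RHS]integralE.
  by apply: emeasurable_funB; apply: measurable_moved_nu_integral => //;
    [exact: measurable_funepos|exact: measurable_funeneg].
- by move=> B mB; rewrite mE// moved_measure.
- by move=> B c d mB _; exact: measurable_moved_nu_itv.
Qed.

Section moved_derivation.
Variables (phi : X -> R) (M Lam : R).
Hypothesis phiM : forall x, `|phi x| <= M.
Hypothesis phi_cont : continuous phi.
Hypothesis Lam0 : 0 <= Lam.
Hypothesis phi_lip : {ae P, forall g, lip_along phi Lam g}.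
Variable m : {measure set (borel X) -> \bar R}.
Hypothesis mE : forall B : set (borel X), measurable B -> (m B = \int[P]_g nu g B)%E.
Variable h : borel X -> R.
Hypothesis h_int : m.-integrable setT (EFin \o h).

(** The integrand of the derivation with the derivative replaced by its
    measurable version. *)
Let rate (z : borel (frag_at g0) * (measurableTypeR R * borel X)) : \bar R :=
  (h z.2.2 * velocity phi Lam (z.1 : frag X) z.2.1)%:E.

Let mh : measurable_fun [set: borel X] h.
Proof. by have /integrableP[/measurable_EFinP] := h_int. Qed.

Let measurable_rate : measurable_fun setT rate.
Proof.
apply/measurable_EFinP; apply: measurable_funM.
  apply: (measurableT_comp mh).
  by apply: (measurableT_comp measurable_snd); exact: measurable_snd.
have mv : measurable_fun [set: borel (frag_at g0) * measurableTypeR R]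
    ((fun z => velocity phi Lam (z.1 : frag X) z.2) :
       borel (frag_at g0) * measurableTypeR R -> measurableTypeR R).
  exact: (measurable_velocity phiM).
have mz : measurable_fun setT (fun z : borel (frag_at g0) * (measurableTypeR R * borel X) =>
    (z.1, z.2.1)).
  apply/measurable_fun_pair; first exact: measurable_fst.
  by apply: (measurableT_comp measurable_fst); exact: measurable_snd.
exact: (measurableT_comp mv mz).
Qed.

Let velocity_ae (g : frag X) : lip_along phi Lam g ->
  exists N : set (measurableTypeR R), [/\ measurable N,
    nu g (param g @^-1` N) = 0%E & forall t, dom g t -> ~ N t ->
    partial_frag g phi (g t) = velocity phi Lam g t].
Proof.
move=> gL; have [N [mN N0 gN]] := partial_frag_velocity phiM Lam0 gL.
exists N; split => //; first by apply: (nu_null nu_ac) => //; exists N; split.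
by move=> t gt Nt; apply: contrapT => ne; apply: Nt; apply: gN => /(_ gt).
Qed.

Let integral_partial (g : frag X) : lip_along phi Lam g ->
  (\int[nu g]_x (h x * partial_frag g phi x)%:E =
   \int[nu g]_x rate^\+ (g, lift g x) - \int[nu g]_x rate^\- (g, lift g x))%E.
Proof.
move=> /velocity_ae[N [mN N0 gN]].
pose N' : set (borel X) := param g @^-1` N `|` ~` image_frag g.
have mpN : measurable (param g @^-1` N).
  by rewrite -[X in measurable X]setTI; apply: measurable_param.
have mN' : measurable N'.
  by apply: measurableU => //; apply: measurableC; exact: measurable_image_frag.
have N'0 : nu g N' = 0%E.
  rewrite (nu_image nu_ac)//; apply: (@subset_measure0 _ _ _ (nu g) _ (param g @^-1` N)) => //.
    by apply: measurableI => //; exact: measurable_image_frag.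
  by move=> x [[]].
rewrite (integral_null_modification (f2 := fun x => rate (g, lift g x)) mN' N'0).
  rewrite [LHS]integralE; congr (_ - _)%E; apply: eq_integral => x _.
    by rewrite !funeposE.
  by rewrite !funenegE.
move=> x /not_orP[Nx /contrapT[t gt tx]].
rewrite /rate/=; congr (_ * _)%:E; rewrite -tx paramK// gN//.
by move: Nx; rewrite /= -tx paramK.
Qed.

Definition origin (y : frag_at g0) : frag_at g0 :=
  xget point [set g | exists n, src n g /\ f n g = y].

Let originK n g : src n g -> origin (f n g) = g.
Proof.
move=> gn; rewrite /origin; case: xgetP => [_ -> [k [gk fk]]|/(_ g)/forallNP/(_ n)/not_andP[]//].
by have [_ ->] := normal_piece_src_inj gk gn fk.
Qed.

(** Inside the half-open cell, the derivative along the piece is the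
    derivative along g, except at the left end point of the cell, where the
    piece only sees one side. *)
Let integral_partial_moved n g : src n g -> lip_along phi Lam g ->
  (\int[nu' (f n g)]_x (h x * partial_frag (f n g) phi x)%:E =
   \int[nu' (f n g)]_x rate^\+ (g, lift (g : frag X) x) -
   \int[nu' (f n g)]_x rate^\- (g, lift (g : frag X) x))%E.
Proof.
move=> gn /velocity_ae[N [mN N0 gN]].
pose e : R := (cell_index n)%:~R * delta.
(* The last part of N1 is not charged because nu' only lives over the
   half-open cell. *)
pose N1 : set (measurableTypeR R) := N `|` [set e] `|` ~` hoc n.
have mN1 : measurable N1.
  apply: measurableU; last exact: measurableC.
  by apply: measurableU => //; exact: measurable_set1.
pose N' : set (borel X) := param (g : frag X) @^-1` N1 `|` ~` image_frag (g : frag X).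
have mpN (V : set (measurableTypeR R)) : measurable V -> measurable (param (g : frag X) @^-1` V).
  by move=> mV; rewrite -[X in measurable X]setTI; apply: measurable_param.
have mN' : measurable N'.
  by apply: measurableU; [exact: mpN|apply: measurableC; exact: measurable_image_frag].
have N'0 : nu' (f n g) N' = 0%E.
  rewrite nu'E// [X in (_ * X)%E](_ : _ = 0%E) ?mule0//.
  rewrite (nu_image nu_ac)//; last exact: measurableI.
  apply: (@subset_measure0 _ _ _ (nu g) _ (param (g : frag X) @^-1` (N `|` [set e]))) => //.
  - by apply: measurableI; [exact: measurableI|exact: measurable_image_frag].
  - by apply: mpN; apply: measurableU => //; exact: measurable_set1.
  - by move=> x [[[[|]|]]].
  apply/eqP; rewrite eq_le measure_ge0 andbT preimage_setU.
  apply: (le_trans (measureU2 (nu g) (mpN _ mN) (mpN _ (measurable_set1 e)))).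
  apply: (@le_trans _ _ (0 + 0)%E); last by rewrite adde0.
  have eq_le0 (x : \bar R) : x = 0%E -> (x <= 0)%E by move=> ->.
  apply: leeD; first exact: (eq_le0 _ N0).
  apply: eq_le0; apply: (nu_null nu_ac) => //.
  by exists [set e]; split; [exact: measurable_set1|exact: lebesgue_measure_set1|].
rewrite (integral_null_modification (f2 := fun x => rate (g, lift (g : frag X) x)) mN' N'0).
  rewrite [LHS]integralE; congr (_ - _)%E; apply: eq_integral => x _.
    by rewrite !funeposE.
  by rewrite !funenegE.
move=> x /not_orP[/not_orP[/not_orP[Nx ex] /contrapT nx] /contrapT[t gt tx]].
move: Nx ex nx; rewrite /= -tx paramK// => Nt et nt.
rewrite /rate/= paramK//; congr (_ * _)%:E; rewrite -gN//.
have Tg : is_piece g (cell delta n) (translate a b u n g) (f n g).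
  by apply: normal_pieceP => //; exact: src_pos gn.
apply: (partial_frag_piece Tg) => //.
exact: (half_open_cell_interior delta0 nt et).
Qed.

Let moved (k : borel (frag_at g0) * (measurableTypeR R * borel X) -> \bar R)
    (y : borel (frag_at g0)) : \bar R :=
  (\int[nu' y]_x k (origin y, lift (origin y : frag X) x))%E.

Let integral_moved (k : borel (frag_at g0) * (measurableTypeR R * borel X) -> \bar R) :
  (forall z, (0 <= k z)%E) -> measurable_fun setT k ->
  measurable_fun setT (moved k) /\
  (\int[P']_y moved k y = \int[P]_g \int[nu g]_x k (g, lift (g : frag X) x))%E.
Proof.
move=> k0 mk.
have on n g : src n g -> moved k (f n g) = ((w n)^-1%:E *
     \int[nu g]_(x in param (g : frag X) @^-1` hoc n) k (g, lift (g : frag X) x))%E.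
  move=> gn; rewrite /moved (originK gn).
  exact: (moved_nu_integral gn (measurable_slice g mk) (fun x => k0 _)).
have off y : (forall n, ~ tgt n y) -> moved k y = 0%E by exact: moved_nu_off.
split; last exact: moved_integralE.
by have [] := moved_integral (fun=> k0) (fun=> mk) on off.
Qed.

Let measurable_unmoved (k : borel (frag_at g0) * (measurableTypeR R * borel X) -> \bar R) :
  (forall z, (0 <= k z)%E) -> measurable_fun setT k ->
  measurable_fun [set: borel (frag_at g0)]
    ((fun g : frag X => \int[nu g]_x k (g, lift g x))%E : borel (frag_at g0) -> \bar R).
Proof. exact: measurable_nu_integral. Qed.

(** The velocity is bounded by Lam, so this is at most Lam times the integral
    of the absolute value of h against the represented measure. *)
Let unmoved_lty (k : borel (frag_at g0) * (measurableTypeR R * borel X) -> \bar R) :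
  (forall z, (0 <= k z)%E) -> measurable_fun setT k -> (forall z, (k z <= `|rate z|)%E) ->
  (\int[P]_g \int[nu g]_x k (g, lift (g : frag X) x) < +oo)%E.
Proof.
move=> k0 mk kr.
have mah : measurable_fun [set: borel X] (fun x => Lam%:E * `|(h x)%:E|)%E.
  apply: emeasurable_funM; first exact: measurable_cst.
  by apply: measurableT_comp => //; exact/measurable_EFinP.
have ah0 x : (0 <= Lam%:E * `|(h x)%:E|)%E by rewrite mule_ge0.
apply: (@le_lt_trans _ _ (\int[P]_g \int[nu g]_x (Lam%:E * `|(h x)%:E|))%E).
  apply: ge0_le_integral => //.
  - by move=> g _; apply: integral_ge0.
  - exact: measurable_unmoved.
  - exact: (measurable_nu_fun nu_ac nu_itv).
  - move=> g _; apply: ge0_le_integral => //; first exact: measurable_slice.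
    move=> x _; apply: (le_trans (kr _)); rewrite /rate/= -EFinM lee_fin normrM mulrC.
    by rewrite ler_wpM2r//; exact: velocity_bound.
rewrite -(integral_disintegration nu_ac nu_itv mE)//.
rewrite ge0_integralZl//; last by apply: measurableT_comp => //; exact/measurable_EFinP.
rewrite lte_mul_pinfty//.
by have /integrableP[] := h_int.
Qed.

(** Almost every fragment turns the inner integrals into differences of
    integrals of the positive and negative parts of rate, which are
    measurable and finite; the change of variables applies to each part. *)
Lemma derivation_integral_moved :
  derivation_integral (alberti_pair P' nu') phi h = derivation_integral (alberti_pair P nu) phi h.
Proof.
have p0 z : (0 <= rate^\+ z)%E by exact: funepos_ge0.
have n0 z : (0 <= rate^\- z)%E by exact: funeneg_ge0.
have mp : measurable_fun [set: borel (frag_at g0) * (measurableTypeR R * borel X)] (rate^\+)%E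
    by exact: measurable_funepos.
have mn : measurable_fun [set: borel (frag_at g0) * (measurableTypeR R * borel X)] (rate^\-)%E
    by exact: measurable_funeneg.
have rE z : `|rate z|%E = (rate^\+ z + rate^\- z)%E by rewrite -/((abse \o rate) z) fune_abse.
have pr z : (rate^\+ z <= `|rate z|)%E by rewrite rE leeDl.
have nr z : (rate^\- z <= `|rate z|)%E by rewrite rE leeDr.
have [mPp Pp] := integral_moved p0 mp; have [mPn Pn] := integral_moved n0 mn.
have fp := unmoved_lty p0 mp pr; have fn := unmoved_lty n0 mn nr.
have int_ge0 (Q : probability (borel (frag_at g0)) R) (F : borel (frag_at g0) -> \bar R) :
    measurable_fun setT F -> (forall y, (0 <= F y)%E) -> (\int[Q]_y F y < +oo)%E ->
    Q.-integrable setT F.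
  move=> mF F0 Foo; apply/integrableP; split => //.
  by under eq_integral do rewrite gee0_abs//.
rewrite /derivation_integral.
transitivity (\int[P']_y (moved rate^\+ y - moved rate^\- y))%E.
  apply: integral_ae_eq; apply: (moved_ae phi_lip) => n g gn gL.
  by rewrite (integral_partial_moved gn gL) /moved (originK gn).
transitivity (\int[P]_g (\int[nu g]_x rate^\+ (g, lift (g : frag X) x) -
    \int[nu g]_x rate^\- (g, lift (g : frag X) x)))%E; last first.
  by apply/esym/integral_ae_eq; apply: (negligibleS _ phi_lip) => g /=;
    apply: contra_not => gL; exact: integral_partial.
rewrite integralB//; last 2 first.
- by apply: int_ge0 => //; [move=> y; exact: integral_ge0|rewrite Pp].
- by apply: int_ge0 => //; [move=> y; exact: integral_ge0|rewrite Pn].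
rewrite Pp Pn; apply/esym.
have ip := int_ge0 P _ (measurable_unmoved p0 mp) (fun g => integral_ge0 _ (fun x _ => p0 _)) fp.
have im := int_ge0 P _ (measurable_unmoved n0 mn) (fun g => integral_ge0 _ (fun x _ => n0 _)) fn.
exact: (integralB measurableT ip im).
Qed.

End moved_derivation.

End moved_representation.

(** * Proof of the theorem *)

Lemma outside_measurable (R : realType) (X : completeMetricType R) (g0 : frag X) (a b : R) :
  measurable ([set g : frag X | ~ dom g `<=` `[a, b]%classic] : set (borel (frag_at g0))).
Proof.
rewrite (_ : [set g | _] = meets [set z : R * X | (~` `[a, b]%classic) z.1]).
  apply: (@open_borel (frag_at g0)); apply: open_meets; apply: open_fst.
  by apply: closed_openC; exact: interval_closed.
apply/seteqP; split=> g /=.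
  move=> ng; apply: contrapT => gm; apply: ng => t gt; apply: contrapT => tn; apply: gm.
  by exists (t, g t); split => //; exists t.
by move=> [_ [[t gt <-] /= nt]] gI; apply: nt; exact: gI.
Qed.

Lemma lipschitz_fun_continuous (R : realType) (X : completeMetricType R) (f : X -> R) :
  lipschitz_fun f -> continuous f.
Proof.
move=> [L fL] x; apply/cvgrPdist_lt => e e0.
have L0 : 0 < `|L| + 1 by rewrite ltr_wpDl.
have : nbhs x (ball x (e / (`|L| + 1))) by apply: nbhsx_ballx; rewrite divr_gt0.
apply: filterS => y; rewrite ballEmdist/= ltr_pdivlMr// => xy.
apply: (le_lt_trans (fL x y)); apply: le_lt_trans xy; rewrite mulrC ler_wpM2l//.
  exact: mdist_ge0.
by rewrite (le_trans (ler_norm _))// lerDl.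
Qed.

Lemma lipschitz_lip_along (R : realType) (X : completeMetricType R) (f : X -> R) (L C : R) (g :
    frag X) :
  (forall x y, `|f x - f y| <= L * mdist x y) -> lip_frag C g -> lip_along f (`|L| * `|C|) g.
Proof.
move=> fL gC s t gs gt; apply: (le_trans (fL _ _)).
rewrite -mulrA; apply: (@le_trans _ _ (`|L| * mdist (g s) (g t))).
  by rewrite ler_wpM2r ?mdist_ge0// ler_norm.
rewrite ler_wpM2l//; apply: (le_trans (gC _ _ gs gt)).
by rewrite ler_wpM2r// ler_norm.
Qed.

Theorem lemma3p41 (R : realType) (X : completeMetricType R)
    (sepX : separable X)
    (mu : {measure set (borel X) -> \bar R}) (radon_mu : radon mu)
    (S : set (borel X)) (mS : measurable S)
    (A : alberti_data X) (repA : alberti_rep (mrestr mu mS) A)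
    (lipA : lipschitz_alberti A)
    (a b : R) (ab : a < b) :
  exists A' : alberti_data X,
    [/\ alberti_rep (mrestr mu mS) A',
        lipschitz_alberti A',
        alberti_supported `[a, b]%classic A',
        (forall f : X -> R, (exists M : R, forall x, `|f x| <= M) ->
           lipschitz_fun f ->
           derivation (mrestr mu mS) A' f = derivation (mrestr mu mS) A f) &
        [/\ (forall C : R, lip_alberti C A -> lip_alberti C A'),
            (forall C D : R, bilip_alberti C D A -> bilip_alberti C D A'),
            (forall f delta : X -> R, lipschitz_fun f ->
               measurable_fun [set: borel X] (delta : borel X -> R) ->
               speed_alberti f delta A -> speed_alberti f delta A') &
            (forall (q : nat) (f v : X -> 'rV[R]_q) (alpha : X -> R),
               lipschitz_vec f ->
               (forall x, norm2 (v x) = 1) ->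
               (forall i : 'I_q, measurable_fun [set: borel X]
                  ((fun x => v x 0 i) : borel X -> R)) ->
               (forall x, 0 < alpha x < pi / 2) ->
               measurable_fun [set: borel X] (alpha : borel X -> R) ->
               direction_alberti f v alpha A ->
               direction_alberti f v alpha A')]].
Proof.
case: A repA lipA => [triv_mu _|g0 P nu [regP [nu_ac _] muE nu_itv] lipA].
  by exists (alberti_triv X); split => //; exists 0.
have [u u_dense] := dense_seq sepX.
have delta0 : 0 < (b - a) / 2 by rewrite divr_gt0// subr_gt0.
have hT : hausdorff_space (frag_at g0) by exact: hausdorff_frag.
have /choice[C CP] : forall j : nat, exists C : set (frag_at g0),
    splits (family ((b - a) / 2) u : nat -> set (frag_at g0)) C /\ (P (~` C) <= (j.+1%:R^-1)%:E)%E.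
  move=> j; apply: (splitting_compact hT regP); last by rewrite invr_gt0.
  by move=> k; exact: measurable_family.
have C_splits j : splits (family ((b - a) / 2) u) (C j) by case: (CP j).
have C_approx (e : R) : 0 < e -> exists j, (P (~` C j) <= e%:E)%E.
  move=> e0; exists (Num.truncn e^-1); case: (CP (Num.truncn e^-1)) => _ /le_trans; apply.
  by rewrite lee_fin -[leRHS]invrK lef_pV2 ?posrE ?invr_gt0// ltW// truncnS_gt.
have [P' P'E] := ex_transport hT (compact_pos_part C_splits)
  (normal_piece_continuous ab u_dense C_splits) (src_gt0 ab C_splits C_approx).
have [nu' [nu'E nu'0]] := ex_moved_measure ab u_dense nu C_splits C_approx.
have moved_Q := moved_ae ab u_dense C_splits P'E.
have piece_of n (g : frag_at g0) : source (@pos_part R X a b g0 C) n g ->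
    is_piece g (cell ((b - a) / 2) n) (translate a b u n g) (normal_piece a b u n g).
  by move=> gn; apply: normal_pieceP => //; exact: src_pos gn.
exists (alberti_pair P' nu'); split.
- exact: (moved_rep ab u_dense regP nu_ac nu_itv C_splits C_approx P'E nu'E nu'0 muE).
- case: lipA => L lipA; exists L; apply: (moved_Q _ _ lipA) => n g gn.
  exact: (lip_piece (piece_of n g gn)).
- have P_true : {ae P, forall g : frag X, True} by exact: aeW.
  have [N [mN N0 IN]] : {ae P', forall g : frag X, dom g `<=` `[a, b]%classic}.
    by apply: (moved_Q _ _ P_true) => n g /src_pos gn _; exact: dom_normal_piece.
  by apply: (@subset_measure0 _ _ _ P' _ N) => //; exact: outside_measurable.
- move=> f [M fM] f_lip; have [L fL] := f_lip; have [D lipD] := lipA.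
  have f_along : {ae P, forall g, lip_along f (`|L| * `|D|) g}.
    by apply: (negligibleS _ lipD) => g /=; apply: contra_not => gD; exact: lipschitz_lip_along.
  have LD0 : 0 <= `|L| * `|D| by rewrite mulr_ge0.
  have eqD (h : borel X -> R) : (mrestr mu mS).-integrable setT (EFin \o h) ->
      derivation_integral (alberti_pair P' nu') f h = derivation_integral (alberti_pair P nu) f h.
    move=> h_int.
    exact: (derivation_integral_moved ab u_dense nu_ac nu_itv C_splits C_approx P'E nu'E nu'0 fM
      (lipschitz_fun_continuous f_lip) LD0 f_along muE h_int).
  by apply/seteqP; split=> k [kL kA]; split => // h mh hM h_int; rewrite kA// eqD.
split.
- by move=> D lipD; apply: (moved_Q _ _ lipD) => n g gn; exact: (lip_piece (piece_of n g gn)).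
- by move=> D E lipD; apply: (moved_Q _ _ lipD) => n g gn; exact: (bilip_piece (piece_of n g gn)).
- by move=> f d _ _ fd; apply: (moved_Q _ _ fd) => n g gn; exact: (ae_speed_piece (piece_of n g
    gn)).
move=> q f v alpha _ _ _ _ _ fv; apply: (moved_Q _ _ fv) => n g gn.
exact: (ae_direction_piece (piece_of n g gn)).
Qed.
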